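(* Let $X$ be a Banach space of genus 2 containing $c_0$ (i.e. containing a subspace isomorphic to $c_0$). Then there exists an unconditional finite dimensional decomposition $X\cong\sum_{n=1}^\infty\oplus E_n$ satisfying: (1) each $E_n$ has dimension $n$ and has an unconditional basis $(x_i^n)_{i=1}^n$; (2) $((x_i^n)_{i=1}^n)_{n=1}^\infty$ is an unconditional basis for $X$; (3) there is a constant $K\ge1$ such that for all $n<m$, $(x_i^n)_{i=1}^n\sim_K(x_i^m)_{i=1}^n$; (4) for all $n_1<n_2<\cdots$, $X\cong_K\sum_{i=1}^\infty\oplus E_{n_i}$ (with the same constant $K$ as in (3)).
   Context: Two sequences $(x_n)$, $(y_n)$ in Banach spaces are equivalent, $(x_n)\sim(y_n)$, if $Tx_n=y_n$ defines an isomorphism between their closed linear spans; they are $K$-equivalent, $(x_n)\sim_K(y_n)$, if for all finitely supported scalar sequences $(a_n)$ one has $\|\sum a_nx_n\|\le K\|\sum a_ny_n\|$ and $\|\sum a_ny_n\|\le K\|\sum a_nx_n\|$. They are permutatively equivalent if $(x_n)\sim(y_{\pi(n)})$ for some permutation $\pi$ of the index set. A Banach space has a unique normalized unconditional basis if it has a normalized unconditional basis and any two such bases are permutatively equivalent. A Banach space $X$ is of genus $n$ if $X$ and all its complemented subspaces with unconditional bases have a unique normalized unconditional basis, and there are, up to isomorphism, exactly $n$ different (infinite-dimensional) complemented subspaces of $X$ with unconditional bases ($X$ itself included in the count). For example, $\ell_1\oplus\ell_2$ is of genus 3. A sequence $(E_n)_{n=1}^\infty$ of finite dimensional subspaces of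 a Banach space $X$ is an unconditional finite dimensional decomposition for $X$ if for each $x\in X$ there is a unique choice of $x_n\in E_n$ with $x=\sum_{n=1}^\infty x_n$, the series being unconditionally convergent in $X$; one then writes $X\cong\sum_{n=1}^\infty\oplus E_n$. For a subsequence $(n_i)$, $\sum\oplus E_{n_i}$ denotes the closed linear span of the $E_{n_i}$ in $X$. $X\cong_K Y$ means that $X$ and $Y$ are $K$-isomorphic. *)

(* Defs.v *)
From HB Require Import structures.
From mathcomp Require Import all_boot all_order all_algebra.
From mathcomp Require Import all_classical all_reals all_analysis.
From mathcomp Require Import complex.

Set Implicit Arguments.
Unset Strict Implicit.
Unset Printing Implicit Defensive.

Import Order.TTheory GRing.Theory Num.Theory.
Import numFieldNormedType.Exports.

Local Open Scope classical_set_scope.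
Local Open Scope ring_scope.

(* Subspaces of a normed space X are sets [A : set X], so that X itself is
   [setT]; sequences are indexed from 0.  Norms take their values in the scalar
   field F, as always in MathComp-Analysis; when F = R[i], an inequality
   [1 <= K] forces K to be real. *)

Inductive real_or_complex (R : realType) : numFieldType -> Prop :=
| real_scalars : real_or_complex R R
| complex_scalars : real_or_complex R R[i].

Section Subspaces.
Context {F : numFieldType}.

Definition linear_subspace {X : lmodType F} (A : set X) : Prop :=
  A 0 /\ forall (a : F) (u v : X), A u -> A v -> A (a *: u + v).

Definition closed_span {X : normedModType F} (S : set X) : set X :=
  closure (smallest linear_subspace S).

Definition complemented {X : normedModType F} (A : set X) : Prop :=
  exists P : {linear X -> X},
    [/\ continuous P, forall x, P (P x) = P x & range P = A].

(* [T] is only relevant on [A]; the last two clauses say that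
   ||T|| <= c and ||T^-1|| <= d. *)
Definition isomorphism_bounds {X Y : normedModType F} (c d : F)
    (A : set X) (B : set Y) (T : X -> Y) : Prop :=
  [/\ forall (a : F) (u v : X), A u -> A v -> T (a *: u + v) = a *: T u + T v,
      T @` A = B,
      forall u, A u -> `|T u| <= c * `|u|
    & forall u, A u -> `|u| <= d * `|T u| ].

Definition isomorphism {X Y : normedModType F}
    (A : set X) (B : set Y) (T : X -> Y) : Prop :=
  exists c d : F, [/\ 0 <= c, 0 <= d & isomorphism_bounds c d A B T].

Definition isomorphic {X Y : normedModType F} (A : set X) (B : set Y) : Prop :=
  exists T : X -> Y, isomorphism A B T.

(* ||T|| ||T^-1|| <= K for some isomorphism T of A onto B *)
Definition K_isomorphic {X Y : normedModType F} (K : F)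
    (A : set X) (B : set Y) : Prop :=
  exists (T : X -> Y) (c d : F),
    [/\ 0 <= c, 0 <= d, c * d <= K & isomorphism_bounds c d A B T].

Definition c0 : set (nat -> F) := [set a | a @ \oo --> (0 : F)].

Definition c0_norm (a : nat -> F) : F := supremum 0 (range (fun n => `|a n|)).

(* [J] is an isomorphism of c_0 onto its image. *)
Definition contains_c0 (X : normedModType F) : Prop :=
  exists (J : (nat -> F) -> X) (c d : F),
    [/\ forall (t : F) (a b : nat -> F), c0 a -> c0 b ->
          J (fun n => t * a n + b n) = t *: J a + J b,
        0 <= c /\ 0 <= d,
        forall a, c0 a -> `|J a| <= c * c0_norm a
      & forall a, c0 a -> c0_norm a <= d * `|J a| ].

End Subspaces.

Section Bases.
Context {F : numFieldType}.

Definition unconditional_sum {X : normedModType F} (u : nat -> X) (x : X) :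
    Prop :=
  forall s : nat -> nat, bijective s -> series (u \o s) @ \oo --> x.

Definition unconditional_basis {X : normedModType F} (A : set X)
    (e : nat -> X) : Prop :=
  (forall n, A (e n)) /\
  forall x, A x -> exists a : nat -> F,
    unconditional_sum (fun n => a n *: e n) x /\
    forall b : nat -> F, series (fun n => b n *: e n) @ \oo --> x -> b = a.

(* Unconditional bases indexed by a countably infinite type: the choice of the
   enumeration is immaterial. *)
Definition unconditional_basis_family {X : normedModType F} (I : Type)
    (A : set X) (e : I -> X) : Prop :=
  exists phi : nat -> I, bijective phi /\ unconditional_basis A (e \o phi).

Definition normalized_unconditional_basis {X : normedModType F} (A : set X)
    (e : nat -> X) : Prop :=
  unconditional_basis A e /\ forall n, `|e n| = 1.

Definition has_unconditional_basis {X : normedModType F} (A : set X) : Prop :=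
  exists e : nat -> X, unconditional_basis A e.

Definition equivalent_seq {X Y : normedModType F}
    (x : nat -> X) (y : nat -> Y) : Prop :=
  exists T : X -> Y,
    isomorphism (closed_span (range x)) (closed_span (range y)) T /\
    forall n, T (x n) = y n.

Definition permutatively_equivalent {X Y : normedModType F}
    (x : nat -> X) (y : nat -> Y) : Prop :=
  exists s : nat -> nat, bijective s /\ equivalent_seq x (y \o s).

Definition K_equivalent {X Y : normedModType F} (I : finType) (K : F)
    (x : I -> X) (y : I -> Y) : Prop :=
  forall a : I -> F,
    `|\sum_i a i *: x i| <= K * `|\sum_i a i *: y i| /\
    `|\sum_i a i *: y i| <= K * `|\sum_i a i *: x i|.

Definition unique_normalized_unconditional_basis {X : normedModType F}
    (A : set X) : Prop :=
  (exists e : nat -> X, normalized_unconditional_basis A e) /\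
  forall e f : nat -> X,
    normalized_unconditional_basis A e -> normalized_unconditional_basis A f ->
    permutatively_equivalent e f.

(* A subspace with a basis indexed by nat is infinite dimensional, so only
   infinite-dimensional subspaces are considered here. *)
Definition genus (n : nat) (X : normedModType F) : Prop :=
  [/\ unique_normalized_unconditional_basis [set: X],
      forall A : set X, complemented A -> has_unconditional_basis A ->
        unique_normalized_unconditional_basis A
    & exists C : 'I_n -> set X,
        [/\ forall i, complemented (C i) /\ has_unconditional_basis (C i),
            forall i j, isomorphic (C i) (C j) -> i = j
          & forall A : set X, complemented A -> has_unconditional_basis A ->
              exists i, isomorphic A (C i) ] ].

(* A basis of a finite-dimensional space is automatically unconditional, the
   expansions being finite sums. *)
Definition finite_basis {X : lmodType F} (n : nat) (E : set X)
    (x : 'I_n -> X) : Prop :=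
  [/\ linear_subspace E, forall i, E (x i)
    & forall v, E v -> exists! a : 'I_n -> F, v = \sum_i a i *: x i ].

Definition has_dimension {X : lmodType F} (E : set X) (n : nat) : Prop :=
  exists x : 'I_n -> X, finite_basis E x.

Definition unconditional_fdd {X : normedModType F} (E : nat -> set X) : Prop :=
  (forall n, exists d, has_dimension (E n) d) /\
  forall x : X, exists u : nat -> X,
    [/\ forall n, E n (u n), unconditional_sum u x
      & forall v : nat -> X, (forall n, E n (v n)) ->
          series v @ \oo --> x -> v = u ].

End Bases.

(* Main.v *)
(* Let e be the normalized unconditional basis of X and phi(A) the norm of the sum
   of e over a finite set A.  Gliding hump and finite-dimensional Hahn-Banach give
   blocks of e equivalent to the basis of c_0 with norming functionals; hence X is
   isomorphic to X + c_0, and by uniqueness e has a subsequence equivalent to the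
   basis of c_0.  Genus 2 then says that a set M of indices with phi unbounded on M
   (a large set) carries a permuted copy of e.  If e itself is equivalent to the
   basis of c_0 there is nothing to do.  Otherwise, comparing lacunary unions of
   intervals shows that sets of bounded size and large phi occur arbitrarily far
   out, so there are disjoint blocks all of whose prefixes of a given length have
   large phi; a compactness argument makes prefixes of equal length equivalent.
   A diagonal argument makes the copies of e inside unions of rows uniform, and
   Schroeder-Bernstein turns them into K-isomorphisms. *)

(* Genus and uniqueness of bases give equivalences without any control of their constants; the
   difficulty is to make one [K] serve all subsequences of rows. A diagonal argument does this only
   if dropping the first rows costs an amount fixed before the diagonal sequence is known. Two
   features of the array serve that purpose. The n-th chosen row contributes only its first n+1
   entries, so the first k+1 rows supply at most (k+1)^2 indices whatever they are. And every row
   begins with an index of the copy of c_0, so these indices can be moved into the remaining rows,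
   at a cost depending on their number only. Because rows are truncated, largeness of a block is not
   enough: its prefixes must be large at a rate [r] common to all blocks, and this is why the large
   sets must have bounded size. Uniformity also has to be created at the start: a basis is defined
   by pointwise expansions, and its unconditional constant comes from a category argument in the
   complete space X. *)
Require Import Defs.
From HB Require Import structures.
From mathcomp Require complex.
From mathcomp Require Import all_boot all_order all_algebra.
From mathcomp Require Import all_classical all_reals all_analysis.
From mathcomp Require Import ring lra zify.

Set Implicit Arguments.
Unset Strict Implicit.
Unset Printing Implicit Defensive.

Import Order.TTheory GRing.Theory Num.Theory.
Import numFieldNormedType.Exports.

Local Open Scope classical_set_scope.
Local Open Scope ring_scope.

(* The scalar field F = R or R[i], seen through the embedding [emb] of the
   reals, so that norms can be given values in the totally ordered field R. *)
Class scalars (R : realType) (F : numFieldType) := Scalars {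
  emb : {rmorphism R -> F};
  emb_le : forall x y, (emb x <= emb y) = (x <= y);
  emb_nneg : forall z : F, 0 <= z -> exists r, z = emb r;
  unit_ball_split : exists2 u : F, `|u| <= 1 &
    forall z : F, `|z| <= 1 -> exists p q : R,
      [/\ `|p| <= 1, `|q| <= 1 & z = emb p + u * emb q];
  scalar_complete : forall u : nat -> F,
    (forall eps : R, 0 < eps -> exists N, forall m n, (N <= m)%N -> (N <= n)%N ->
       `|u m - u n| <= emb eps) ->
    exists l, forall eps : R, 0 < eps -> exists N, forall n, (N <= n)%N ->
       `|u n - l| <= emb eps }.

Section BanachSpaces.
Context {R : realType} {F : numFieldType} {S : scalars R F}.
Local Notation emb := (@emb R F S).

(** * Real-valued norms *)

Section RealNorm.
Lemma emb_inj : injective (emb : R -> F).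
Proof. by move=> x y e; apply/le_anti; rewrite -!emb_le e lexx. Qed.

Lemma emb_ge0 x : (0 <= emb x :> F) = (0 <= x).
Proof. by rewrite -[0](rmorph0 emb) emb_le. Qed.

Lemma emb_lt x y : (emb x < emb y :> F) = (x < y).
Proof. by rewrite !lt_def emb_le (inj_eq emb_inj). Qed.

Lemma emb_gt0 x : (0 < emb x :> F) = (0 < x).
Proof. by rewrite -[0 in LHS](rmorph0 emb) emb_lt. Qed.

Lemma emb_pos (z : F) : 0 < z -> exists2 r : R, 0 < r & z = emb r.
Proof.
by move=> z0; have [r zr] := emb_nneg (ltW z0); exists r; rewrite // -emb_gt0 -zr.
Qed.

Lemma norm_emb x : `|emb x : F| = emb `|x|.
Proof.
case: (leP 0 x) => h; first by rewrite !ger0_norm ?emb_ge0.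
by rewrite (ltr0_norm h) -normrN -rmorphN ger0_norm // emb_ge0; lra.
Qed.

Definition real_part_of (z : F) : R := xget 0 [set r | z = emb r].

Lemma real_part_ofK z : 0 <= z -> emb (real_part_of z) = z.
Proof.
move=> /emb_nneg [r ->]; rewrite /real_part_of.
by case: xgetP => [y _ /= <- //|/(_ r)] /=.
Qed.

Definition ab (a : F) : R := real_part_of `|a|.
Definition nm {V : normedModType F} (x : V) : R := real_part_of `|x|.

Lemma abE a : emb (ab a) = `|a|. Proof. by rewrite real_part_ofK. Qed.
Lemma nmE (V : normedModType F) (x : V) : emb (nm x) = `|x|.
Proof. by rewrite real_part_ofK. Qed.

Lemma ab_ge0 a : 0 <= ab a. Proof. by rewrite -emb_ge0 abE. Qed.
Lemma abM a b : ab (a * b) = ab a * ab b.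
Proof. by apply: emb_inj; rewrite rmorphM !abE normrM. Qed.
Lemma abV a : ab a^-1 = (ab a)^-1.
Proof. by apply: emb_inj; rewrite fmorphV !abE normfV. Qed.
Lemma abN a : ab (- a) = ab a.
Proof. by apply: emb_inj; rewrite !abE normrN. Qed.
Lemma ab0 : ab 0 = 0. Proof. by apply: emb_inj; rewrite abE normr0 rmorph0. Qed.
Lemma ab1 : ab 1 = 1. Proof. by apply: emb_inj; rewrite abE normr1 rmorph1. Qed.
Lemma ab_emb r : ab (emb r) = `|r|.
Proof. by apply: emb_inj; rewrite abE norm_emb. Qed.
Lemma abD a b : ab (a + b) <= ab a + ab b.
Proof. by rewrite -emb_le rmorphD !abE ler_normD. Qed.
Lemma ab_eq0 a : (ab a == 0) = (a == 0).
Proof.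
by apply/eqP/eqP => [h|->]; [apply/normr0_eq0; rewrite -abE h rmorph0|exact: ab0].
Qed.
Lemma ab_gt0 a : (0 < ab a) = (a != 0).
Proof. by rewrite lt_def ab_ge0 andbT ab_eq0. Qed.
Lemma ab_sum (I : finType) (P : pred I) (a : I -> F) :
  ab (\sum_(i | P i) a i) <= \sum_(i | P i) ab (a i).
Proof.
elim/big_ind2: _ => //; first by rewrite ab0.
by move=> x1 x2 y1 y2 h1 h2; apply: le_trans (abD _ _) (lerD h1 h2).
Qed.

Section Norm.
Context {V : normedModType F}.
Implicit Types x y : V.

Lemma nm_ge0 x : 0 <= nm x. Proof. by rewrite -emb_ge0 nmE. Qed.
Lemma nmZ a x : nm (a *: x) = ab a * nm x.
Proof. by apply: emb_inj; rewrite rmorphM !(nmE, abE) normrZ. Qed.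
Lemma nmN x : nm (- x) = nm x.
Proof. by apply: emb_inj; rewrite !nmE normrN. Qed.
Lemma nm0 : nm (0 : V) = 0. Proof. by apply: emb_inj; rewrite nmE normr0 rmorph0. Qed.
Lemma nmD x y : nm (x + y) <= nm x + nm y.
Proof. by rewrite -emb_le rmorphD !nmE ler_normD. Qed.
Lemma nmB x y : nm (x - y) <= nm x + nm y.
Proof. by rewrite -(nmN y) nmD. Qed.
Lemma nm_distC x y : nm (x - y) = nm (y - x).
Proof. by rewrite -nmN opprB. Qed.
Lemma nm_eq0 x : (nm x == 0) = (x == 0).
Proof.
by apply/eqP/eqP => [h|->]; [apply/normr0_eq0; rewrite -nmE h rmorph0|exact: nm0].
Qed.
Lemma nm_gt0 x : (0 < nm x) = (x != 0).
Proof. by rewrite lt_def nm_ge0 andbT nm_eq0. Qed.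
Lemma nm_sum (I : finType) (P : pred I) (f : I -> V) :
  nm (\sum_(i | P i) f i) <= \sum_(i | P i) nm (f i).
Proof.
elim/big_ind2: _ => //; first by rewrite nm0.
by move=> x1 x2 y1 y2 h1 h2; apply: le_trans (nmD _ _) (lerD h1 h2).
Qed.
Lemma nm_dist3 z x y : nm (x - y) <= nm (x - z) + nm (z - y).
Proof. by apply: le_trans (nmD _ _); rewrite addrA subrK. Qed.
Lemma nm_emb_scale r x : 0 <= r -> nm (emb r *: x) = r * nm x.
Proof. by move=> r0; rewrite nmZ ab_emb ger0_norm. Qed.

Definition tendsto (u : nat -> V) (x : V) := forall eps : R, 0 < eps ->
  exists N, forall n, (N <= n)%N -> nm (u n - x) <= eps.

Lemma tendstoP (u : nat -> V) x : u @ \oo --> x <-> tendsto u x.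
Proof.
split=> [/cvgrPdist_le h eps e0|h].
  have [|N _ hN] := h (emb eps); first by rewrite emb_gt0.
  exists N => n /hN /=; rewrite -nmE emb_le nm_distC //.
apply/cvgrPdist_le => eps e0.
have [r r0 er] := emb_pos e0.
have [N hN] := h r r0.
exists N => // n /= /hN; rewrite er -nmE emb_le nm_distC //.
Qed.

Lemma tendsto_unique (u : nat -> V) x y : tendsto u x -> tendsto u y -> x = y.
Proof.
move=> hx hy; apply/eqP; rewrite -subr_eq0 -nm_eq0 eq_le nm_ge0 andbT.
apply/ler_addgt0Pr => eps e0; rewrite add0r.
have e2 : 0 < eps / 2 by lra.
have [N1 h1] := hx _ e2; have [N2 h2] := hy _ e2.
have := h1 _ (leq_maxl N1 N2); have := h2 _ (leq_maxr N1 N2).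
have := nm_dist3 (u (maxn N1 N2)) x y; rewrite (nm_distC x (u _)); lra.
Qed.

Lemma tendsto_cst x : tendsto (fun=> x) x.
Proof. by move=> eps e0; exists 0%N => n _; rewrite subrr nm0 ltW. Qed.

Lemma tendsto_ext (u v : nat -> V) x : u =1 v -> tendsto u x -> tendsto v x.
Proof. by move=> uv h eps e0; have [N hN] := h _ e0; exists N => n /hN; rewrite uv. Qed.

Lemma tendstoD (u v : nat -> V) x y :
  tendsto u x -> tendsto v y -> tendsto (fun n => u n + v n) (x + y).
Proof.
move=> hx hy eps e0; have e2 : 0 < eps / 2 by lra.
have [N1 h1] := hx _ e2; have [N2 h2] := hy _ e2.
exists (maxn N1 N2) => n; rewrite geq_max => /andP[/h1 a /h2 b].
rewrite opprD addrACA; have := nmD (u n - x) (v n - y); lra.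
Qed.

Lemma tendstoZ a (u : nat -> V) x : tendsto u x -> tendsto (fun n => a *: u n) (a *: x).
Proof.
move=> hx eps e0.
have h : 0 < eps / (ab a + 1) by rewrite divr_gt0 //; have := ab_ge0 a; lra.
have [N hN] := hx _ h; exists N => n /hN; rewrite -scalerBr nmZ => hn.
rewrite ler_pdivlMr in hn; last by have := ab_ge0 a; lra.
have := nm_ge0 (u n - x); have := ab_ge0 a; nra.
Qed.

Lemma tendsto_nm_le (u : nat -> V) x M :
  tendsto u x -> (exists N, forall n, (N <= n)%N -> nm (u n) <= M) -> nm x <= M.
Proof.
move=> hx [N0 h0]; apply/ler_addgt0Pr => eps e0; have [N hN] := hx _ e0.
have h1 := h0 _ (leq_maxr N N0); have h2 := hN _ (leq_maxl N N0).
have := nmD (u (maxn N N0)) (x - u (maxn N N0)).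
rewrite addrC subrK (nm_distC x (u _)); lra.
Qed.

Lemma closureP (A : set V) x :
  closure A x <-> forall eps : R, 0 < eps -> exists2 y, A y & nm (x - y) <= eps.
Proof.
split=> [clA eps e0|h B /nbhs_ballP [eps /= e0 hB]].
  have ie0 : 0 < emb eps :> F by rewrite emb_gt0.
  have [y [Ay By]] := clA _ (nbhsx_ballx x _ ie0).
  exists y => //; move: By; rewrite -ball_normE /= => /ltW; rewrite -nmE emb_le //.
have [r r0 er] := emb_pos e0.
have [|y Ay xy] := h (r / 2); first lra.
exists y; split=> //; apply: hB; rewrite -ball_normE /= er -nmE.
by rewrite emb_lt; lra.
Qed.

Lemma closure_tendsto (A : set V) x :
  closure A x <-> exists u : nat -> V, (forall n, A (u n)) /\ tendsto u x.
Proof.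
rewrite closureP; split=> [h|[u [Au ux]] eps e0]; last first.
  have [N hN] := ux _ e0; by exists (u N) => //; rewrite nm_distC; apply: hN.
have hn (n : nat) : 0 < (n.+1%:R)^-1 :> R by rewrite invr_gt0.
have /choice [v hv] : forall n, exists y, A y /\ nm (x - y) <= (n.+1%:R)^-1.
  by move=> n; have [y ? ?] := h _ (hn n); exists y.
exists v; split=> [n|eps e0]; first by case: (hv n).
have hN : (Num.truncn eps^-1).+1%:R^-1 < eps.
  by rewrite invf_plt ?posrE // truncnS_gt.
exists (Num.truncn eps^-1) => n hn'; rewrite nm_distC.
have [_ /le_trans] := hv n; apply; apply/ltW/le_lt_trans/hN.
by rewrite lef_pV2 ?posrE // ler_nat.
Qed.

End Norm.

Definition cauchyn {V : normedModType F} (u : nat -> V) :=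
  forall eps : R, 0 < eps -> exists N, forall m n, (N <= m)%N -> (N <= n)%N ->
    nm (u m - u n) <= eps.

Lemma cauchyn_tendsto (V : completeNormedModType F) (u : nat -> V) :
  cauchyn u -> exists x, tendsto u x.
Proof.
move=> h; have cu : cauchy (u @ \oo).
  apply: cauchy_exP => eps e0.
  have [r r0 er] := emb_pos e0.
  have [|N hN] := h (r / 2); first lra.
  exists (u N); exists N => // n /= Nn; rewrite -ball_normE /= er -nmE.
  by rewrite emb_lt; have := hN N n (leqnn _) Nn; lra.
by have /cauchy_cvg := cu => cu'; exists (lim (u @ \oo)); apply/tendstoP.
Qed.

Lemma tendsto_cauchyn (V : normedModType F) (u : nat -> V) x : tendsto u x -> cauchyn u.
Proof.
move=> h eps e0; have [|N hN] := h (eps / 2); first lra.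
exists N => m n /hN h1 /hN h2; have := nm_dist3 x (u m) (u n).
rewrite (nm_distC x (u _)); lra.
Qed.

End RealNorm.

(** * Unconditional constants and equivalence *)

Section Unconditional.

(* A vector of finite support is given by an injective finite family [al] of
   indices and its coefficients. *)
Definition latt {X : normedModType F} {J : Type} (C : R) (f : J -> X) :=
  forall (I : finType) (al : I -> J) (a b : I -> F), injective al ->
    (forall i, ab (a i) <= ab (b i)) ->
    nm (\sum_i a i *: f (al i)) <= C * nm (\sum_i b i *: f (al i)).

(** Stated through finite sums with distinct indices, so that it composes, restricts and glues
    without operators on closed spans. *)
Definition eqvs {X Y : normedModType F} {J : Type} (K : R) (x : J -> X) (y : J -> Y) :=
  forall (I : finType) (al : I -> J) (a : I -> F), injective al ->
    nm (\sum_i a i *: x (al i)) <= K * nm (\sum_i a i *: y (al i)) /\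
    nm (\sum_i a i *: y (al i)) <= K * nm (\sum_i a i *: x (al i)).

Lemma latt_comp (X : normedModType F) (J J' : Type) C (f : J -> X) (be : J' -> J) :
  injective be -> latt C f -> latt C (f \o be).
Proof. by move=> hb hf I al a b ha hab; apply: hf => // i j /hb /ha. Qed.

Lemma eqvs_comp (X Y : normedModType F) (J J' : Type) K (x : J -> X) (y : J -> Y)
    (be : J' -> J) :
  injective be -> eqvs K x y -> eqvs K (x \o be) (y \o be).
Proof. by move=> hb hf I al a ha; apply: hf => // i j /hb /ha. Qed.

Lemma eqvs_sym (X Y : normedModType F) (J : Type) K (x : J -> X) (y : J -> Y) :
  eqvs K x y -> eqvs K y x.
Proof. by move=> h I al a ha; have [] := h I al a ha. Qed.

Lemma eqvs_trans (X Y Z : normedModType F) (J : Type) K L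
    (x : J -> X) (y : J -> Y) (z : J -> Z) :
  0 <= K -> 0 <= L -> eqvs K x y -> eqvs L y z -> eqvs (K * L) x z.
Proof.
move=> K0 L0 h1 h2 I al a ha; have [p1 p2] := h1 I al a ha.
have [q1 q2] := h2 I al a ha; split.
  by rewrite (le_trans p1) // -mulrA ler_wpM2l.
by rewrite (le_trans q2) // (mulrC K) -mulrA ler_wpM2l.
Qed.

Lemma eqvs_weaken (X Y : normedModType F) (J : Type) K L (x : J -> X) (y : J -> Y) :
  K <= L -> eqvs K x y -> eqvs L x y.
Proof.
move=> KL h I al a ha; have [p q] := h I al a ha; split.
  by rewrite (le_trans p) // ler_wpM2r ?nm_ge0.
by rewrite (le_trans q) // ler_wpM2r ?nm_ge0.
Qed.

Lemma eqvs_latt (X Y : normedModType F) (J : Type) C K (x : J -> X) (y : J -> Y) :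
  0 <= C -> 0 <= K -> latt C x -> eqvs K x y -> latt (K * C * K) y.
Proof.
move=> C0 K0 hx h I al a b ha hab; have [_ p] := h I al a ha.
have [q _] := h I al b ha; apply: (le_trans p).
rewrite -!mulrA ler_wpM2l //; apply: le_trans (hx _ _ _ _ ha hab) _.
by rewrite ler_wpM2l.
Qed.

Lemma latt_mask (X : normedModType F) (J : Type) C (f : J -> X)
    (I : finType) (al : I -> J) (a : I -> F) (P : pred I) :
  latt C f -> injective al ->
  nm (\sum_(i | P i) a i *: f (al i)) <= C * nm (\sum_i a i *: f (al i)).
Proof.
move=> h ha.
rewrite (_ : \sum_(i | P i) _ = \sum_i (if P i then a i else 0) *: f (al i)).
  by apply: h => // i; case: (P i); rewrite ?ab0 ?ab_ge0.
by rewrite big_mkcond; apply: eq_bigr => i _; case: (P i); rewrite ?scale0r.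
Qed.

Lemma latt_coord (X : normedModType F) (J : Type) C (f : J -> X)
    (I : finType) (al : I -> J) (a : I -> F) i :
  latt C f -> injective al ->
  ab (a i) * nm (f (al i)) <= C * nm (\sum_i a i *: f (al i)).
Proof.
move=> h ha; have := latt_mask a (pred1 i) h ha.
by rewrite big_pred1_eq nmZ.
Qed.

(** A multiplier with values in [0, 1] is a convex combination of 0-1 masks, taken one index at a
    time; [w] collects the terms whose mask value is already fixed. *)
Lemma convex_mask (X : normedModType F) (I : eqType) (v : I -> X) (K : R)
    (p : I -> R) (s : seq I) (w : X) :
  uniq s -> (forall i, 0 <= p i <= 1) ->
  (forall P : pred I, nm (w + \sum_(i <- s | P i) v i) <= K) ->
  nm (w + \sum_(i <- s) emb (p i) *: v i) <= K.
Proof.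
move=> + hp; elim: s w => [|i s IH] w /=.
  by move=> _ /(_ xpredT); rewrite !big_nil.
move=> /andP[nis us] h; rewrite big_cons.
have h0 : nm (w + \sum_(j <- s) emb (p j) *: v j) <= K.
  apply: IH => // P; have := h (fun j => (j != i) && P j).
  rewrite big_cons eqxx /=.
  rewrite (_ : \sum_(j <- s | (j != i) && P j) v j = \sum_(j <- s | P j) v j) //.
  rewrite big_seq_cond [RHS]big_seq_cond; apply: eq_bigl => j.
  by case: (boolP (j \in s)) => //= js; case: eqP => // ji; rewrite -ji js in nis.
have h1 : nm (w + v i + \sum_(j <- s) emb (p j) *: v j) <= K.
  apply: IH => // P; have := h (fun j => (j == i) || P j).
  rewrite big_cons eqxx /= addrA.
  rewrite (_ : \sum_(j <- s | (j == i) || P j) v j = \sum_(j <- s | P j) v j) //.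
  rewrite big_seq_cond [RHS]big_seq_cond; apply: eq_bigl => j.
  by case: (boolP (j \in s)) => //= js; case: eqP => // ji; rewrite -ji js in nis.
set t := \sum_(j <- s) _ in h0 h1 *.
have /andP [p0 p1] := hp i.
have -> : w + (emb (p i) *: v i + t) =
    emb (1 - p i) *: (w + t) + emb (p i) *: (w + v i + t).
  rewrite (addrAC w) [_ *: (w + t + _)]scalerDr [RHS]addrA -scalerDl rmorphB rmorph1.
  by rewrite subrK scale1r (addrC _ t) addrA.
apply: le_trans (nmD _ _) _; rewrite !nm_emb_scale //; last lra.
nra.
Qed.

(** The 6 is 2 times 3: a real multiplier q in [-1, 1] is 2 p - 1 with p = (q+1)/2 in [0, 1], which
    costs 2C + C, and a scalar multiplier splits into two real ones by [unit_ball_split]. *)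
Lemma latt_of_subsums (X : normedModType F) (f : nat -> X) (C : R) : 0 <= C ->
  (forall n (a : nat -> F) (B : pred nat),
     nm (\sum_(i < n | B i) a i *: f i) <= C * nm (\sum_(i < n) a i *: f i)) ->
  latt (6 * C) f.
Proof.
move=> C0 h I al a b ha hab.
(* The hypothesis concerns initial segments; the family [al] is placed inside the segment below [n],
   with coefficients [b'] carried along it. *)
have h1 (P : pred I) :
    nm (\sum_(i | P i) b i *: f (al i)) <= C * nm (\sum_i b i *: f (al i)).
  pose n := (\max_i al i).+1.
  have aln i : (al i < n)%N by rewrite ltnS leq_bigmax.
  pose b' j := \sum_(i | al i == j) b i.
  pose B j := [exists i, P i && (al i == j)].
  have key (Q : pred I) (D : pred nat) : (forall i, Q i = D (al i)) ->
      \sum_(i | Q i) b i *: f (al i) = \sum_(j < n | D j) b' j *: f j.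
    move=> QD; rewrite (partition_big (fun i => Ordinal (aln i)) (fun j => D j)) /=.
      apply: eq_bigr => j Dj; rewrite scaler_suml; apply: eq_big.
        move=> i; rewrite QD -(inj_eq val_inj) /=.
        by case: eqP => [->|//]; rewrite ?Dj ?andbF.
      by move=> i /andP[_ /eqP <-].
    by move=> i; rewrite QD.
  rewrite (key P B) ?(key xpredT xpredT) //.
  move=> i; apply/idP/existsP => [Pi|[j /andP[Pj /eqP /ha <- //]]].
  by exists i; rewrite Pi eqxx.
set x := \sum_i b i *: f (al i) in h1 *.
have hq (q : I -> R) : (forall i, `|q i| <= 1) ->
    nm (\sum_i emb (q i) *: (b i *: f (al i))) <= 3 * C * nm x.
  move=> hq.
  have := @convex_mask X I (fun i => b i *: f (al i)) (C * nm x)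
     (fun i => (q i + 1) / 2) (index_enum I) 0 (index_enum_uniq I).
  rewrite add0r => /(_ _ _) hc.
  have {hc} hc : nm (\sum_i emb ((q i + 1) / 2) *: (b i *: f (al i))) <= C * nm x.
    apply: hc => [i|P]; last by rewrite add0r; exact: h1.
    by have := hq i; rewrite ler_norml; lra.
  have -> : \sum_i emb (q i) *: (b i *: f (al i)) =
    emb 2 *: (\sum_i emb ((q i + 1) / 2) *: (b i *: f (al i))) - x.
    rewrite scaler_sumr /x -sumrB; apply: eq_bigr => i _.
    rewrite [emb 2 *: _]scalerA -rmorphM /= mulrC divfK //.
    by rewrite rmorphD rmorph1 scalerDl scale1r addrK.
  apply: le_trans (nmB _ _) _; rewrite nm_emb_scale //.
  have := h1 xpredT; rewrite -/x; lra.
have [u u1 hu] := unit_ball_split.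
have /choice [pq hpq] : forall i, exists pq : R * R,
    [/\ `|pq.1| <= 1, `|pq.2| <= 1 & a i = (emb pq.1 + u * emb pq.2) * b i].
  move=> i; have [b0|b0] := eqVneq (b i) 0.
    exists (0, 0); rewrite !normr0 ler01 rmorph0 mulr0 addr0 mul0r; split=> //.
    by have := hab i; rewrite b0 ab0 => ?; apply/eqP; rewrite -ab_eq0 eq_le ab_ge0 andbT.
  have [|p [q [p1 q1 e]]] := hu (a i / b i).
    rewrite normrM normfV ler_pdivrMr ?normr_gt0 // mul1r -!abE emb_le //.
  by exists (p, q); rewrite /= -e divfK.
have -> : \sum_i a i *: f (al i) =
    \sum_i emb (pq i).1 *: (b i *: f (al i)) +
    u *: \sum_i emb (pq i).2 *: (b i *: f (al i)).
  rewrite scaler_sumr -big_split /=; apply: eq_bigr => i _.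
  by have [_ _ ->] := hpq i; rewrite !scalerA -scalerDl mulrDl -mulrA.
apply: le_trans (nmD _ _) _; rewrite nmZ.
have q1 := hq (fun i => (pq i).1) (fun i => let: And3 h _ _ := hpq i in h).
have q2 := hq (fun i => (pq i).2) (fun i => let: And3 _ h _ := hpq i in h).
have u1' : ab u <= 1 by rewrite -(emb_le (F:=F)) abE rmorph1.
move: q1 q2; set A := nm _ => q1; set B := nm _ => q2.
have B0 : 0 <= B by exact: nm_ge0.
have := ab_ge0 u; nra.
Qed.

End Unconditional.

(** * Expansions along an unconditional sequence *)

Section Span.
Definition fspan {X : normedModType F} (f : nat -> X) : set X :=
  [set y | exists n (a : nat -> F), y = \sum_(i < n) a i *: f i].

Lemma linear_subspace_sum (X : lmodType F) (A : set X) (I : finType) (P : pred I)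
    (c : I -> F) (v : I -> X) :
  linear_subspace A -> (forall i, P i -> A (v i)) -> A (\sum_(i | P i) c i *: v i).
Proof.
move=> [A0 Alin] Av; elim/big_rec: _ => // i x Pi Ax; apply: Alin => //.
exact: Av.
Qed.

Lemma linear_subspaceZ (X : lmodType F) (A : set X) c x :
  linear_subspace A -> A x -> A (c *: x).
Proof. by move=> [A0 Alin] Ax; rewrite -[_ *: _]addr0; apply: Alin. Qed.

Lemma linear_subspaceD (X : lmodType F) (A : set X) x y :
  linear_subspace A -> A x -> A y -> A (x + y).
Proof. by move=> [A0 Alin] Ax Ay; rewrite -[x]scale1r; apply: Alin. Qed.

Lemma linear_subspaceB (X : lmodType F) (A : set X) x y :
  linear_subspace A -> A x -> A y -> A (x - y).
Proof. by move=> [A0 Alin] Ax Ay; rewrite addrC -scaleN1r; apply: Alin. Qed.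

Lemma sum_pad (X : lmodType F) (f : nat -> X) (a : nat -> F) n N : (n <= N)%N ->
  \sum_(i < n) a i *: f i = \sum_(i < N) (if (i < n)%N then a i else 0) *: f i.
Proof.
move=> nN; rewrite (big_ord_widen _ (fun i => a i *: f i) nN) big_mkcond /=.
by apply: eq_bigr => i _; case: ifP; rewrite ?scale0r.
Qed.

Lemma fspan_subspace (X : normedModType F) (f : nat -> X) : linear_subspace (fspan f).
Proof.
split; first by exists 0%N, (fun=> 0); rewrite big_ord0.
move=> c _ _ [n [a ->]] [m [b ->]].
rewrite (sum_pad f a (leq_maxl n m)) (sum_pad f b (leq_maxr n m)).
rewrite scaler_sumr -big_split /=.
exists (maxn n m), (fun i => c * (if (i < n)%N then a i else 0) +
   (if (i < m)%N then b i else 0)).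
by apply: eq_bigr => i _; rewrite scalerDl scalerA.
Qed.

Lemma fspan_gen (X : normedModType F) (f : nat -> X) i : fspan f (f i).
Proof.
exists i.+1, (fun j => (j == i)%:R).
rewrite (bigD1 ord_max) //= eqxx scale1r big1 ?addr0 // => j.
by rewrite -(inj_eq val_inj) /= => /negbTE ->; rewrite scale0r.
Qed.

Lemma smallest_subspaceE (X : normedModType F) (f : nat -> X) :
  smallest linear_subspace (range f) = fspan f.
Proof.
apply/seteqP; split.
  apply: smallest_sub; first exact: fspan_subspace.
  by move=> _ [i _ <-]; exact: fspan_gen.
move=> _ [n [a ->]] A [Alin fA]; apply: linear_subspace_sum => // i _.
by apply: fA; exists i.
Qed.

Lemma closed_spanE (X : normedModType F) (f : nat -> X) :
  closed_span (range f) = closure (fspan f).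
Proof. by rewrite /closed_span smallest_subspaceE. Qed.

Lemma closure_subspace (X : normedModType F) (A : set X) :
  linear_subspace A -> linear_subspace (closure A).
Proof.
move=> Alin; split; first by apply: subset_closure; case: Alin.
move=> c x y /closure_tendsto [u [Au ux]] /closure_tendsto [v [Av vy]].
apply/closure_tendsto; exists (fun n => c *: u n + v n); split.
  by move=> n; apply: (Alin.2).
by apply: tendstoD => //; exact: tendstoZ.
Qed.

Lemma closed_span_subspace (X : normedModType F) (f : nat -> X) :
  linear_subspace (closed_span (range f)).
Proof. by rewrite closed_spanE; apply: closure_subspace; apply: fspan_subspace. Qed.

Lemma closed_span_gen (X : normedModType F) (f : nat -> X) i :
  closed_span (range f) (f i).
Proof. by rewrite closed_spanE; apply: subset_closure; apply: fspan_gen. Qed.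

End Span.

Section Expansion.

(* Summation along the net of finite sets of indices. *)
Definition usum {X : normedModType F} (f : nat -> X) (a : nat -> F) (x : X) :=
  forall eps : R, 0 < eps -> exists n0, forall (I : finType) (al : I -> nat),
    injective al -> (forall j, (j < n0)%N -> exists i, al i = j) ->
    nm (\sum_i a (al i) *: f (al i) - x) <= eps.

Lemma seriesE (X : normedModType F) (f : nat -> X) n :
  series f n = \sum_(i < n) f i.
Proof. by rewrite /series /= big_mkord. Qed.

Lemma usum_tendsto (X : normedModType F) (f : nat -> X) a x :
  usum f a x -> tendsto (fun n => \sum_(i < n) a i *: f i) x.
Proof.
move=> h eps e0; have [n0 hn0] := h eps e0; exists n0 => n nn.
apply: hn0 => [|j jn]; first exact: val_inj.
by exists (Ordinal (leq_trans jn nn)).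
Qed.

Lemma usum_unconditional (X : normedModType F) (f : nat -> X) a x :
  usum f a x -> unconditional_sum (fun n => a n *: f n) x.
Proof.
move=> h s bs; apply/tendstoP => eps e0; have [n0 hn0] := h eps e0.
have [t st ts] := bs.
pose N := (\max_(j < n0) t j).+1.
exists N => n Nn; rewrite seriesE /=.
apply: (hn0 _ (fun i : 'I_n => s i)) => [i j /(bij_inj bs)|j jn]; first exact: val_inj.
have tn : (t j < n)%N.
  by apply: leq_trans Nn; rewrite ltnS (leq_bigmax (Ordinal jn)).
by exists (Ordinal tn) => /=.
Qed.

Lemma tendsto_coord_unique (X : normedModType F) C (f : nat -> X) (a b : nat -> F) x :
  latt C f -> (forall i, f i != 0) ->
  tendsto (fun n => \sum_(i < n) a i *: f i) x ->
  tendsto (fun n => \sum_(i < n) b i *: f i) x -> a = b.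
Proof.
move=> hf f0 ha hb; apply/funext => i; apply/eqP; rewrite -subr_eq0 -ab_eq0.
have hab : tendsto (fun n => \sum_(i < n) (a i - b i) *: f i) (x + -1 *: x).
  apply: tendsto_ext (tendstoD ha (tendstoZ (-1) hb)) => n /=.
  rewrite scaler_sumr -big_split /=; apply: eq_bigr => j _.
  by rewrite scalerBl scaleN1r.
rewrite scaleN1r subrr in hab.
have : ab (a i - b i) * nm (f i) <= 0.
  apply/ler_addgt0Pr => eps e0; rewrite add0r.
  have C1 : 0 < `|C| + 1 by rewrite ltr_wpDl.
  have [N hN] := hab _ (divr_gt0 e0 C1).
  have iN : (i < maxn N i.+1)%N by rewrite leq_max ltnSn orbT.
  have := hN _ (leq_maxl N i.+1); rewrite subr0.
  set t := \sum_(_ < _) _; rewrite ler_pdivlMr // => h2.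
  have h1 : ab (a i - b i) * nm (f i) <= C * nm t.
    exact: (latt_coord (fun j : 'I_ _ => a j - b j) (Ordinal iN) hf val_inj).
  have t0 := nm_ge0 t; have hC := ler_norm C.
  have : C * nm t <= `|C| * nm t by rewrite ler_wpM2r.
  lra.
move=> h; rewrite eq_le ab_ge0 andbT.
have := f0 i; rewrite -nm_gt0 => fi; have := ab_ge0 (a i - b i); nra.
Qed.

Lemma sum_injective (V : nmodType) (I : finType) (al : I -> nat) (G : nat -> V) N :
  injective al -> (forall i, (al i < N)%N) ->
  \sum_i G (al i) = \sum_(j < N | [exists i, al i == j]) G j.
Proof.
move=> ha aN; rewrite (partition_big (fun i => Ordinal (aN i))
   (fun j : 'I_N => [exists i, al i == j])) /=; last first.
  by move=> i _; apply/existsP; exists i.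
apply: eq_bigr => j /existsP [i /eqP ij].
rewrite (big_pred1 i) ?ij // => i'; rewrite -(inj_eq val_inj) /= -ij.
by rewrite (inj_eq ha).
Qed.

Lemma injective_bound (I : finType) (al : I -> nat) m :
  exists2 N, (m <= N)%N & forall i, (al i < N)%N.
Proof.
exists (m + (\max_i al i).+1)%N; first exact: leq_addr.
by move=> i; rewrite (leq_trans _ (leq_addl _ _)) // ltnS leq_bigmax.
Qed.

Lemma tendsto_sum (X : normedModType F) (I : finType) (u : I -> nat -> X) (l : I -> X) :
  (forall i, tendsto (u i) (l i)) -> tendsto (fun n => \sum_i u i n) (\sum_i l i).
Proof.
move=> h; elim: (index_enum I) => [|i s IH].
  by rewrite big_nil; apply: tendsto_ext (tendsto_cst 0) => n; rewrite big_nil.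
by rewrite big_cons; apply: tendsto_ext (tendstoD (h i) IH) => n; rewrite big_cons.
Qed.

Lemma tendsto_scale (X : normedModType F) (c : nat -> F) (l : F) (v : X) :
  (forall eps, 0 < eps -> exists N, forall n, (N <= n)%N -> ab (c n - l) <= eps) ->
  tendsto (fun n => c n *: v) (l *: v).
Proof.
move=> h eps e0.
have [|N hN] := h (eps / (nm v + 1)).
  by rewrite divr_gt0 // ltr_wpDl // nm_ge0.
exists N => n /hN; rewrite -scalerBl nmZ ler_pdivlMr ?ltr_wpDl ?nm_ge0 //.
by have := ab_ge0 (c n - l); have := nm_ge0 v; nra.
Qed.

Lemma ab_complete (u : nat -> F) :
  (forall eps : R, 0 < eps -> exists N, forall m n, (N <= m)%N -> (N <= n)%N ->
     ab (u m - u n) <= eps) ->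
  exists l, forall eps : R, 0 < eps -> exists N, forall n, (N <= n)%N ->
     ab (u n - l) <= eps.
Proof.
move=> h; have [|l hl] := @scalar_complete R F S u.
  move=> eps /h [N hN]; exists N => m n Nm Nn.
  by rewrite -abE emb_le hN.
by exists l => eps /hl [N hN]; exists N => n /hN; rewrite -abE emb_le.
Qed.

(** Unconditionality bounds each coordinate of a finite sum by its norm, so the coordinates of
    finite sums approximating [x] converge. A finite set of indices containing the support of a good
    approximant then sums to within [eps] of [x]. *)
Lemma usum_exists (X : completeNormedModType F) (C : R) (f : nat -> X) x :
  0 <= C -> latt C f -> (forall i, f i != 0) -> closure (fspan f) x ->
  exists a, usum f a x.
Proof.
move=> C0 hf f0 /closure_tendsto [y [ys yx]].
have /choice [nb hnb] : forall k, exists nb : nat * (nat -> F),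
    y k = \sum_(i < nb.1) nb.2 i *: f i.
  by move=> k; have [n [b ->]] := ys k; exists (n, b).
pose b k i := if (i < (nb k).1)%N then (nb k).2 i else 0.
have yb k N : ((nb k).1 <= N)%N -> y k = \sum_(i < N) b k i *: f i.
  by move=> kN; rewrite hnb (sum_pad _ _ kN).
have diff k l (I : finType) (al : I -> nat) : injective al ->
    nm (\sum_i (b k (al i) - b l (al i)) *: f (al i)) <= C * nm (y k - y l).
  move=> ha.
  have [N kN aN] := injective_bound al ((nb k).1 + (nb l).1).
  rewrite (yb k N) ?(leq_trans (leq_addr _ _) kN) //.
  rewrite (yb l N) ?(leq_trans (leq_addl _ _) kN) // -sumrB.
  rewrite (sum_injective (fun j => (b k j - b l j) *: f j) ha aN).
  under [X in _ <= C * nm X]eq_bigr do rewrite -scalerBl.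
  exact: (latt_mask (fun j : 'I_N => b k j - b l j) _ hf val_inj).
have cy : cauchyn y by apply: tendsto_cauchyn yx.
have /choice [a ha] : forall i, exists l, forall eps : R, 0 < eps ->
    exists N, forall k, (N <= k)%N -> ab (b k i - l) <= eps.
  move=> i; apply: ab_complete => eps e0.
  have fi : 0 < nm (f i) by rewrite nm_gt0.
  have h : 0 < eps * nm (f i) / (C + 1) by rewrite divr_gt0 ?mulr_gt0 // ltr_wpDl.
  have [N hN] := cy _ h; exists N => k l Nk Nl.
  have := diff k l 'I_1 (fun=> i); rewrite big_ord1 nmZ => /(_ _) d.
  rewrite -(ler_pM2r fi); apply: (le_trans (d _)); first by move=> ? ?; rewrite !ord1.
  have := hN _ _ Nk Nl; rewrite ler_pdivlMr ?ltr_wpDl //.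
  by have := nm_ge0 (y k - y l); nra.
exists a => eps e0.
(* Two late approximants differ by at most 2 [eta], which is paid with the factor [C]; one more
   [eta] is the distance to [x]. *)
have h : 0 < eps / (2 * C + 1) by rewrite divr_gt0 // ltr_wpDl // mulr_ge0.
have [K hK] := yx _ h; exists (nb K).1 => I al hal cov.
set eta := eps / _ in h hK.
have d l : (K <= l)%N ->
    nm (\sum_i (b l (al i) - b K (al i)) *: f (al i)) <= C * (2 * eta).
  move=> Kl; apply: le_trans (diff _ _ _ _ hal) _; rewrite ler_wpM2l //.
  have := nm_dist3 x (y l) (y K); rewrite (nm_distC x).
  by have := hK _ Kl; have := hK _ (leqnn K); lra.
have d' : nm (\sum_i (a (al i) - b K (al i)) *: f (al i)) <= C * (2 * eta).
  apply: (@tendsto_nm_le _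
    (fun l => \sum_i (b l (al i) - b K (al i)) *: f (al i))); last by exists K.
  apply: tendsto_sum => i; apply: tendsto_scale => e /(ha (al i)) [N hN].
  by exists N => n /hN; rewrite opprB addrA subrK.
have yK : y K = \sum_i b K (al i) *: f (al i).
  have [N kN aN] := injective_bound al (nb K).1.
  rewrite (sum_injective (fun j => b K j *: f j) hal aN) (yb K N) //.
  rewrite [RHS]big_mkcond /=; apply: eq_bigr => j _; case: existsP => // nj.
  rewrite /b; case: ifP => [jn|_]; last by rewrite scale0r.
  by have [i ij] := cov _ jn; case: nj; exists i; rewrite ij.
have -> : \sum_i a (al i) *: f (al i) - x =
    \sum_i (a (al i) - b K (al i)) *: f (al i) + (y K - x).
  rewrite yK addrA -big_split /=; congr (_ - _); apply: eq_bigr => i _.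
  by rewrite scalerBl subrK.
apply: le_trans (nmD _ _) _; have := hK _ (leqnn K).
have : eta * (2 * C + 1) = eps by rewrite divfK // gt_eqF // ltr_wpDl // mulr_ge0.
by set A := nm _ in d' *; lra.
Qed.

Lemma unconditional_basis_latt (X : completeNormedModType F) (C : R) (f : nat -> X) :
  0 <= C -> latt C f -> (forall i, f i != 0) ->
  unconditional_basis (closed_span (range f)) f.
Proof.
move=> C0 hf f0; split=> [n|x]; first exact: closed_span_gen.
rewrite closed_spanE => /(usum_exists C0 hf f0) [a ha].
exists a; split; first exact: usum_unconditional.
move=> b /tendstoP hb; apply: (tendsto_coord_unique hf f0) (usum_tendsto ha).
by apply: tendsto_ext hb => n; rewrite seriesE.
Qed.

Lemma unconditional_basis_dense (X : normedModType F) (e : nat -> X) :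
  unconditional_basis [set: X] e -> closure (fspan e) = [set: X].
Proof.
move=> [_ he]; apply/seteqP; split=> // x _.
have [a [ha _]] := he x I; apply/closure_tendsto.
exists (fun n => \sum_(i < n) a i *: e i); split=> [n|]; first by exists n, a.
have : bijective (@id nat) by exists id.
by move=> /ha /tendstoP; apply: tendsto_ext => n; rewrite seriesE.
Qed.

(** Convergence of the expansion in [X] makes the image series Cauchy; linearity of its sum rests on
    uniqueness of the coefficients. *)
Lemma basis_extension (X Y : completeNormedModType F) (C K : R) (e : nat -> X) (f : nat -> Y) :
  0 <= C -> 0 <= K -> latt C e -> (forall i, e i != 0) -> closure (fspan e) = [set: X] ->
  (forall n (a : nat -> F),
     nm (\sum_(i < n) a i *: f i) <= K * nm (\sum_(i < n) a i *: e i)) ->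
  exists T : {linear X -> Y}, (forall i, T (e i) = f i) /\ forall x, nm (T x) <= K * nm x.
Proof.
move=> C0 K0 he e0 dense hf.
have /choice [a ha] : forall x, exists a, usum e a x.
  by move=> x; apply: (usum_exists C0 he e0); rewrite dense.
have /choice [T hT] : forall x, exists y, tendsto (fun n => \sum_(i < n) a x i *: f i) y.
  move=> x; apply: cauchyn_tendsto => eps eps0.
  have h : 0 < eps / (K + 1) by rewrite divr_gt0 // ltr_wpDl.
  have [N hN] := tendsto_cauchyn (usum_tendsto (ha x)) h.
  have main m n : (m <= n)%N -> (N <= m)%N ->
     nm (\sum_(i < n) a x i *: f i - \sum_(i < m) a x i *: f i) <= eps.
    move=> mn Nm; have Nn := leq_trans Nm mn.
    have E (Z : normedModType F) (g : nat -> Z) :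
       \sum_(i < n) a x i *: g i - \sum_(i < m) a x i *: g i =
       \sum_(i < n) (if (i < m)%N then 0 else a x i) *: g i.
      rewrite (sum_pad _ _ mn) -sumrB; apply: eq_bigr => i _.
      by rewrite -scalerBl; case: ifP; rewrite ?subrr ?subr0.
    rewrite E; apply: le_trans (hf n (fun i => if (i < m)%N then 0 else a x i)) _.
    rewrite -E; have := hN _ _ Nn Nm; rewrite ler_pdivlMr ?ltr_wpDl //.
    set t := nm _; have t0 : 0 <= t by exact: nm_ge0.
    lra.
  exists N => m n Nm Nn; have [mn|/ltnW nm'] := leqP m n; last exact: main.
  by rewrite nm_distC; exact: main.
have uniq_a x (b : nat -> F) : tendsto (fun n => \sum_(i < n) b i *: e i) x -> b = a x.
  by move=> hb; apply: (tendsto_coord_unique he e0 hb); exact: usum_tendsto.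
have lin_T : linear T.
  move=> c x y.
  apply: tendsto_unique (hT (c *: x + y)) _.
  apply: tendsto_ext (tendstoD (tendstoZ c (hT x)) (hT y)) => n /=.
  rewrite (_ : a (c *: x + y) = fun i => c * a x i + a y i).
    rewrite scaler_sumr -big_split /=; apply: eq_bigr => i _.
    by rewrite scalerDl scalerA.
  apply/esym/uniq_a.
  apply: tendsto_ext (tendstoD (tendstoZ c (usum_tendsto (ha x))) (usum_tendsto (ha y))) => k /=.
  rewrite scaler_sumr -big_split /=; apply: eq_bigr => i _.
  by rewrite scalerDl scalerA.
pose TL : {linear X -> Y} := HB.pack T (GRing.isLinear.Build _ _ _ _ _ lin_T).
exists TL; split=> [i|x].
  apply: tendsto_unique (hT (e i)) _.
  have delta (Z : normedModType F) (g : nat -> Z) n : (i < n)%N ->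
      \sum_(j < n) (nat_of_ord j == i)%:R *: g j = g i.
    move=> lin; rewrite (bigD1 (Ordinal lin)) //= eqxx scale1r big1 ?addr0 // => j.
    by rewrite -(inj_eq val_inj) /= => /negbTE ->; rewrite scale0r.
  have <- : (fun j => (j == i)%:R) = a (e i).
    apply: uniq_a => eps eps0; exists i.+1 => n lin.
    by rewrite delta // subrr nm0 ltW.
  by move=> eps eps0; exists i.+1 => n lin; rewrite delta // subrr nm0 ltW.
apply/ler_addgt0Pr => eps eps0.
have h : 0 < eps / (K + 1) by rewrite divr_gt0 // ltr_wpDl.
have [N hN] := usum_tendsto (ha x) h.
apply: (tendsto_nm_le (hT x)); exists N => n Nn.
apply: le_trans (hf _ _) _.
have := hN _ Nn; rewrite ler_pdivlMr ?ltr_wpDl // => hn.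
have := nmD (\sum_(i < n) a x i *: e i - x) x; rewrite subrK.
set s := nm (\sum_(i < n) _); set t := nm (_ - x) in hn *.
have : 0 <= t by exact: nm_ge0.
nra.
Qed.

End Expansion.

(** * Boundedness of the partial sum operators *)

Section Blocks.
Context (P : nat -> nat) (P0 : P 0 = 0%N) (Plt : forall j, (P j < P j.+1)%N).

Lemma blocks_mono i j : (i <= j)%N -> (P i <= P j)%N.
Proof.
elim: j => [|j IH]; first by rewrite leqn0 => /eqP ->.
rewrite leq_eqVlt => /orP[/eqP -> //|]; rewrite ltnS => /IH h.
exact: leq_trans h (ltnW (Plt j)).
Qed.

Lemma blocks_ge j : (j <= P j)%N.
Proof. by elim: j => // j IH; apply: leq_ltn_trans IH (Plt j). Qed.

Lemma blocks_cover n : exists j, (P j <= n < P j.+1)%N.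
Proof.
have ex : exists j, (n < P j.+1)%N by exists n; rewrite (leq_trans (blocks_ge n.+1)) .
case: (ex_minnP ex) => -[|j] nj min.
  by exists 0%N; rewrite nj P0.
by exists j.+1; rewrite nj andbT leqNgt; apply/negP => /min; rewrite ltnn.
Qed.

Lemma blocks_unique n i j :
  (P i <= n < P i.+1)%N -> (P j <= n < P j.+1)%N -> i = j.
Proof.
move=> /andP[a b] /andP[c d]; apply/eqP; rewrite eqn_leq; apply/andP; split;
rewrite leqNgt; apply/negP => /blocks_mono h.
  by have := leq_trans d (leq_trans h a); rewrite ltnn.
by have := leq_trans b (leq_trans h c); rewrite ltnn.
Qed.

(** Reordering inside consecutive intervals always gives a permutation of the integers; this
    produces rearranged series in which chosen terms come first in each block. *)
Lemma blockwise_permutation (L : nat -> seq nat) :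
  (forall j, perm_eq (L j) (index_iota (P j) (P j.+1))) ->
  exists2 s : nat -> nat, bijective s &
    forall j k, (k < P j.+1 - P j)%N -> s (P j + k)%N = nth 0%N (L j) k.
Proof.
move=> hL; have /choice [bl hbl] := blocks_cover.
have szL j : size (L j) = (P j.+1 - P j)%N by rewrite (perm_size (hL j)) size_iota.
have unL j : uniq (L j) by rewrite (perm_uniq (hL j)) iota_uniq.
have memL j m : (m \in L j) = (P j <= m < P j.+1)%N.
  by rewrite (perm_mem (hL j)) mem_index_iota.
have blE n j : (P j <= n < P j.+1)%N -> bl n = j.
  by move=> h; apply: blocks_unique (hbl n) h.
have inb j k : (k < P j.+1 - P j)%N -> (P j <= P j + k < P j.+1)%N.
  by move=> kj; rewrite leq_addr /= -ltn_subRL.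
pose s n := nth 0%N (L (bl n)) (n - P (bl n)).
pose t m := (P (bl m) + index m (L (bl m)))%N.
have sin n : (n - P (bl n) < size (L (bl n)))%N.
  by rewrite szL; have /andP[h1 h2] := hbl n; rewrite ltn_sub2r // (leq_ltn_trans h1).
have bls n : bl (s n) = bl n by apply: blE; rewrite -memL mem_nth.
have blt m : bl (t m) = bl m.
  by apply/blE/inb; rewrite -szL index_mem memL.
exists s; last first.
  by move=> j k kj; rewrite /s (blE _ j) ?inb // addKn.
exists t => n.
  rewrite /t bls /s index_uniq // subnKC //; by case/andP: (hbl n).
by rewrite /s blt /t addKn nth_index // memL.
Qed.

End Blocks.

(** * Bounded masked sums and Baire category *)

Section Uniform.
(** If masked sums were unbounded, masked sums of norm above 1 would occur beyond every index;
    listing the selected terms first in each of successive blocks would give a rearranged series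
    that is not Cauchy. *)
Lemma unconditional_sum_bounded (X : normedModType F) (v : nat -> X) x :
  unconditional_sum v x ->
  exists M : R, forall n (B : pred nat), nm (\sum_(i < n | B i) v i) <= M.
Proof.
move=> hv; apply: contrapT => nobd.
have step p : exists qB : nat * pred nat, (p < qB.1)%N /\
    1 < nm (\sum_(p <= i < qB.1 | qB.2 i) v i).
  (* The terms before [p] account for at most the sum of their norms; the extra 1 survives in the
     terms after [p]. *)
  pose M := 1 + \sum_(i < p) nm (v i).
  have /existsNP [n /existsNP [B hB]] :
      ~ (forall n (B : pred nat), nm (\sum_(i < n | B i) v i) <= M).
    by move=> h; apply: nobd; exists M.
  move/negP : hB; rewrite -ltNge => hB.
  have small m : (m <= p)%N -> nm (\sum_(i < m | B i) v i) <= \sum_(i < p) nm (v i).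
    move=> mp; apply: le_trans (nm_sum _ _) _.
    rewrite (big_ord_widen_cond _ B (fun i => nm (v i)) mp).
    rewrite big_mkcond; apply: ler_sum => i _; case: ifP => // _; exact: nm_ge0.
  have pn : (p < n)%N.
    rewrite ltnNge; apply/negP => /small; rewrite leNgt => /negP; apply.
    by apply: lt_trans hB; rewrite ltrDr.
  exists (n, B); split=> //=.
  have := hB; rewrite -(big_mkord B v) (big_cat_nat _ (n := p)) ?(ltnW pn) //= big_mkord.
  have := nmD (\sum_(i < p | B i) v i) (\sum_(p <= i < n | B i) v i).
  by have := small p (leqnn p); rewrite /M; lra.
have /choice [qB hqB] := step.
pose P j := iter j (fun p => (qB p).1) 0%N.
have Plt j : (P j < P j.+1)%N by case: (hqB (P j)).
pose B j := (qB (P j)).2.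
pose L j := seq.filter (B j) (index_iota (P j) (P j.+1)) ++
            seq.filter (predC (B j)) (index_iota (P j) (P j.+1)).
have [s bs hs] := @blockwise_permutation P erefl Plt L (fun j => permEl (perm_filterC _ _)).
have /tendstoP /tendsto_cauchyn /(_ 1 ltr01) [N hN] := hv s bs.
pose c := size (seq.filter (B N) (index_iota (P N) (P N.+1))).
have cle : (c <= P N.+1 - P N)%N.
  by rewrite /c size_filter (leq_trans (count_size _ _)) // size_iota.
have NP := blocks_ge Plt N.
have := hN (P N + c)%N (P N) (leq_trans NP (leq_addr _ _)) NP.
rewrite /series /= (big_cat_nat _ (n := P N)) ?leq_addr //= [X in nm X]addrAC subrr add0r.
rewrite -{1}[P N]add0n big_addn addKn.
rewrite (_ : \sum_(0 <= i < c) _ = \sum_(P N <= i < P N.+1 | B N i) v i); last first.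
  rewrite -[RHS]big_filter (big_nth 0%N) -/c; apply: eq_big_nat => i /andP[_ ic].
  rewrite addnC hs ?(leq_trans ic cle) // /L nth_cat -/c ic //.
by rewrite leNgt => /negP; apply; case: (hqB (P N)).
Qed.

(** Baire's theorem without closed sets: if no [V k] were dense in any ball, shrinking balls
    avoiding [V 0], [V 1], ... in turn would close down on a point outside all of them. *)
Lemma baire_cover (X : completeNormedModType F) (V : nat -> set X) :
  (forall x, exists k, V k x) ->
  exists k x0 (d : R), 0 < d /\ forall x, nm (x - x0) <= d ->
    forall eps : R, 0 < eps -> exists2 y, V k y & nm (x - y) <= eps.
Proof.
move=> cov; apply: contrapT => no.
have step (kxd : nat * X * R) : exists xd : X * R, 0 < kxd.2 ->
    [/\ 0 < xd.2, xd.2 <= kxd.2 / 2,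
        nm (xd.1 - kxd.1.2) <= kxd.2 / 2
      & forall y, nm (y - xd.1) <= xd.2 -> ~ V kxd.1.1 y].
  case: kxd => [[k x] d] /=; have [d0|d0] := ltP 0 d; last by exists (x, d).
  apply: contrapT => h; apply: no; exists k, x, (d / 2); split; first lra.
  move=> z zx eps eps0; apply: contrapT => nz; apply: h.
  exists (z, Num.min (eps / 2) (d / 2)) => _; split=> //=.
  - by rewrite lt_min; apply/andP; split; lra.
  - by rewrite ge_min lexx orbT.
  - move=> y; rewrite le_min => /andP[h _] Vy; apply: nz; exists y => //.
    rewrite nm_distC; lra.
have /choice [g hg] := step.
(* [c n] is a pair of centre and radius; from radius 1 on, the radii at least halve. *)
pose fix c n := if n is m.+1 then g (m, (c m).1, (c m).2) else (0 : X, 1 : R).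
have d0 n : 0 < (c n).2.
  by elim: n => [|n IH] //=; have [] := hg (n, (c n).1, (c n).2) IH.
have dS n : (c n.+1).2 <= (c n).2 / 2.
  by have [] := hg (n, (c n).1, (c n).2) (d0 n).
have xS n : nm ((c n.+1).1 - (c n).1) <= (c n).2 / 2.
  by have [] := hg (n, (c n).1, (c n).2) (d0 n).
have avoid n y : nm (y - (c n.+1).1) <= (c n.+1).2 -> ~ V n y.
  by have [_ _ _] := hg (n, (c n).1, (c n).2) (d0 n); apply.
(* Nesting of the closed balls: it yields both the Cauchy property and the membership of the limit
   in every ball. *)
have near n m : nm ((c (n + m)%N).1 - (c n).1) <= (c n).2 - (c (n + m)%N).2.
  elim: m => [|m IH]; first by rewrite addn0 !subrr nm0.
  rewrite addnS; have := nm_dist3 (c (n + m)%N).1 (c (n + m).+1).1 (c n).1.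
  have := xS (n + m)%N; have := dS (n + m)%N; lra.
have dn n : (c n).2 <= (n.+1%:R)^-1.
  elim: n => [|n IH]; first by rewrite invr1.
  apply: le_trans (dS n) _; apply: (@le_trans _ _ (n.+1%:R^-1 / 2)); first by rewrite ler_pM2r ?invr_gt0.
  rewrite -invfM lef_pV2 ?posrE ?mulr_gt0 // -natrM ler_nat; lia.
have cc : cauchyn (fun n => (c n).1).
  move=> eps eps0; pose N := Num.truncn (2 * eps^-1).
  have hN : (c N).2 <= eps / 2.
    apply: le_trans (dn N) _; rewrite -[_ / 2]invrK lef_pV2 ?posrE ?invr_gt0 //; last lra.
    by rewrite invf_div; apply/ltW; exact: truncnS_gt.
  exists N => m n /subnKC <- /subnKC <-.
  have := near N (m - N)%N; have := near N (n - N)%N.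
  have := d0 (N + (m - N))%N; have := d0 (N + (n - N))%N.
  have := nm_dist3 (c N).1 (c (N + (m - N))%N).1 (c (N + (n - N))%N).1.
  rewrite (nm_distC (c N).1); lra.
have [x hx] := cauchyn_tendsto cc; have [k Vk] := cov x.
apply: (avoid k x) Vk.
apply: (@tendsto_nm_le _ (fun n => (c n).1 - (c k.+1).1)).
  by apply: tendstoD => //; exact: tendsto_cst.
exists k.+1 => n /subnKC <-; have := near k.+1 (n - k.+1)%N.
by have := d0 (k.+1 + (n - k.+1))%N; lra.
Qed.

(* Zabreiko's lemma *)
Lemma absorbing_ball (X : completeNormedModType F) (V : R -> set X) :
  (forall x, exists r, V r x) -> (forall r s x, r <= s -> V r x -> V s x) ->
  (forall r s x y, V r x -> V s y -> V (r + s) (x - y)) ->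
  (forall r t x, 0 <= t -> V r x -> V (t * r) (emb t *: x)) ->
  (forall (y : nat -> X) (r : nat -> R) x rho,
     (forall k, V (r k) (y k)) -> (forall n, \sum_(k < n) r k <= rho) ->
     tendsto (fun n => \sum_(k < n) y k) x -> V rho x) ->
  exists2 C : R, 0 <= C & forall x, V (C * nm x) x.
Proof.
move=> cov mono sub scal csub.
have [|k [x0 [d [d0 hd]]]] := @baire_cover X (fun k => V k%:R).
  move=> x; have [r Vr] := cov x; exists (Num.truncn r).+1.
  by apply: mono Vr; apply/ltW; exact: truncnS_gt.
(* A vector of norm [d] is approximated by a difference of two members of [V k], one of them close
   to [x0], at cost [k + k]; homogeneity divides by [d]. *)
pose D := (k%:R + k%:R) / d.
have D0 : 0 <= D by rewrite divr_ge0 ?addr_ge0 // ltW.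
have V00 : V 0 0.
  have [r Vr] := cov 0; have := scal r 0 0 (lexx 0) Vr.
  by rewrite mul0r scaler0.
have app (ze : X * R) : exists y, 0 < ze.2 -> V (D * nm ze.1) y /\ nm (ze.1 - y) <= ze.2.
  case: ze => [z eps] /=; have [->|z0] := eqVneq z 0.
    by exists 0 => e0; rewrite nm0 mulr0 subr0 nm0; split=> //; exact: ltW.
  have [e0|e0] := ltP 0 eps; last by exists 0.
  have nz : 0 < nm z by rewrite nm_gt0.
  pose t := d / nm z; have t0 : 0 < t by rewrite divr_gt0.
  pose eta := eps * t / 2; have eta0 : 0 < eta by rewrite /eta; have := mulr_gt0 e0 t0; lra.
  have [|y1 V1 h1] := hd (x0 + emb t *: z) _ _ eta0.
    by rewrite addrC addKr nm_emb_scale ?(ltW t0) // divfK // gt_eqF.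
  have [|y2 V2 h2] := hd x0 _ _ eta0; first by rewrite subrr nm0 ltW.
  exists (emb t^-1 *: (y1 - y2)) => _; split.
    rewrite /D (_ : _ / d * nm z = t^-1 * (k%:R + k%:R)); last first.
      by rewrite /t invf_div [RHS]mulrC [RHS]mulrA [RHS]mulrAC.
    by apply: scal; [rewrite invr_ge0 ltW|exact: sub].
  have -> : z - emb t^-1 *: (y1 - y2) =
      emb t^-1 *: ((x0 + emb t *: z - y1) - (x0 - y2)).
    rewrite (_ : _ - y1 - _ = emb t *: z - (y1 - y2)).
      by rewrite [RHS]scalerBr scalerA -rmorphM mulVf ?gt_eqF // rmorph1 scale1r.
    rewrite !opprB (addrC x0) addrA addrAC (addrAC _ (- y1)) addrK -addrA.
    by rewrite (addrC y2).
  rewrite nm_emb_scale ?invr_ge0 ?(ltW t0) // mulrC ler_pdivrMr //.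
  apply: le_trans (nmB _ _) _; move: h1 h2; rewrite /eta; lra.
have /choice [g hg] := app.
(* Successive approximation: the n-th remainder has norm at most [h n] and is approximated at cost
   [D] times that; the geometric series sums to 2. *)
exists (2 * D) => [|x]; first lra.
have [->|x_neq0] := eqVneq x 0; first by rewrite nm0 mulr0.
have nx : 0 < nm x by rewrite nm_gt0.
pose h n := nm x / 2 ^+ n.
have h0 n : 0 < h n by rewrite divr_gt0 // exprn_gt0.
have hS n : h n.+1 = h n / 2.
  by rewrite /h exprS invfM mulrA mulrAC.
pose fix z n := if n is m.+1 then z m - g (z m, h m.+1) else x.
have hz n : nm (z n) <= h n.
  case: n => [|n] /=; first by rewrite /h expr0 divr1.
  by have [] := hg (z n, h n.+1) (h0 _).
apply: (csub (fun n => g (z n, h n.+1)) (fun n => D * h n)).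
- move=> n; have [/= + _] := hg (z n, h n.+1) (h0 _); apply: mono.
  by rewrite ler_wpM2l.
- move=> n; rewrite -mulr_sumr (_ : 2 * D * nm x = D * (2 * nm x)) ?ler_wpM2l //; last by ring.
  suff : \sum_(i < n) h i = 2 * nm x - 2 * h n.
    by move=> ->; have := h0 n; lra.
  elim: n => [|n IH]; first by rewrite big_ord0 /h expr0 divr1 subrr.
  rewrite big_ord_recr /= IH hS; lra.
- have sumg n : \sum_(k < n) g (z k, h k.+1) = x - z n.
    elim: n => [|n IH]; first by rewrite big_ord0 subrr.
    by rewrite big_ord_recr /= IH opprB [RHS]addrA addrAC.
  have hn n : h n <= nm x * (n.+1%:R)^-1.
    rewrite /h ler_pM2l // lef_pV2 ?posrE ?exprn_gt0 //.
    rewrite -natrX ler_nat; exact: ltn_expl.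
  move=> eps e0; pose N := Num.truncn (nm x / eps).
  exists N => n Nn; rewrite sumg addrAC subrr sub0r nmN.
  apply: le_trans (hz n) _; apply: le_trans (hn n) _.
  rewrite ler_pdivrMr // mulrC -ler_pdivrMr //.
  apply: (@le_trans _ _ N.+1%:R); last by rewrite ler_nat.
  by apply/ltW; exact: truncnS_gt.
Qed.

End Uniform.

(** * The unconditional constant of a basis *)

Section BasisConstant.
Lemma bounded_sums_cauchy (r : nat -> R) (rho : R) :
  (forall k, 0 <= r k) -> (forall n, \sum_(k < n) r k <= rho) ->
  forall eps : R, 0 < eps -> exists N, forall m, (N <= m)%N -> forall n,
    \sum_(m <= k < m + n) r k <= eps.
Proof.
move=> r0 hr eps e0; pose A := range (fun n => \sum_(k < n) r k).
have supA : has_sup A.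
  by split; [exists (\sum_(k < 0) r k), 0%N|exists rho => _ [n _ <-]; exact: hr].
have [_ [N _ <-] hN] := sup_adherent e0 supA.
exists N => m Nm n.
have up : \sum_(k < m + n) r k <= sup A.
  by apply: ub_le_sup; [case: supA|exists (m + n)%N].
have mono : \sum_(k < N) r k <= \sum_(k < m) r k.
  rewrite (_ : \sum_(k < m) r k = \sum_(k < N) r k + \sum_(N <= k < m) r k).
    by rewrite lerDl sumr_ge0.
  by rewrite -!(big_mkord xpredT r) -big_cat_nat.
move: up; rewrite -(big_mkord xpredT r) (big_cat_nat _ (n := m)) ?leq_addr //=.
rewrite big_mkord; lra.
Qed.

Lemma basis_coord_neq0 (X : normedModType F) (A : set X) (e : nat -> X) i :
  unconditional_basis A e -> e i != 0.
Proof.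
move=> [eA he]; apply/eqP => ei0.
have [a [_ ua]] := he _ (eA i); rewrite ei0 in ua.
have h (c : F) : (fun j => if j == i then c else 0) = a.
  apply: ua; apply/tendstoP.
  apply: tendsto_ext (tendsto_cst 0) => n; rewrite seriesE big1 // => j _.
  by case: eqP => [->|_]; rewrite ?ei0 ?scaler0 ?scale0r.
have /(congr1 (fun g => g i)) := etrans (h 0) (esym (h 1)).
by rewrite eqxx => /eqP; rewrite eq_sym oner_eq0.
Qed.

(** [V r] gathers the vectors whose masked partial sums all have norm at most [r]. Unconditional
    convergence puts each vector in some [V r], and Zabreiko's lemma turns this into a bound
    proportional to the norm. *)
Lemma unconditional_basis_constant (X : completeNormedModType F) (e : nat -> X) :
  unconditional_basis [set: X] e -> exists2 C : R, 1 <= C & latt C e.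
Proof.
move=> he; have e0 i := basis_coord_neq0 i he.
case: he => _ he.
have /choice [a ha] : forall x, exists a : nat -> F,
   unconditional_sum (fun n => a n *: e n) x /\
   forall b : nat -> F, tendsto (fun n => \sum_(i < n) b i *: e i) x -> b = a.
  move=> x; have [a [h1 h2]] := he x I; exists a; split=> // b hb.
  apply: h2; apply/tendstoP.
  by apply: tendsto_ext hb => n; rewrite seriesE.
have ax x : tendsto (fun n => \sum_(i < n) a x i *: e i) x.
  have bid : bijective (@id nat) by exists id.
  have [/(_ _ bid) /tendstoP h _] := ha x.
  by apply: tendsto_ext h => n; rewrite seriesE.
have auniq x (b : nat -> F) : tendsto (fun n => \sum_(i < n) b i *: e i) x -> b = a x.
  by move=> hb; have [_ h] := ha x; apply: h.
have alin c x y : a (c *: x + y) = fun i => c * a x i + a y i.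
  apply/esym/auniq.
  apply: tendsto_ext (tendstoD (tendstoZ c (ax x)) (ax y)) => n /=.
  rewrite scaler_sumr -big_split /=; apply: eq_bigr => i _.
  by rewrite scalerDl scalerA.
pose V (r : R) := [set x : X | forall n (B : pred nat),
   nm (\sum_(i < n | B i) a x i *: e i) <= r].
have V_ge0 r x : V r x -> 0 <= r.
  by move=> /(_ 0%N xpredT); rewrite big_ord0 nm0.
have a0 : a 0 = fun=> 0.
  by apply/esym/auniq; apply: tendsto_ext (tendsto_cst 0) => n; rewrite big1 // => i _; rewrite scale0r.
have asum (y : nat -> X) m : a (\sum_(k < m) y k) = fun i => \sum_(k < m) a (y k) i.
  elim: m => [|m IH].
    by rewrite big_ord0 a0; apply/funext => i; rewrite big_ord0.
  rewrite big_ord_recr /= addrC -[y m]scale1r alin IH; apply/funext => i.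
  by rewrite mul1r big_ord_recr /= addrC.
have aD x y : a (x + y) = fun i => a x i + a y i.
  by rewrite -[x]scale1r alin; apply/funext => i; rewrite mul1r scale1r.
have VD r s x y : V r x -> V s y -> V (r + s) (x + y).
  move=> hx hy n B; rewrite aD.
  under eq_bigr do rewrite scalerDl.
  by rewrite big_split /=; apply: le_trans (nmD _ _) (lerD (hx n B) (hy n B)).
have VZ c r x : V r x -> V (ab c * r) (c *: x).
  move=> hx n B; rewrite -[c *: x]addr0 alin a0.
  under eq_bigr do rewrite addr0 -scalerA.
  by rewrite -scaler_sumr nmZ ler_wpM2l // ab_ge0.
have Vsum (y : nat -> X) (r : nat -> R) m n : (forall k, V (r k) (y k)) ->
    V (\sum_(m <= k < n) r k) (\sum_(m <= k < n) y k).
  move=> hy; apply: (big_ind2 (fun x r => V r x)) => //.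
    by move=> k B; rewrite a0 big1 ?nm0 // => i _; rewrite scale0r.
  by move=> x1 r1 x2 r2; apply: VD.
have Vcoord r x i : V r x -> ab (a x i) * nm (e i) <= r.
  move=> /(_ i.+1 (pred1 i)); rewrite (big_pred1 ord_max) ?nmZ //.
have [|||||C C0 hC] := @absorbing_ball X V.
- move=> x; have [h _] := ha x.
  by have [M hM] := unconditional_sum_bounded h; exists M.
- by move=> r s x rs h n B; apply: le_trans (h n B) rs.
- move=> r s x y hx hy; rewrite -scaleN1r; apply: VD => //.
  by have := VZ (-1) _ _ hy; rewrite abN ab1 mul1r.
- by move=> r t x t0 /(VZ (emb t)); rewrite ab_emb ger0_norm.
(* Countable subadditivity of the gauge. Continuity of the coordinates is not known yet, so the
   coordinates [al] of the sum are obtained as limits and identified with those of [x] by uniqueness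
   of the expansion. *)
- move=> y r x rho hy hr hx.
  have r0 k : 0 <= r k by apply: V_ge0 (hy k).
  have tails := bounded_sums_cauchy r0 hr.
  pose z m := \sum_(k < m) y k.
  have zdiff m n : V (\sum_(m <= k < m + n) r k) (z (m + n)%N - z m).
    rewrite (_ : z (m + n)%N - z m = \sum_(m <= k < m + n) y k); first exact: Vsum.
    rewrite /z -(big_mkord xpredT y) (big_cat_nat _ (n := m)) ?leq_addr //= big_mkord.
    by rewrite [LHS]addrAC subrr add0r.
  have adiff u v i : a (u - v) i = a u i - a v i.
    by rewrite aD -scaleN1r -[_ *: v]addr0 alin a0 mulN1r addr0.
  have /choice [al hal] : forall i, exists l, forall eps : R, 0 < eps ->
      exists N, forall m, (N <= m)%N -> ab (a (z m) i - l) <= eps.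
    move=> i; apply: ab_complete => eps eps0.
    have ei : 0 < nm (e i) by rewrite nm_gt0.
    have [N hN] := tails _ (mulr_gt0 eps0 ei).
    have main m n : (N <= m)%N -> ab (a (z (m + n)%N) i - a (z m) i) <= eps.
      move=> Nm; rewrite -(ler_pM2r ei) -adiff.
      exact: le_trans (Vcoord _ _ _ (zdiff m n)) (hN m Nm n).
    exists N => m n Nm Nn; have [/subnKC <-|/ltnW /subnKC <-] := leqP n m.
      exact: main.
    by rewrite -abN opprB; exact: main.
  have altail eps : 0 < eps -> exists N, forall m, (N <= m)%N -> forall n (B : pred nat),
      nm (\sum_(i < n | B i) (al i - a (z m) i) *: e i) <= eps.
    move=> eps0; have [N hN] := tails _ eps0; exists N => m Nm n B.
    apply: (@tendsto_nm_le _
      (fun k => \sum_(i < n | B i) (a (z k) i - a (z m) i) *: e i)).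
      rewrite big_mkcond /=; under eq_fun do rewrite big_mkcond /=.
      apply: tendsto_sum => i; case: (B i); last exact: tendsto_cst.
      apply: tendsto_scale => ep /(hal i) [M hM]; exists M => k /hM.
      by rewrite opprB addrA subrK.
    exists m => k /subnKC <-; have := zdiff m (k - m)%N => /(_ n B).
    under eq_bigr do rewrite adiff.
    by move/le_trans; apply; exact: hN.
  have alx : al = a x.
    apply: auniq => eps eps0; have e3 : 0 < eps / 3 by lra.
    have [N1 h1] := altail _ e3; have [N2 h2] := hx _ e3.
    pose m := maxn N1 N2; have [N3 h3] := ax (z m) _ e3.
    exists N3 => n Nn.
    have := h1 m (leq_maxl _ _) n xpredT; have := h2 m (leq_maxr _ _).
    have := h3 n Nn.
    under [X in nm X <= _ -> _ <= eps]eq_bigr do rewrite scalerBl.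
    rewrite sumrB.
    set s1 := \sum_(_ < n) a (z m) _ *: _; set s2 := \sum_(_ < n) al _ *: _.
    rewrite -/(z m) => k1 k2 k3.
    have := nm_dist3 s1 s2 x; have := nm_dist3 (z m) s1 x; lra.
  move=> n B; rewrite -alx.
  apply: (@tendsto_nm_le _ (fun k => \sum_(i < n | B i) a (z k) i *: e i)).
    rewrite big_mkcond /=; under eq_fun do rewrite big_mkcond /=.
    apply: tendsto_sum => i; case: (B i); last exact: tendsto_cst.
    exact: tendsto_scale (hal i).
  exists 0%N => k _; have := Vsum y r 0%N k hy.
  by rewrite !big_mkord => /(_ n B) /le_trans; apply; exact: hr.
exists (6 * C + 1); first lra.
have hl : latt (6 * C) e.
  apply: latt_of_subsums => // n b B.
  have ab' : a (\sum_(i < n) b i *: e i) = fun i => if (i < n)%N then b i else 0.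
    apply/esym/auniq => eps eps0; exists n => m nm'.
    by rewrite -(sum_pad _ _ nm') subrr nm0 ltW.
  have := hC (\sum_(i < n) b i *: e i) n B; rewrite ab'.
  by under eq_bigr do rewrite ltn_ord.
move=> I al c d hal hcd; apply: le_trans (hl I al c d hal hcd) _.
by rewrite ler_wpM2r ?nm_ge0 // lerDl.
Qed.

End BasisConstant.

(** * Isomorphisms and uniqueness of bases *)

Section Transport.
(** For a normalized unconditional sequence this expresses equivalence with the unit vector basis of
    c_0, without mentioning c_0. *)
Definition bounded_sums {X : normedModType F} {J : Type} (L : R) (f : J -> X) :=
  forall (I : finType) (al : I -> J), injective al -> nm (\sum_i f (al i)) <= L.

Lemma bounded_sums_comp (X : normedModType F) (J J' : Type) L (f : J -> X) (s : J' -> J) :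
  injective s -> bounded_sums L f -> bounded_sums L (f \o s).
Proof. by move=> hs h I al hal; apply: (h I (s \o al)); exact: inj_comp. Qed.

Lemma bounded_sums_eqvs (X Y : normedModType F) (J : Type) K L (f : J -> X) (g : J -> Y) :
  0 <= K -> eqvs K f g -> bounded_sums L f -> bounded_sums (K * L) g.
Proof.
move=> K0 fg h I al hal; have [_ ] := fg I al (fun=> 1) hal.
have E (Z : normedModType F) (k : I -> Z) : \sum_i (1 : F) *: k i = \sum_i k i.
  by apply: eq_bigr => i _; rewrite scale1r.
rewrite !E.
by move/le_trans; apply; rewrite ler_wpM2l // h.
Qed.

Lemma isomorphism_real_bounds (X Y : normedModType F) (A : set X) (B : set Y) (T : X -> Y) :
  isomorphism A B T -> exists c d : R, [/\ 0 <= c, 0 <= d,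
    forall (a : F) u v, A u -> A v -> T (a *: u + v) = a *: T u + T v,
    T @` A = B &
    forall u, A u -> nm (T u) <= c * nm u /\ nm u <= d * nm (T u)].
Proof.
move=> [_ [_ [/emb_nneg [c ->] /emb_nneg [d ->] [lin im h1 h2]]]].
have abs_le (r : R) : r <= `|r| by exact: ler_norm.
exists `|c|, `|d|; split=> // u Au; split.
  by have := h1 u Au; rewrite -!nmE -rmorphM emb_le => /le_trans; apply;
    rewrite ler_wpM2r ?nm_ge0.
by have := h2 u Au; rewrite -!nmE -rmorphM emb_le => /le_trans; apply;
    rewrite ler_wpM2r ?nm_ge0.
Qed.

Lemma real_bounds_isomorphism (X Y : normedModType F) (A : set X) (B : set Y)
    (T : X -> Y) (c d : R) :
  0 <= c -> 0 <= d ->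
  (forall (a : F) u v, A u -> A v -> T (a *: u + v) = a *: T u + T v) ->
  T @` A = B ->
  (forall u, A u -> nm (T u) <= c * nm u /\ nm u <= d * nm (T u)) ->
  isomorphism_bounds (emb c) (emb d) A B T.
Proof.
move=> c0 d0 lin im h; split=> // u Au; have [h1 h2] := h u Au.
  by rewrite -!nmE -rmorphM emb_le.
by rewrite -!nmE -rmorphM emb_le.
Qed.

Section LinearOn.
Context {X Y : normedModType F} (A : set X) (T : X -> Y).
Context (Alin : linear_subspace A)
  (Tlin : forall (a : F) u v, A u -> A v -> T (a *: u + v) = a *: T u + T v).

Lemma linear_on0 : T 0 = 0.
Proof.
have [A0 _] := Alin.
have h : T 0 = T 0 + T 0.
  by have := Tlin 1 A0 A0; rewrite !scale1r addr0.
by apply: (@addrI _ (T 0)); rewrite -h addr0.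
Qed.

Lemma linear_onZ a u : A u -> T (a *: u) = a *: T u.
Proof. by move=> Au; have := Tlin a Au Alin.1; rewrite !addr0 linear_on0 addr0. Qed.

Lemma linear_onB u v : A u -> A v -> T (u - v) = T u - T v.
Proof. by move=> Au Av; rewrite addrC -scaleN1r Tlin // scaleN1r addrC. Qed.

Lemma linear_on_sum (I : finType) (c : I -> F) (v : I -> X) :
  (forall i, A (v i)) -> T (\sum_i c i *: v i) = \sum_i c i *: T (v i).
Proof.
move=> Av; suff [] : A (\sum_i c i *: v i) /\
  T (\sum_i c i *: v i) = \sum_i c i *: T (v i) by [].
elim/big_ind2 : _ => [|x' x y' y [Ax Tx] [Ay Ty]|i _].
- by split; [exact: Alin.1|exact: linear_on0].
- split; first exact: linear_subspaceD.
  by rewrite -[x]scale1r Tlin // scale1r Tx Ty.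
- by split; [exact: linear_subspaceZ|exact: linear_onZ].
Qed.

End LinearOn.

Lemma isomorphic_sym (X Y : normedModType F) (A : set X) (B : set Y) :
  linear_subspace A -> isomorphic A B -> isomorphic B A.
Proof.
move=> Alin [T /isomorphism_real_bounds [c [d [c0 d0 lin im h]]]].
have /choice [g hg] : forall y, exists x, B y -> A x /\ T x = y.
  move=> y; have [By|nBy] := pselect (B y); last by exists 0.
  by move: By; rewrite -im => -[x Ax <-]; exists x.
have inj u v : A u -> A v -> T u = T v -> u = v.
  move=> Au Av e; apply/eqP; rewrite -subr_eq0 -nm_eq0 eq_le nm_ge0 andbT.
  have [_] := h _ (linear_subspaceB Alin Au Av).
  by rewrite (linear_onB lin) // e subrr nm0 mulr0.
have Blin : linear_subspace B.
  rewrite -im; split; first by exists 0; [exact: Alin.1|exact: (linear_on0 Alin lin)].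
  move=> a _ _ [x Ax <-] [y Ay <-]; exists (a *: x + y); first exact: Alin.2.
  exact: lin.
exists g, (emb d), (emb c); split; rewrite ?emb_ge0 //.
apply: real_bounds_isomorphism => //.
- move=> a u v Bu Bv; have [Au Tu] := hg _ Bu; have [Av Tv] := hg _ Bv.
  have Bw := Blin.2 a u v Bu Bv; have [Aw Tw] := hg _ Bw.
  by apply: inj => //; [exact: Alin.2|rewrite Tw lin // Tu Tv].
- apply/seteqP; split=> [_ [y By <-]|x Ax]; first by case: (hg _ By).
  have BT : B (T x) by rewrite -im; exists x.
  by exists (T x) => //; have [Ag Tg] := hg _ BT; apply: inj.
- by move=> y By; have [Ag Tg] := hg _ By; have [] := h _ Ag; rewrite Tg.
Qed.

Lemma equivalent_seq_eqvs (X Y : normedModType F) (x : nat -> X) (y : nat -> Y) :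
  equivalent_seq x y -> exists2 K : R, 0 <= K & eqvs K x y.
Proof.
move=> [T [/isomorphism_real_bounds [c [d [c0 d0 lin _ h]]] Tx]].
have Alin := closed_span_subspace x.
exists (c + d) => [|I al a hal]; first exact: addr_ge0.
set s := \sum_i a i *: x _.
have As : closed_span (range x) s.
  by apply: linear_subspace_sum => // i _; exact: closed_span_gen.
have -> : \sum_i a i *: y (al i) = T s.
  rewrite (linear_on_sum Alin lin); last by move=> i; exact: closed_span_gen.
  by under eq_bigr do rewrite -Tx.
have [h1 h2] := h _ As; split.
  by apply: le_trans h2 _; rewrite ler_wpM2r ?nm_ge0 // lerDr.
by apply: le_trans h1 _; rewrite ler_wpM2r ?nm_ge0 // lerDl.
Qed.

Lemma unconditional_basis_scale (X : normedModType F) (A : set X) (e : nat -> X)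
    (c : nat -> F) :
  linear_subspace A -> (forall n, c n != 0) -> unconditional_basis A e ->
  unconditional_basis A (fun n => c n *: e n).
Proof.
move=> Alin c0 [eA he]; split=> [n|x /he [a [ha ua]]].
  exact: linear_subspaceZ.
have E (b : nat -> F) : (fun n => b n *: (c n *: e n)) = (fun n => (b n * c n) *: e n).
  by apply/funext => n; rewrite scalerA.
exists (fun n => a n / c n); rewrite E; split.
  rewrite (_ : (fun n => _) = (fun n => a n *: e n)) //.
  by apply/funext => n; rewrite divfK.
move=> b; rewrite E => /ua <-; apply/funext => n; by rewrite mulfK.
Qed.

Lemma unconditional_basis_transport (X Y : normedModType F) (A : set X) (B : set Y)
    (T : X -> Y) (e : nat -> X) :
  linear_subspace A -> isomorphism A B T -> unconditional_basis A e ->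
  unconditional_basis B (T \o e).
Proof.
move=> Alin /isomorphism_real_bounds [c [d [c0 d0 lin im h]]] [eA he].
split=> [n|y]; first by rewrite -im; exists (e n).
rewrite -im => -[x Ax <-]; have [a [ha ua]] := he x Ax.
have As (b : nat -> F) (s : nat -> nat) n : A (\sum_(i < n) b (s i) *: e (s i)).
  by apply: linear_subspace_sum.
have Ts (b : nat -> F) (s : nat -> nat) n : \sum_(i < n) b (s i) *: (T \o e) (s i) - T x =
    T (\sum_(i < n) b (s i) *: e (s i) - x).
  by rewrite (linear_onB lin) // (linear_on_sum Alin lin).
exists a; split.
  move=> s bs; apply/tendstoP => eps e0.
  have hc : 0 < eps / (c + 1) by rewrite divr_gt0 // ltr_wpDl.
  have /tendstoP /(_ _ hc) [N hN] := ha s bs.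
  exists N => n /hN; rewrite !seriesE Ts ler_pdivlMr ?ltr_wpDl // => hn.
  have [h1 _] := h _ (linear_subspaceB Alin (As a s n) Ax).
  apply: (le_trans h1); set t := nm _ in hn *.
  have t0 : 0 <= t by exact: nm_ge0.
  rewrite /= -/t in hn; lra.
move=> b /tendstoP hb; apply: ua; apply/tendstoP => eps e0.
have hd : 0 < eps / (d + 1) by rewrite divr_gt0 // ltr_wpDl.
have [N hN] := hb _ hd; exists N => n /hN; rewrite !seriesE (Ts b id).
rewrite ler_pdivlMr ?ltr_wpDl // => hn.
have [_ h1] := h _ (linear_subspaceB Alin (As b id n) Ax).
apply: (le_trans h1); set t := nm (T _) in hn *.
have t0 : 0 <= t by exact: nm_ge0.
lra.
Qed.

(** The vectors [T (e n)] have norms between two positive constants; dividing by these norms changes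
    the coefficients by bounded factors, which unconditionality absorbs. *)
Lemma normalized_basis_transport (X Y : normedModType F) (A : set X) (B : set Y)
    (e : nat -> X) (C : R) :
  linear_subspace A -> linear_subspace B -> isomorphic A B -> 0 <= C -> latt C e ->
  normalized_unconditional_basis A e ->
  exists (f : nat -> Y) (K : R), [/\ 0 <= K,
    normalized_unconditional_basis B f & eqvs K e f].
Proof.
move=> Alin Blin [T hT] C0 hl [be ne].
have bTe := unconditional_basis_transport Alin hT be.
have [c [d [c0 d0 lin im h]]] := isomorphism_real_bounds hT.
have ne1 n : nm (e n) = 1 by apply: emb_inj; rewrite nmE ne rmorph1.
have Te0 n : T (e n) != 0 by apply: basis_coord_neq0 bTe.
pose la n := (nm (T (e n)))^-1.
have nT n : 0 < nm (T (e n)) by rewrite nm_gt0.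
have la0 n : 0 < la n by rewrite invr_gt0.
exists (fun n => emb (la n) *: T (e n)), (C * c * d); split.
- by rewrite !mulr_ge0.
- split.
    apply: (unconditional_basis_scale (e := T \o e) (c := fun n => emb (la n))) => // n.
    by rewrite fmorph_eq0 gt_eqF.
  move=> n; rewrite -nmE nm_emb_scale ?(ltW (la0 n)) // mulVf ?rmorph1 //.
  by rewrite gt_eqF.
have eA : forall n, A (e n) by case: be.
move=> I al a hal; have As (b : I -> F) : A (\sum_i b i *: e (al i)).
  by apply: linear_subspace_sum => // i _.
have -> : \sum_i a i *: (emb (la (al i)) *: T (e (al i))) =
    T (\sum_i (a i * emb (la (al i))) *: e (al i)).
  rewrite (linear_on_sum Alin lin) //; apply: eq_bigr => i _.
  by rewrite scalerA.
have [h1 h2] := h _ (As (fun i => a i * emb (la (al i)))).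
have bd n : nm (T (e n)) <= c /\ 1 <= d * nm (T (e n)).
  by have := h _ (eA n); rewrite ne1 mulr1.
split.
  have h3 : nm (\sum_i a i *: e (al i)) <=
      C * nm (emb c *: \sum_i (a i * emb (la (al i))) *: e (al i)).
    rewrite scaler_sumr; under [in leRHS]eq_bigr do rewrite scalerA.
    apply: hl => // i; rewrite !abM !ab_emb (ger0_norm c0) ger0_norm ?(ltW (la0 _)) //.
    rewrite mulrCA ler_peMr ?ab_ge0 // /la ler_pdivlMr // mul1r.
    by case: (bd (al i)).
  rewrite nm_emb_scale // mulrA in h3; apply: (le_trans h3).
  by rewrite -[leRHS]mulrA ler_wpM2l ?mulr_ge0.
have h4 : nm (\sum_i (a i * emb (la (al i))) *: e (al i)) <=
    C * nm (emb d *: \sum_i a i *: e (al i)).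
  rewrite scaler_sumr; under [in leRHS]eq_bigr do rewrite scalerA.
  apply: hl => // i; rewrite !abM !ab_emb (ger0_norm d0) ger0_norm ?(ltW (la0 _)) //.
  rewrite mulrC ler_wpM2r ?ab_ge0 // /la -[leLHS]mul1r ler_pdivrMr //.
  by case: (bd (al i)).
rewrite nm_emb_scale // in h4.
apply: (le_trans h1); rewrite (mulrC C) -!mulrA ler_wpM2l //.
Qed.

Lemma normalized_basis_transport2 (X Y Z : normedModType F) (A : set X) (B : set Y)
    (D : set Z) (e : nat -> X) (C : R) :
  linear_subspace A -> linear_subspace B -> linear_subspace D ->
  isomorphic A D -> isomorphic B D -> 0 <= C -> latt C e ->
  normalized_unconditional_basis A e ->
  exists (f : nat -> Y) (K : R), [/\ 0 <= K,
    normalized_unconditional_basis B f & eqvs K e f].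
Proof.
move=> Al Bl Dl AD BD C0 hl he.
have [g [K [K0 hg eg]]] := normalized_basis_transport Al Dl AD C0 hl he.
have [|f [L [L0 hf gf]]] := normalized_basis_transport Dl Bl
  (isomorphic_sym Bl BD) _ (eqvs_latt C0 K0 hl eg) hg; first by rewrite !mulr_ge0.
exists f, (K * L); split=> //; first exact: mulr_ge0.
exact: eqvs_trans eg gf.
Qed.

End Transport.

(** * Subsequences of the basis and the two isomorphism classes *)

Section Genus.
Context {X : completeNormedModType F}.

Lemma bounded_linear_agree (Y : normedModType F) (T U : {linear X -> Y}) (A B : R)
    (D : set X) :
  (forall x, nm (T x) <= A * nm x) -> (forall x, nm (U x) <= B * nm x) ->
  (forall x, D x -> T x = U x) -> forall x, closure D x -> T x = U x.
Proof.
move=> hT hU TU x /closure_tendsto [u [Du ux]].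
have cont (W : {linear X -> Y}) (M : R) : (forall x, nm (W x) <= M * nm x) ->
    tendsto (fun n => W (u n)) (W x).
  move=> hW eps e0; have hM : 0 < eps / (`|M| + 1) by rewrite divr_gt0 // ltr_wpDl.
  have [N hN] := ux _ hM; exists N => n /hN; rewrite -linearB ler_pdivlMr ?ltr_wpDl //.
  move=> hn; apply: le_trans (hW _) _; set t := nm _ in hn *.
  have t0 : 0 <= t by exact: nm_ge0.
  have : M * t <= `|M| * t by rewrite ler_wpM2r // ler_norm.
  lra.
apply: tendsto_unique (cont T A hT) _.
by apply: tendsto_ext (cont U B hU) => n; rewrite TU.
Qed.

Lemma bounded_linear_is_continuous (Y : normedModType F) (T : {linear X -> Y}) (M : R) :
  (forall x, nm (T x) <= M * nm x) -> continuous T.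
Proof.
move=> hT; apply: bounded_linear_continuous.
apply/bounded_funP => r.
have [r0|r0] := boolP (0 <= r); last first.
  exists 0 => x xr; exfalso; move/negP : r0; apply; exact: le_trans xr.
exists (emb `|M| * r) => x xr; rewrite -nmE.
apply: (@le_trans _ _ (emb (`|M| * nm x))).
  rewrite emb_le; apply: le_trans (hT x) _.
  by rewrite ler_wpM2r ?nm_ge0 // ler_norm.
by rewrite rmorphM nmE ler_wpM2l // emb_ge0.
Qed.

(** The projection keeps the [e n] with [n] in the range of [s] and kills the others; as a 0-1
    multiplier it has norm at most [C]. *)
Lemma subsequence_complemented (e : nat -> X) (C : R) (s : nat -> nat) :
  0 <= C -> latt C e -> (forall i, e i != 0) -> closure (fspan e) = [set: X] ->
  complemented (closed_span (range (e \o s))).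
Proof.
move=> C0 hl e0 dense.
pose f n := if `[< exists k, s k = n >] then e n else 0.
have [|P [Pe Pb]] := basis_extension (f := f) C0 C0 hl e0 dense.
  move=> n a.
  rewrite (_ : \sum_(i < n) a i *: f i =
     \sum_(i < n) (if `[< exists k, s k = i >] then a i else 0) *: e i).
    apply: hl => [i j /val_inj //|i].
    by case: asboolP; rewrite ?ab0 ?ab_ge0.
  by apply: eq_bigr => i _; rewrite /f; case: asboolP; rewrite ?scale0r ?scaler0.
have Bl := closed_span_subspace (e \o s).
have Pfix x : closed_span (range (e \o s)) x -> P x = x.
  rewrite (closed_spanE).
  apply: (bounded_linear_agree (U := idfun) (A := C) (B := 1) (D := fspan (e \o s))) => //.
    by move=> y; rewrite mul1r.
  move=> _ [n [a ->]]; rewrite linear_sum; apply: eq_bigr => i _.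
  rewrite linearZ /= Pe /f; case: asboolP => // nk; by case: nk; exists i.
have Pin x : closed_span (range (e \o s)) (P x).
  have : closure (fspan e) x by rewrite dense.
  move=> /closure_tendsto [u [us ux]].
  rewrite (closed_spanE); apply/closure_tendsto.
  exists (fun n => P (u n)); split.
    move=> n; have [m [a ->]] := us n; rewrite linear_sum.
    under eq_bigr do rewrite linearZ /=.
    apply: linear_subspace_sum; first exact: fspan_subspace.
    move=> i _; rewrite Pe /f; case: asboolP => [[k <-]|_].
      exact: (fspan_gen (e \o s)).
    by case: (fspan_subspace (e \o s)).
  move=> eps eps0; have h : 0 < eps / (C + 1) by rewrite divr_gt0 // ltr_wpDl.
  have [N hN] := ux _ h; exists N => n /hN; rewrite -linearB ler_pdivlMr ?ltr_wpDl //.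
  move=> hn; apply: le_trans (Pb _) _; set t := nm _ in hn *.
  have t0 : 0 <= t by exact: nm_ge0.
  lra.
exists P; split.
- exact: bounded_linear_is_continuous Pb.
- by move=> x; apply: Pfix.
- apply/seteqP; split=> [_ [x _ <-]|x hx] //.
  by exists x => //; exact: Pfix.
Qed.

Lemma complemented_subspace (A : set X) : complemented A -> linear_subspace A.
Proof.
move=> [P [_ _ <-]]; split; first by exists 0; rewrite ?linear0.
by move=> a _ _ [x _ <-] [y _ <-]; exists (a *: x + y); rewrite ?linearP.
Qed.

Lemma ord2_cases (i j k : 'I_2) : i <> j -> k = i \/ k = j.
Proof.
move=> ij; have [->|ki] := eqVneq k i; [by left|right].
have ij' : val i != val j by rewrite (inj_eq val_inj); apply/eqP.
have ki' : val k != val i by rewrite (inj_eq val_inj).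
apply: val_inj; move: ij' ki' (ltn_ord i) (ltn_ord j) (ltn_ord k) => /=; lia.
Qed.

(** The span of the copy of c_0 and the whole space fill the two classes, unless they are
    isomorphic, and then uniqueness makes [e] itself a c_0 basis. Every subsequence spans a
    complemented subspace in one of the classes, and uniqueness of its basis turns the isomorphism
    into a permutative equivalence. *)
Lemma genus2_dichotomy (e : nat -> X) (C L0 : R) (s0 : nat -> nat) :
  genus 2 X -> normalized_unconditional_basis [set: X] e -> 0 <= C -> latt C e ->
  injective s0 -> bounded_sums L0 (e \o s0) ->
  (exists L, bounded_sums L e) \/
  forall s : nat -> nat, injective s ->
    (exists L, bounded_sums L (e \o s)) \/
    exists p : nat -> nat, injective p /\
      exists2 K : R, 0 <= K & eqvs K e (e \o s \o p).
Proof.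
move=> [[_ uX] uA [Cs [Cs1 Cs2 Cs3]]] he C0 hl is0 bs0.
have [be ne] := he.
have ne1 n : nm (e n) = 1 by apply: emb_inj; rewrite nmE ne rmorph1.
have e0 n : e n != 0 by rewrite -nm_gt0 ne1 ltr01.
have dense := unconditional_basis_dense be.
have sub s : injective s -> [/\ complemented (closed_span (range (e \o s))),
    linear_subspace (closed_span (range (e \o s))) &
    normalized_unconditional_basis (closed_span (range (e \o s))) (e \o s)].
  move=> hs; split.
  - exact: subsequence_complemented s C0 hl e0 dense.
  - exact: closed_span_subspace.
  - split; last by move=> n; exact: ne.
    apply: unconditional_basis_latt C0 (latt_comp hs hl) _ => i; exact: e0.
have Tl : linear_subspace [set: X] by [].
have Tc : complemented [set: X].
  exists idfun; split=> //; first by move=> x; exact: cvg_id.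
  by apply/seteqP; split=> // x _; exists x.
have [c0 l0 b0] := sub s0 is0.
have [i0 hi0] := Cs3 _ c0 (ex_intro _ _ b0.1).
have [i1 hi1] := Cs3 _ Tc (ex_intro _ _ be).
have Cl i : linear_subspace (Cs i) by apply: complemented_subspace; case: (Cs1 i).
have [i01|i01] := pselect (i0 = i1).
  left; rewrite -i01 in hi1.
  have [f [K [K0 hf ef]]] := normalized_basis_transport2 l0 Tl (Cl i0) hi0 hi1 C0
     (latt_comp is0 hl) b0.
  have [t [bt /equivalent_seq_eqvs [K' K'0 eft]]] := uX _ _ he hf.
  exists (K' * (K * L0)); apply: bounded_sums_eqvs (eqvs_sym eft) _ => //.
  by apply: bounded_sums_comp (bij_inj bt) _; exact: bounded_sums_eqvs ef bs0.
right=> s hs; have [cs ls bs] := sub s hs.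
have [j hj] := Cs3 _ cs (ex_intro _ _ bs.1).
have [_ us] := uA _ cs (ex_intro _ _ bs.1).
have [ji|ji] := ord2_cases j i01; subst j.
  left; have [f [K [K0 hf ef]]] := normalized_basis_transport2 l0 ls (Cl i0) hi0 hj C0
     (latt_comp is0 hl) b0.
  have [t [bt /equivalent_seq_eqvs [K' K'0 eft]]] := us _ _ bs hf.
  exists (K' * (K * L0)); apply: bounded_sums_eqvs (eqvs_sym eft) _ => //.
  by apply: bounded_sums_comp (bij_inj bt) _; exact: bounded_sums_eqvs ef bs0.
right; have [f [K [K0 hf ef]]] := normalized_basis_transport2 Tl ls (Cl i1) hi1 hj C0 hl he.
have [t [bt /equivalent_seq_eqvs [K' K'0 eft]]] := us _ _ hf bs.
exists t; split; first exact: bij_inj.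
exists (K * K'); first exact: mulr_ge0.
exact: eqvs_trans ef eft.
Qed.

End Genus.

(** * A subsequence of the basis spanning c_0 *)

Section Coordinates.
Lemma basis_coords (X : completeNormedModType F) (C : R) (e : nat -> X) :
  0 <= C -> latt C e -> (forall i, nm (e i) = 1) -> closure (fspan e) = [set: X] ->
  exists a : X -> nat -> F, [/\ forall x, usum e (a x) x,
    forall c x y i, a (c *: x + y) i = c * a x i + a y i,
    forall (I : finType) (al : I -> nat) (b : I -> F) n, injective al ->
      a (\sum_i b i *: e (al i)) n = \sum_(i | al i == n) b i &
    forall x n (B : pred nat), nm (\sum_(i < n | B i) a x i *: e i) <= C * nm x].
Proof.
move=> C0 hl ne dense.
have e0 i : e i != 0 by rewrite -nm_gt0 ne ltr01.
have /choice [a ha] : forall x, exists a, usum e a x.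
  by move=> x; apply: (usum_exists C0 hl e0); rewrite dense.
have uniq_a x (b : nat -> F) : tendsto (fun n => \sum_(i < n) b i *: e i) x -> b = a x.
  by move=> hb; apply: (tendsto_coord_unique hl e0 hb); exact: usum_tendsto.
exists a; split=> //.
- move=> c x y i; rewrite -(uniq_a (c *: x + y) (fun i => c * a x i + a y i)) //.
  apply: tendsto_ext (tendstoD (tendstoZ c (usum_tendsto (ha x))) (usum_tendsto (ha y))) => k /=.
  rewrite scaler_sumr -big_split /=; apply: eq_bigr => j _.
  by rewrite scalerDl scalerA.
- move=> I al b n hal; rewrite -(uniq_a _ (fun n => \sum_(i | al i == n) b i)) //.
  move=> eps eps0; have [N _ aN] := injective_bound al 0.
  exists N => m Nm.
  rewrite [X in X - _](_ : _ = \sum_i b i *: e (al i)); first by rewrite subrr nm0 ltW.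
  have am i : (al i < m)%N by exact: leq_trans (aN i) Nm.
  rewrite [RHS](partition_big (fun i => Ordinal (am i)) xpredT) //=.
  apply: eq_bigr => j _; rewrite scaler_suml; apply: eq_big => // i.
  by move=> /eqP ->.
- move=> x n B; apply/ler_addgt0Pr => eps eps0.
  have h : 0 < eps / (C + 1) by rewrite divr_gt0 // ltr_wpDl.
  have [N hN] := usum_tendsto (ha x) h.
  pose m := maxn n N.
  have : nm (\sum_(i < n | B i) a x i *: e i) <= C * nm (\sum_(i < m) a x i *: e i).
    rewrite (big_ord_widen_cond m B (fun i => a x i *: e i)) ?leq_maxl //.
    exact: (latt_mask (al := val) (fun i : 'I_m => a x i) (fun i => B i && (i < n)%N) hl val_inj).
  move/le_trans; apply.
  have := hN m (leq_maxr _ _); rewrite ler_pdivlMr ?ltr_wpDl // => hn.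
  have := nmD (\sum_(i < m) a x i *: e i - x) x; rewrite subrK.
  set s := nm (\sum_(i < m) _); set t := nm (_ - x) in hn *.
  have t0 : 0 <= t by exact: nm_ge0.
  move=> st; have : C * s <= C * (t + nm x) by rewrite ler_wpM2l.
  lra.
Qed.

Lemma unimodular_phase (z : F) : exists2 t : F, ab t = 1 & z = t * emb (ab z).
Proof.
have [->|z0] := eqVneq z 0; first by exists 1; rewrite ?ab1 // ab0 rmorph0 mulr0.
exists (z / emb (ab z)).
  by rewrite abM abV ab_emb ger0_norm ?ab_ge0 // divff // ab_eq0.
by rewrite divfK // fmorph_eq0 ab_eq0.
Qed.

End Coordinates.

(** * Norming functionals *)

Section HahnBanach.

(* The successive one-dimensional extensions in the proof of Hahn-Banach. *)
Lemma finite_hahn_banach (X : normedModType F) (u : X) (v : nat -> X) n :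
  exists h : nat -> R, forall (s : R) (t : nat -> R),
    s * nm u + \sum_(i < n) t i * h i <=
    nm (emb s *: u + \sum_(i < n) emb (t i) *: v i).
Proof.
elim: n => [|n [h IH]].
  exists (fun=> 0) => s t; rewrite !big_ord0 !addr0 nmZ ab_emb.
  by rewrite ler_wpM2r ?nm_ge0 // ler_norm.
pose f (st : R * (nat -> R)) := st.1 * nm u + \sum_(i < n) st.2 i * h i.
pose y (st : R * (nat -> R)) := emb st.1 *: u + \sum_(i < n) emb (st.2 i) *: v i.
have IH' st : f st <= nm (y st) by exact: IH.
(* A value on [v n] has to lie above all left sides and below all right sides; [g] will be the
   supremum of the left ones. *)
have sep st st' : f st - nm (y st - v n) <= nm (y st' + v n) - f st'.
  have h1 := IH' (st.1 + st'.1, fun i => st.2 i + st'.2 i).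
  have fD : f (st.1 + st'.1, fun i => st.2 i + st'.2 i) = f st + f st'.
    rewrite /f /= mulrDl addrACA -big_split /=; congr (_ + _).
    by apply: eq_bigr => i _; rewrite mulrDl.
  have yD : y (st.1 + st'.1, fun i => st.2 i + st'.2 i) = (y st - v n) + (y st' + v n).
    rewrite addrACA addNr addr0 /y /= rmorphD scalerDl addrACA -big_split /=.
    by congr (_ + _); apply: eq_bigr => i _; rewrite rmorphD scalerDl.
  rewrite fD yD in h1; have := nmD (y st - v n) (y st' + v n); lra.
pose A := range (fun st => f st - nm (y st - v n)).
have supA : has_sup A.
  split; first by exists (f (0, fun=> 0) - nm (y (0, fun=> 0) - v n)), (0, fun=> 0).
  by exists (nm (y (0, fun=> 0) + v n) - f (0, fun=> 0)) => _ [st _ <-]; exact: sep.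
pose g := sup A.
have lo st : f st - nm (y st - v n) <= g by apply: ub_le_sup; [case: supA|exists st].
have hi st : g <= nm (y st + v n) - f st.
  by apply: ge_sup; [case: supA|move=> _ [st' _ <-]; exact: sep].
exists (fun i => if (i < n)%N then h i else g) => s t.
rewrite !big_ord_recr /= ltnn.
under eq_bigr do rewrite ltn_ord.
rewrite [leLHS]addrA [X in _ <= nm X]addrA -/(f (s, t)) -/(y (s, t)).
have scale c : 0 < c ->
   f (c * s, fun i => c * t i) = c * f (s, t) /\
   y (c * s, fun i => c * t i) = emb c *: y (s, t).
  move=> c0; rewrite /f /y /= mulrDr mulrA mulr_sumr scalerDr scalerA -rmorphM scaler_sumr.
  split; congr (_ + _); apply: eq_bigr => i _; first by rewrite mulrA.
  by rewrite scalerA -rmorphM.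
(* Dividing by the modulus of [t n] reduces to the coefficients -1 and 1 of [v n], the cases [lo]
   and [hi]. *)
have [t0|t0|t0] := ltgtP (t n) 0.
- have c0 : 0 < (- t n)^-1 by rewrite invr_gt0 oppr_gt0.
  have [fE yE] := scale _ c0; have := lo ((- t n)^-1 * s, fun i => (- t n)^-1 * t i).
  rewrite fE yE.
  have -> : emb ((- t n)^-1) *: y (s, t) - v n =
      emb ((- t n)^-1) *: (y (s, t) + emb (t n) *: v n).
    have tn1 : (- t n)^-1 * t n = -1 by rewrite invrN mulNr mulVf // lt_eqF.
    by rewrite [RHS]scalerDr scalerA -rmorphM tn1 rmorphN rmorph1 scaleN1r.
  rewrite nm_emb_scale ?(ltW c0) //.
  set A1 := f _; set A2 := nm _ => hh.
  have : - t n * ((- t n)^-1 * A1 - (- t n)^-1 * A2) <= - t n * g.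
    by rewrite ler_pM2l // oppr_gt0.
  by rewrite -mulrBr mulrA divff ?mul1r ?oppr_eq0 ?lt_eqF //; lra.
- have c0 : 0 < (t n)^-1 by rewrite invr_gt0.
  have [fE yE] := scale _ c0; have := hi ((t n)^-1 * s, fun i => (t n)^-1 * t i).
  rewrite fE yE.
  have -> : emb ((t n)^-1) *: y (s, t) + v n =
      emb ((t n)^-1) *: (y (s, t) + emb (t n) *: v n).
    by rewrite [RHS]scalerDr scalerA -rmorphM mulVf ?gt_eqF // rmorph1 scale1r.
  rewrite nm_emb_scale ?(ltW c0) //.
  set A1 := f _; set A2 := nm _ => hh.
  have : t n * g <= t n * ((t n)^-1 * A2 - (t n)^-1 * A1) by rewrite ler_pM2l.
  by rewrite -mulrBr mulrA divff ?mul1r ?gt_eqF //; lra.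
- by rewrite t0 mul0r rmorph0 scale0r !addr0; exact: IH'.
Qed.

(** The extension above is for real coefficients. It is applied to the [e i] rotated by the phases
    of [c i], where [u] has real coordinates; undoing the phases gives a scalar functional, and
    replacing arbitrary coefficients by real ones of at most the same moduli costs the factor
    [C]. *)
Lemma norming_functional (X : normedModType F) (C : R) (e : nat -> X) (c : nat -> F)
    (B : pred nat) n :
  0 <= C -> latt C e -> nm (\sum_(i < n | B i) c i *: e i) = 1 ->
  exists g : nat -> F, \sum_(i < n | B i) g i * c i = 1 /\
    forall a : nat -> F, ab (\sum_(i < n | B i) g i * a i) <=
      C * nm (\sum_(i < n | B i) a i *: e i).
Proof.
move=> C0 hl nu.
have /choice [ph hph] : forall i, exists t : F, ab t = 1 /\ c i = t * emb (ab (c i)).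
  by move=> i; have [t t1 t2] := unimodular_phase (c i); exists t.
have ph0 i : ph i != 0 by rewrite -ab_eq0 (hph i).1 oner_eq0.
set u := \sum_(i < n | B i) _ in nu.
pose v i := if B i then ph i *: e i else 0.
have [h hh] := finite_hahn_banach u v n.
have vE (t : nat -> R) : \sum_(i < n) emb (t i) *: v i =
    \sum_(i < n | B i) (emb (t i) * ph i) *: e i.
  rewrite [RHS]big_mkcond; apply: eq_bigr => i _; rewrite /v.
  by case: (B i); rewrite ?scaler0 ?scalerA.
have uE : \sum_(i < n) emb (ab (c i)) *: v i = u.
  by rewrite (vE (fun i => ab (c i))); apply: eq_bigr => i _; rewrite mulrC -(hph i).2.
(* Off [B] the vector [v i] is 0, and testing with both signs forces the value there to vanish. *)
have hB i : (i < n)%N -> ~~ B i -> h i = 0.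
  move=> lin nB.
  have key (r : R) : r * h i <= 0.
    have := hh 0 (fun j => if j == i then r else 0).
    rewrite mul0r add0r rmorph0 scale0r add0r (bigD1 (Ordinal lin)) //= eqxx.
    rewrite big1 ?addr0; last first.
      by move=> j; rewrite -(inj_eq val_inj) /= => /negbTE ->; rewrite mul0r.
    rewrite (_ : \sum_(_ < n) _ = 0) ?nm0 // big1 // => j _.
    case: eqP => [->|_]; last by rewrite rmorph0 scale0r.
    by rewrite /v (negbTE nB) scaler0.
  have := key 1; have := key (-1); lra.
have hsum (t : nat -> R) : \sum_(i < n) t i * h i = \sum_(i < n | B i) t i * h i.
  rewrite [RHS]big_mkcond; apply: eq_bigr => i _; case: ifP => // /negbT nB.
  by rewrite hB ?mulr0 // ltn_ord.
(* [u] is itself the combination of the [v i] with coefficients [ab (c i)]; the inequality at both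
   signs pins its value to [nm u]. *)
have hc : \sum_(i < n | B i) ab (c i) * h i = 1.
  have h1 := hh (-1) (fun i => ab (c i)); have h2 := hh 1 (fun i => - ab (c i)).
  move: h1; rewrite uE (hsum (fun i => ab (c i))) rmorphN rmorph1 scaleN1r addNr nm0 nu.
  move: h2; rewrite (hsum (fun i => - ab (c i))) rmorph1 scale1r nu.
  under eq_bigr do rewrite mulNr; rewrite sumrN.
  rewrite (_ : \sum_(i < n) emb (- ab (c i)) *: v i = - u).
    by rewrite subrr nm0; lra.
  by rewrite -uE -sumrN; apply: eq_bigr => i _; rewrite rmorphN scaleNr.
exists (fun i => emb (h i) / ph i); split.
  rewrite -[RHS](rmorph1 emb) -hc rmorph_sum; apply: eq_bigr => i _.
  by rewrite [in LHS](hph i).2 mulrA divfK // rmorphM mulrC.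
move=> a; apply: le_trans (ab_sum _ _) _.
apply: (@le_trans _ _ (\sum_(i < n | B i) (Num.sg (h i) * ab (a i)) * h i)).
  apply: ler_sum => i _; rewrite !abM abV (hph i).1 invr1 mulr1 ab_emb.
  by rewrite mulrAC -normrEsg.
rewrite -(hsum (fun i => Num.sg (h i) * ab (a i))); have := hh 0 (fun i => Num.sg (h i) * ab (a i)).
rewrite mul0r add0r rmorph0 scale0r add0r => /le_trans; apply; rewrite (vE (fun i => Num.sg (h i) * ab (a i))).
have mask (b : nat -> F) : \sum_(i < n | B i) b i *: e i =
    \sum_(i < n) (if B i then b i else 0) *: e i.
  by rewrite big_mkcond; apply: eq_bigr => i _; case: (B i); rewrite ?scale0r.
rewrite (mask (fun i => emb (Num.sg (h i) * ab (a i)) * ph i)) (mask a); apply: hl => [|i]; first exact: val_inj.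
case: (B i) => //; rewrite abM (hph i).1 mulr1 ab_emb normrM normr_sg.
rewrite (ger0_norm (ab_ge0 _)); case: (h i != 0); rewrite ?mul1r // mul0r; exact: ab_ge0.
Qed.

End HahnBanach.

(** * Adding a summand c_0 to X *)

Section C0Summand.
(** Indices outside [P] go beyond all values of [be], so that [latt], which demands an injective
    family, applies to masked sums. *)
Lemma injective_extension (I : finType) (P : pred I) (be : I -> nat) :
  {in P &, injective be} ->
  exists2 be' : I -> nat, injective be' & forall i, P i -> be' i = be i.
Proof.
move=> hbe; pose N := (\max_i be i).+1.
have beN i : (be i < N)%N by rewrite ltnS leq_bigmax.
exists (fun i => if P i then be i else (N + enum_rank i)%N); last by move=> i ->.
move=> i j; case: ifP => Pi; case: ifP => Pj.
- exact: hbe.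
- by move=> E; have := beN i; rewrite E ltnNge leq_addr.
- by move=> E; have := beN j; rewrite -E ltnNge leq_addr.
- by move/addnI/val_inj/enum_rank_inj.
Qed.

Lemma sum_mask (X : lmodType F) (I : finType) (P : pred I) (d : I -> F) (v : I -> X) :
  \sum_(i | P i) d i *: v i = \sum_i (if P i then d i else 0) *: v i.
Proof.
by rewrite big_mkcond; apply: eq_bigr => i _; case: (P i); rewrite ?scale0r.
Qed.

Lemma latt_on (X : normedModType F) (C : R) (e : nat -> X) (I : finType) (P : pred I)
    (be : I -> nat) (a b : I -> F) :
  latt C e -> {in P &, injective be} -> (forall i, P i -> ab (a i) <= ab (b i)) ->
  nm (\sum_(i | P i) a i *: e (be i)) <= C * nm (\sum_(i | P i) b i *: e (be i)).
Proof.
move=> hl /injective_extension [be' be'_inj be'E] hab.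
have E (d : I -> F) : \sum_(i | P i) d i *: e (be i) =
    \sum_i (if P i then d i else 0) *: e (be' i).
  by rewrite -sum_mask; apply: eq_bigr => i /be'E ->.
rewrite (E a) (E b); apply: hl => // i; case: ifP => // /hab //.
Qed.

Context {X : completeNormedModType F} (C : R) (e : nat -> X).
Context (C0 : 0 <= C) (hl : latt C e) (ne : forall i, nm (e i) = 1)
  (dense : closure (fspan e) = [set: X]).
Context (bl Q : nat -> nat) (c : nat -> F) (hQ : forall i, (i < Q (bl i))%N).

(** The blocks partition all the indices: [i] lies in block [bl i], and [Q k] is a strict upper
    bound for block [k] that makes the sum finite. *)
Let u k := \sum_(i < Q k | bl i == k) c i *: e i.

Lemma block_widen k N : (Q k <= N)%N ->
  u k = \sum_(i < N) (if bl i == k then c i else 0) *: e i.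
Proof.
move=> QN; rewrite /u (big_ord_widen_cond N (fun i => bl i == k) (fun i => c i *: e i)) //.
rewrite -sum_mask; apply: eq_bigl => i; case: eqP => //= <-; exact: hQ.
Qed.

(** A combination of blocks is a combination of [e] whose coefficient at [m] involves only the block
    of [m]. *)
Lemma latt_blocks : latt C u.
Proof.
move=> I al a b hal hab.
pose N := \max_i Q (al i).
pose coef (a : I -> F) m := (\sum_(i | al i == bl m) a i) * c m.
have E (d : I -> F) : \sum_i d i *: u (al i) = \sum_(m < N) coef d m *: e m.
  rewrite (eq_bigr (fun i => \sum_(m < N) (if bl m == al i then d i * c m else 0) *: e m)).
    rewrite exchange_big /=; apply: eq_bigr => m _; rewrite -scaler_suml; congr (_ *: _).
    rewrite /coef mulr_suml [RHS]big_mkcond; apply: eq_bigr => i _.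
    by rewrite eq_sym.
  move=> i _; rewrite (@block_widen _ N); last exact: (@leq_bigmax _ (fun i => Q (al i)) i).
  rewrite scaler_sumr; apply: eq_bigr => m _; rewrite scalerA.
  by case: eqP; rewrite ?mulr0.
rewrite (E a) (E b); apply: hl => [|m]; first exact: val_inj.
rewrite /coef !abM ler_wpM2r ?ab_ge0 //.
have [[i /eqP im]|no] := pselect (exists i, al i == bl m); last first.
  by rewrite !big_pred0 ?ab0 // => i; apply/negP => h; apply: no; exists i.
have p : (fun j => al j == bl m) =1 pred1 i by move=> j; rewrite -im (inj_eq hal).
by rewrite !(eq_bigl _ _ p) !big_pred1_eq.
Qed.

Context (nu : forall k, nm (u k) = 1) (L : R) (hL : forall n, nm (\sum_(k < n) u k) <= L).

Lemma bounded_sums_blocks : bounded_sums (C * L) u.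
Proof.
move=> I al hal; have [N _ aN] := injective_bound al 0.
rewrite (sum_injective u hal aN).
have := latt_mask (fun=> 1) (fun j : 'I_N => [exists i, al i == j]) latt_blocks val_inj.
under eq_bigr do rewrite scale1r.
under [in X in _ <= C * X]eq_bigr do rewrite scale1r.
by move/le_trans; apply; rewrite ler_wpM2l.
Qed.

Lemma block_sum_le (I : finType) (P : pred I) (al : I -> nat) (b : I -> F) M :
  {in P &, injective al} -> 0 <= M -> (forall i, P i -> ab (b i) <= M) ->
  nm (\sum_(i | P i) b i *: u (al i)) <= C * (M * (C * L)).
Proof.
move=> hal M0 hb.
have [al' al'_inj al'E] := injective_extension hal.
rewrite (_ : \sum_(i | P i) _ = \sum_i (if P i then b i else 0) *: u (al' i)); last first.
  by rewrite -sum_mask; apply: eq_bigr => i /al'E ->.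
apply: le_trans (latt_blocks (b := fun=> emb M) al'_inj _) _.
  by move=> i; rewrite ab_emb ger0_norm //; case: ifP => [/hb //|_]; rewrite ab0.
rewrite ler_wpM2l // -scaler_sumr nm_emb_scale // ler_wpM2l //.
exact: bounded_sums_blocks.
Qed.

Lemma fspan_sum (Y : normedModType F) (g : nat -> Y) (I : finType) (P : pred I)
    (d : I -> F) (v : I -> Y) :
  (forall i, P i -> fspan g (v i)) -> fspan g (\sum_(i | P i) d i *: v i).
Proof. by move=> h; apply: linear_subspace_sum => //; exact: fspan_subspace. Qed.

(* Splitting the blocks into two halves exhibits X as X + c_0: with h_k the
   functional norming u_k, x + t |-> x + sum_k h_k(x) (u_(2k) - u_k) + sum_k t_k u_(2k+1)
   is an isomorphism; the resulting basis of X interleaves the images of e and of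
   the unit vectors of c_0. *)
Lemma c0_summand_basis : exists f : nat -> X, [/\ unconditional_basis [set: X] f,
  forall k, nm (f k.*2.+1) = 1 & exists L', bounded_sums L' (fun k => f k.*2.+1)].
Proof.
have e0 i : e i != 0 by rewrite -nm_gt0 ne ltr01.
have [a [ax alin afin abd]] := basis_coords C0 hl ne dense.
have /choice [g hg] : forall k, exists g : nat -> F,
    \sum_(i < Q k | bl i == k) g i * c i = 1 /\
    forall a : nat -> F, ab (\sum_(i < Q k | bl i == k) g i * a i) <=
      C * nm (\sum_(i < Q k | bl i == k) a i *: e i).
  move=> k; exact: (norming_functional (B := fun i => bl i == k) C0 hl (nu k)).
pose G i := g (bl i) i.
pose h k x := \sum_(i < Q k | bl i == k) G i * a x i.
have hE k x : h k x = \sum_(i < Q k | bl i == k) g k i * a x i.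
  by apply: eq_bigr => i /eqP ik; rewrite /G ik.
have hlin k t x y : h k (t *: x + y) = t * h k x + h k y.
  rewrite /h mulr_sumr -big_split /=; apply: eq_bigr => i _.
  by rewrite alin mulrDr mulrCA.
have h00 k : h k 0 = 0.
  have := hlin k 1 0 0; rewrite scale1r addr0 mul1r => E.
  by apply: (@addrI _ (h k 0)); rewrite -E addr0.
have hD k x y : h k (x + y) = h k x + h k y.
  by have := hlin k 1 x y; rewrite scale1r mul1r.
have hZ k t x : h k (t *: x) = t * h k x.
  by have := hlin k t x 0; rewrite !addr0 h00 addr0.
have hB k x y : h k (x - y) = h k x - h k y by rewrite hD -scaleN1r hZ mulN1r.
have hsum k (I : finType) (P : pred I) (v : I -> X) :
    h k (\sum_(i | P i) v i) = \sum_(i | P i) h k (v i).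
  exact: (big_morph (h k) (hD k) (h00 k)).
pose D := C * C; have D0 : 0 <= D by rewrite mulr_ge0.
have hb k x : ab (h k x) <= D * nm x.
  rewrite hE; apply: le_trans ((hg k).2 _) _; rewrite /D -mulrA ler_wpM2l //.
  exact: (abd x (Q k) (fun i => bl i == k)).
have ae n i : a (e n) i = (i == n)%:R.
  have := afin 'I_1 (fun=> n) (fun=> 1) i.
  rewrite big_ord1 scale1r => ->; last by move=> ? ?; rewrite !ord1.
  by rewrite big_mkcond big_ord1 eq_sym; case: (i == n).
have he k n : h k (e n) = if bl n == k then G n else 0.
  rewrite /h; under eq_bigr do rewrite ae.
  case: eqP => [nk|nk]; last first.
    by rewrite big1 // => i /eqP ik; case: eqP => [E|_]; [by case: nk; rewrite -E|rewrite mulr0].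
  have nQ : (n < Q k)%N by rewrite -nk hQ.
  rewrite (bigD1 (Ordinal nQ)) /= ?nk // eqxx mulr1 big1 ?addr0 // => i /andP[_].
  by rewrite -(inj_eq val_inj) /= => /negbTE ->; rewrite mulr0.
have hu k j : h k (u j) = (k == j)%:R.
  rewrite hsum; under eq_bigr do rewrite hZ he.
  case: eqP => [<-|kj].
    rewrite -(hg k).1; apply: eq_bigr => i ik; rewrite ik mulrC.
    by rewrite /G (eqP ik).
  by rewrite big1 // => i /eqP ij; case: eqP => [E|_]; [by case: kj; rewrite -E|rewrite mulr0].
(* Even indices carry the images of [e], odd ones the blocks of odd number, which span the added
   c_0; [G n] is the value at [e n] of the functional of its block. *)
pose f m := if odd m then u m else e m./2 + G m./2 *: (u (bl m./2).*2 - u (bl m./2)).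
pose B := C * (C * L).
have L0 : 0 <= L by apply: le_trans (hL 0); exact: nm_ge0.
have B0 : 0 <= B by rewrite !mulr_ge0.
have usum_le (I : finType) (P : pred I) (al : I -> nat) (b : I -> F) M :
    {in P &, injective al} -> 0 <= M -> (forall i, P i -> ab (b i) <= M) ->
    nm (\sum_(i | P i) b i *: u (al i)) <= B * M.
  move=> q1 q2 q3; apply: le_trans (block_sum_le q1 q2 q3) _.
  by rewrite /B mulrCA mulrC.
(* [E] is the component x of the pair (x, t) whose image is the given combination of [f]. *)
pose E (I : finType) (al : I -> nat) (b : I -> F) :=
  \sum_(i | ~~ odd (al i)) b i *: e (al i)./2.
have decomp (I : finType) (al : I -> nat) (b : I -> F) : injective al ->
    exists N, (forall k, (N <= k)%N -> h k (E I al b) = 0) /\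
    \sum_i b i *: f (al i) = E I al b +
      \sum_(k < N) h k (E I al b) *: (u k.*2 - u k) + \sum_(i | odd (al i)) b i *: u (al i).
  move=> hal; have hEk k : h k (E I al b) =
      \sum_(i | ~~ odd (al i)) if bl (al i)./2 == k then b i * G (al i)./2 else 0.
    rewrite hsum; apply: eq_bigr => i _; rewrite hZ he.
    by case: eqP; rewrite ?mulr0.
  pose N := (\max_i bl (al i)./2).+1.
  have bN i : (bl (al i)./2 < N)%N by rewrite ltnS (@leq_bigmax _ (fun i => bl (al i)./2) i).
  exists N; split.
    move=> k Nk; rewrite hEk big1 // => i _; case: eqP => // ik.
    by have := bN i; rewrite ik ltnNge Nk.
  rewrite (bigID (fun i => odd (al i))) /= addrC; congr (_ + _); last first.
    by apply: eq_bigr => i oi; rewrite /f oi.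
  rewrite (eq_bigr (fun i => b i *: e (al i)./2 +
      (b i * G (al i)./2) *: (u (bl (al i)./2).*2 - u (bl (al i)./2)))); last first.
    by move=> i /negbTE oi; rewrite /f oi scalerDr scalerA.
  rewrite big_split /=; congr (_ + _).
  under [RHS]eq_bigr do rewrite hEk scaler_suml.
  rewrite exchange_big /=; apply: eq_bigr => i _.
  rewrite (bigD1 (Ordinal (bN i))) //= eqxx big1 ?addr0 // => k.
  by rewrite -(inj_eq val_inj) /= eq_sym => /negbTE ->; rewrite scale0r.
(* Applying [h j] to the image cancels [h j x] against the subtracted [u j]: an even j = 2k returns
   [h k x], an odd j the coefficient of [u j]. So all the c_0 data are controlled by the norm of the
   image. *)
have lower (I : finType) (al : I -> nat) (b : I -> F) : injective al ->
    (forall k, ab (h k (E I al b)) <= D * nm (\sum_i b i *: f (al i))) /\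
    (forall i, odd (al i) -> ab (b i) <= D * nm (\sum_i b i *: f (al i))).
  move=> hal; have [N [hN dec]] := decomp I al b hal.
  set x := E I al b in hN dec *; set y := \sum_i _ in dec *.
  have hy j : h j y = \sum_(k < N) h k x * (j == k.*2)%:R +
      \sum_(i | odd (al i)) b i * (j == al i)%:R.
    rewrite dec !hD; congr (_ + _); last first.
      by rewrite hsum; apply: eq_bigr => i _; rewrite hZ hu.
    rewrite (hsum j _ _ (fun k : 'I_N => h k x *: _)) (eq_bigr (fun k : 'I_N => h k x * (j == k.*2)%:R - h k x * (j == k)%:R)).
      rewrite sumrB addrCA -[RHS]addr0; congr (_ + _).
      apply/eqP; rewrite subr_eq0; apply/eqP.
      have [jN|Nj] := ltnP j N; last first.
        rewrite hN // big1 // => k _; case: eqP => [jk|_]; last by rewrite mulr0.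
        by have := ltn_ord k; rewrite -jk ltnNge Nj.
      rewrite (bigD1 (Ordinal jN)) //= eqxx mulr1 big1 ?addr0 // => k.
      by rewrite -(inj_eq val_inj) /= eq_sym => /negbTE ->; rewrite mulr0.
    by move=> k _; rewrite hZ hB !hu mulrBr.
  split=> [k|i oi].
    have [kN|Nk] := ltnP k N; last by rewrite hN // ab0 mulr_ge0 ?nm_ge0.
    rewrite (_ : h k x = h k.*2 y) ?hb // hy (bigD1 (Ordinal kN)) //= eqxx mulr1.
    rewrite big1 ?addr0; last first.
      move=> j; rewrite -(inj_eq val_inj) /= eq_sym -(inj_eq double_inj) => /negbTE ->.
      by rewrite mulr0.
    rewrite big1 ?addr0 // => j oj; case: eqP => [E1|_]; last by rewrite mulr0.
    by move: oj; rewrite -E1 odd_double.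
  rewrite (_ : b i = h (al i) y) ?hb // hy big1 ?add0r; last first.
    by move=> k _; case: eqP => [E1|_]; rewrite ?mulr0 //; move: oi; rewrite E1 odd_double.
  rewrite (bigD1 i) //= eqxx mulr1 big1 ?addr0 // => j /andP[_ ji].
  by rewrite (inj_eq hal) eq_sym (negbTE ji) mulr0.
have half_inj (I : finType) (al : I -> nat) : injective al ->
    {in [pred i | ~~ odd (al i)] &, injective (fun i => (al i)./2)}.
  move=> hal i j /negbTE oi /negbTE oj ij; apply: hal.
  by rewrite -[al i]odd_double_half -[al j]odd_double_half oi oj ij.
have corr (N : nat) (x : X) M : 0 <= M -> (forall k, ab (h k x) <= M) ->
    nm (\sum_(k < N) h k x *: (u k.*2 - u k)) <= B * M + B * M.
  move=> M0 hM; under eq_bigr do rewrite scalerBr.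
  rewrite sumrB; apply: le_trans (nmB _ _) _; apply: lerD.
    by apply: usum_le => // i j _ _ /double_inj/val_inj.
  by apply: usum_le => // i j _ _ /val_inj.
(* Recovering x from its image subtracts three c_0 sums, along [u k.*2], [u k] and the odd blocks,
   each at most [B * D] times the norm of the image. *)
pose K1 := 1 + 3 * B * D.
have lowerE (I : finType) (al : I -> nat) (b : I -> F) : injective al ->
    nm (E I al b) <= K1 * nm (\sum_i b i *: f (al i)).
  move=> hal; have [l1 l2] := lower I al b hal.
  have [N [hN dec]] := decomp I al b hal.
  set x := E I al b in l1 hN dec *; set y := \sum_i _ in l1 l2 dec *.
  have M0 : 0 <= D * nm y by rewrite mulr_ge0 ?nm_ge0.
  have c1 := corr N x _ M0 l1.
  have c2 : nm (\sum_(i | odd (al i)) b i *: u (al i)) <= B * (D * nm y).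
    by apply: usum_le => // i j _ _ /hal.
  have -> : x = y - (\sum_(k < N) h k x *: (u k.*2 - u k) +
                     \sum_(i | odd (al i)) b i *: u (al i)).
    by rewrite dec -[x + _ + _]addrA addrK.
  apply: le_trans (nmB _ _) _.
  apply: le_trans (lerD (lexx _) (nmD _ _)) _.
  rewrite /K1; lra.
have upper (I : finType) (al : I -> nat) (b : I -> F) M : injective al -> 0 <= M ->
    (forall i, odd (al i) -> ab (b i) <= M) ->
    nm (\sum_i b i *: f (al i)) <= (1 + 2 * B * D) * nm (E I al b) + B * M.
  move=> hal M0 hM; have [N [hN dec]] := decomp I al b hal.
  rewrite dec; apply: le_trans (nmD _ _) _; apply: lerD; last first.
    by apply: usum_le => // i j _ _ /hal.
  apply: le_trans (nmD _ _) _.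
  have := corr N (E I al b) _ _ (hb ^~ _); rewrite mulr_ge0 ?nm_ge0 // => /(_ isT).
  lra.
have K10 : 0 <= K1 by rewrite addr_ge0 // !mulr_ge0.
pose K := (1 + 2 * B * D) * (C * K1) + B * D.
have K0 : 0 <= K by rewrite addr_ge0 ?mulr_ge0 ?addr_ge0 ?mulr_ge0.
have lf : latt K f.
  move=> I al b d hal hbd; have [_ l2] := lower I al d hal.
  set y := \sum_i d i *: _ in l2 *.
  have M0 : 0 <= D * nm y by rewrite mulr_ge0 ?nm_ge0.
  apply: le_trans (upper I al b _ hal M0 _) _.
    by move=> i oi; apply: le_trans (hbd i) (l2 i oi).
  have h1 : nm (E I al b) <= C * (K1 * nm y).
    apply: le_trans (latt_on hl (half_inj I al hal) (fun i _ => hbd i)) _.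
    by rewrite ler_wpM2l //; exact: lowerE.
  have h2 : (1 + 2 * B * D) * nm (E I al b) <= (1 + 2 * B * D) * (C * (K1 * nm y)).
    by rewrite ler_wpM2l // addr_ge0 // !mulr_ge0.
  apply: (le_trans (lerD h2 (lexx _))).
  by rewrite /K le_eqVlt; apply/orP; left; apply/eqP; ring.
have fo k : f k.*2.+1 = u k.*2.+1 by rewrite /f /= odd_double.
have fe n : f n.*2 = e n + G n *: (u (bl n).*2 - u (bl n)).
  by rewrite /f odd_double doubleK.
have f0 m : f m != 0.
  rewrite -(odd_double_half m); case: (odd m) => /=.
    by rewrite add1n fo -nm_gt0 nu ltr01.
  rewrite add0n; apply/eqP => fm0.
  have := lowerE 'I_1 (fun=> (m./2).*2) (fun=> 1) (fun i j _ => etrans (ord1 i) (esym (ord1 j))).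
  rewrite big_ord1 fm0 scaler0 nm0 mulr0 /E (eq_bigl xpredT); last first.
    by move=> i; rewrite odd_double.
  by rewrite big_ord1 scale1r doubleK ne leNgt ltr01.
have fu j : fspan f (u j).
  rewrite -(odd_double_half j); case: (odd j); first by rewrite add1n -fo; exact: fspan_gen.
  rewrite add0n; set k := j./2.
  have -> : u k.*2 = \sum_(i < Q k | bl i == k) c i *: f i.*2.
    under eq_bigr do rewrite fe scalerDr scalerA.
    rewrite big_split /= -/(u k).
    rewrite (eq_bigr (fun i : 'I_(Q k) => (g k i * c i) *: (u k.*2 - u k))); last first.
      by move=> i /eqP ik; rewrite /G ik mulrC.
    by rewrite -scaler_suml (hg k).1 scale1r addrC subrK.
  by apply: fspan_sum => i _; exact: fspan_gen.
have fdense : closed_span (range f) = [set: X].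
  apply/seteqP; split=> // x _; rewrite closed_spanE.
  have : closure (fspan e) x by rewrite dense.
  apply: closure_subset => _ [n [b ->]]; apply: fspan_sum => i _.
  have -> : e i = f i.*2 - G i *: (u (bl i).*2 - u (bl i)) by rewrite fe addrK.
  have fs := fspan_subspace f.
  apply: linear_subspaceB => //; first exact: fspan_gen.
  by apply: linear_subspaceZ => //; apply: linear_subspaceB.
exists f; split.
- by rewrite -fdense; exact: unconditional_basis_latt K0 lf f0.
- by move=> k; rewrite fo nu.
- exists (C * L) => I al hal.
  under eq_bigr do rewrite fo.
  by apply: (bounded_sums_blocks (al := fun i => (al i).*2.+1)) => i j [] /double_inj /hal.
Qed.

End C0Summand.

(** * Blocks of the basis equivalent to the c_0 basis *)

Section GlidingHump.
Lemma c0_norm_eq1 (v : nat -> F) : (forall n, `|v n| <= 1) -> (exists n, `|v n| = 1) ->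
  c0_norm v = 1.
Proof.
move=> v1 [n0 vn0]; rewrite /c0_norm /supremum.
have ub1 : ubound (range (fun n => `|v n|)) 1 by move=> _ [n _ <-].
have in1 : range (fun n => `|v n|) 1 by exists n0.
case: ifPn => [/eqP E|_]; first by move: in1; rewrite E.
case: xgetP => [y _ [yub ylb]|/(_ 1)].
  by apply/eqP; rewrite eq_le (ylb _ ub1) (yub _ in1).
by case; split=> // y yub; exact: yub.
Qed.

Lemma c0_eventually0 (v : nat -> F) N : (forall n, (N <= n)%N -> v n = 0) -> c0 v.
Proof.
move=> h; apply/cvgrPdist_le => eps e0; exists N => // n /= /h ->.
by rewrite subrr normr0 ltW.
Qed.

(** [w] is the image of the unit vectors of c_0. Unimodular coefficients are allowed because they
    will be chosen to make coordinates add up in modulus. *)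
Lemma contains_c0_sequence (X : normedModType F) : contains_c0 X ->
  exists (w : nat -> X) (L d : R), [/\ 0 <= L, 0 < d,
    forall (I : finType) (al : I -> nat) (t : I -> F), injective al ->
      (forall i, ab (t i) = 1) -> nm (\sum_i t i *: w (al i)) <= L &
    forall n, 1 <= d * nm (w n)].
Proof.
move=> [J [c [d [Jlin [/emb_nneg [cr ->] /emb_nneg [dr ->]] hc hd]]]].
pose de (n m : nat) := (m == n)%:R : F.
pose comb (I : finType) (al : I -> nat) (t : I -> F) (s : seq I) :=
  fun m : nat => \sum_(i <- s) t i * de (al i) m.
have combc0 (I : finType) (al : I -> nat) t s : c0 (comb I al t s).
  have [N _ aN] := injective_bound al 0.
  apply: (@c0_eventually0 _ N) => n Nn; rewrite /comb big1 // => i _.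
  rewrite /de; case: eqP => [E|_]; last by rewrite mulr0.
  by have := aN i; rewrite -E ltnNge Nn.
have dec0 n : c0 (de n).
  by apply: (@c0_eventually0 _ n.+1) => m; rewrite /de => /gtn_eqF ->.
have z0 : c0 (fun=> 0 : F) by apply: (@c0_eventually0 _ 0%N).
have J0 : J (fun=> 0) = 0.
  have := Jlin 1 _ _ z0 z0; rewrite scale1r.
  rewrite (_ : (fun n => _) = fun=> 0); last by apply/funext => n; rewrite mulr0 addr0.
  by move=> E; apply: (@addrI _ (J (fun=> 0))); rewrite -E addr0.
have Jcomb (I : finType) (al : I -> nat) t s :
    J (comb I al t s) = \sum_(i <- s) t i *: J (de (al i)).
  elim: s => [|i s IH].
    by rewrite big_nil -J0; congr J; apply/funext => m; rewrite /comb big_nil.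
  rewrite big_cons -IH -Jlin //; congr J; apply/funext => m.
  by rewrite /comb big_cons.
have abs_le (r : R) : r <= `|r| by exact: ler_norm.
exists (fun n => J (de n)), `|cr|, (`|dr| + 1); split.
- exact: normr_ge0.
- by rewrite ltr_wpDl.
- move=> I al t hal ht; rewrite -Jcomb -(@emb_le _ _ S) nmE.
  have [i0|noI] := pselect (exists i : I, True); last first.
    have -> : comb I al t (index_enum I) = fun=> 0.
      apply/funext => m; rewrite /comb big1 // => i; case: noI; by exists i.
    by rewrite J0 normr0 emb_ge0 normr_ge0.
  case: i0 => i0 _.
  apply: le_trans (hc _ (combc0 _ _ _ _)) _.
  have val1 i : comb I al t (index_enum I) (al i) = t i.
    rewrite /comb (bigD1 i) //= /de eqxx mulr1 big1 ?addr0 // => j ji.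
    by rewrite (inj_eq hal) eq_sym (negbTE ji) mulr0.
  have t1 i : `|t i| = 1 by rewrite -abE ht rmorph1.
  rewrite c0_norm_eq1; last by exists (al i0); rewrite val1 t1.
    by rewrite mulr1 emb_le.
  move=> n; have [[i <-]|ni] := pselect (exists i, al i = n).
    by rewrite val1 t1.
  rewrite /comb big1 ?normr0 ?ler01 // => i _; rewrite /de.
  by case: eqP => [E|_]; [case: ni; exists i|rewrite mulr0].
- move=> n; have := hd _ (dec0 n); rewrite c0_norm_eq1; last by exists n; rewrite /de eqxx normr1.
    rewrite -nmE -rmorphM -(rmorph1 emb) emb_le => /le_trans; apply.
    by rewrite ler_wpM2r ?nm_ge0 // (le_trans (abs_le dr)) // lerDl.
  by move=> m; rewrite /de; case: (m == n); rewrite ?normr1 ?normr0.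
Qed.

Lemma geometric_sum_le (n : nat) : \sum_(k < n) (2 ^- k.+1 : R) <= 1.
Proof.
suff -> : \sum_(k < n) (2 ^- k.+1 : R) = 1 - 2 ^- n.
  by rewrite lerBlDr lerDl invr_ge0 exprn_ge0.
elim: n => [|n IH]; first by rewrite big_ord0 expr0 invr1 subrr.
rewrite big_ord_recr /= IH exprS invfM.
set x := (2 ^+ n)^-1; lra.
Qed.

(** Late vectors [w n] are small on any given initial segment of coordinates, and each has a small
    tail; so some are close to their restrictions to successive intervals. *)
Lemma gliding_hump (X : completeNormedModType F) (C : R) (e : nat -> X)
    (w : nat -> X) (L d : R) :
  0 <= C -> latt C e -> (forall i, nm (e i) = 1) -> closure (fspan e) = [set: X] ->
  0 <= L -> 0 < d ->
  (forall (I : finType) (al : I -> nat) (t : I -> F), injective al ->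
      (forall i, ab (t i) = 1) -> nm (\sum_i t i *: w (al i)) <= L) ->
  (forall n, 1 <= d * nm (w n)) ->
  exists (bl Q : nat -> nat) (c : nat -> F) (L' : R), [/\ forall i, (i < Q (bl i))%N,
    forall k, nm (\sum_(i < Q k | bl i == k) c i *: e i) = 1 &
    forall n, nm (\sum_(k < n) \sum_(i < Q k | bl i == k) c i *: e i) <= L'].
Proof.
move=> C0 hl ne dense L0 d0 hw wd.
have [a [ax alin _ abd]] := basis_coords C0 hl ne dense.
have ab_coord x i : ab (a x i) <= C * nm x.
  have := abd x i.+1 (pred1 i); rewrite (big_pred1 ord_max) ?nmZ ?ne ?mulr1 //.
have asum i (I : finType) (t : I -> F) (v : I -> X) :
    a (\sum_j t j *: v j) i = \sum_j t j * a (v j) i.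
  have aD x y : a (x + y) i = a x i + a y i by have := alin 1 x y i; rewrite scale1r mul1r.
  have a0 : a 0 i = 0.
    have := aD 0 0; rewrite addr0 => E; by apply: (@addrI _ (a 0 i)); rewrite -E addr0.
  rewrite (big_morph (fun x => a x i) aD a0); apply: eq_bigr => j _.
  by have := alin (t j) (v j) 0 i; rewrite a0 !addr0.
(* With phases making the i-th coordinates of all [w k] nonnegative, the sum of their moduli is a
   coordinate of a bounded vector; hence the series of moduli converges. *)
have coord0 i (eps : R) : 0 < eps -> exists N, forall n, (N <= n)%N ->
    ab (a (w n) i - 0) <= eps.
  move=> eps0.
  have [|N hN] := bounded_sums_cauchy (fun n => ab_ge0 (a (w n) i)) (rho := C * L) _ eps0.
    move=> n; have /choice [ph hph] : forall k, exists t : F,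
        ab t = 1 /\ t * a (w k) i = emb (ab (a (w k) i)).
      move=> k; have [t t1 tE] := unimodular_phase (a (w k) i).
      have t0 : t != 0 by rewrite -ab_eq0 t1 oner_eq0.
      exists t^-1; rewrite abV t1 invr1; split=> //.
      by rewrite [X in _ * X = _]tE mulKf.
    have := ab_coord (\sum_(k < n) ph k *: w k) i.
    rewrite asum (eq_bigr (fun k : 'I_n => emb (ab (a (w k) i)))); last first.
      by move=> k _; rewrite (hph k).2.
    rewrite -rmorph_sum ab_emb ger0_norm; last by apply: sumr_ge0 => k _; exact: ab_ge0.
    move/le_trans; apply; rewrite ler_wpM2l //.
    by apply: hw => [|k]; [exact: val_inj|exact: (hph k).1].
  by exists N => n /hN /(_ 1%N); rewrite addn1 big_nat1 subr0.
pose Sp p x := \sum_(i < p) a x i *: e i.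
have Sp0 p : tendsto (fun n => Sp p (w n)) 0.
  rewrite (_ : 0 = \sum_(i < p) (0 : F) *: e i); last by rewrite big1 // => i _; rewrite scale0r.
  by apply: tendsto_sum => i; apply: tendsto_scale; exact: coord0.
have step (pNe : nat * nat * R) : exists nq : nat * nat, 0 < pNe.2 ->
    [/\ (pNe.1.2 <= nq.1)%N, (pNe.1.1 < nq.2)%N &
     nm (w nq.1 - (Sp nq.2 (w nq.1) - Sp pNe.1.1 (w nq.1))) <= pNe.2].
  case: pNe => [[p N] eps] /=; have [e0|e0] := ltP 0 eps; last by exists (0%N, 0%N).
  have e2 : 0 < eps / 2 by lra.
  have [N1 h1] := Sp0 p _ e2; pose n := maxn N N1.
  have [N2 h2] := usum_tendsto (ax (w n)) e2; pose q := maxn N2 p.+1.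
  exists (n, q) => _ /=; split; [exact: leq_maxl|exact: leq_maxr|].
  have := h1 n (leq_maxr _ _); rewrite subr0 => k1.
  have := h2 q (leq_maxl _ _); rewrite -/(Sp q (w n)) nm_distC => k2.
  rewrite opprB addrCA addrC; have := nmD (w n - Sp q (w n)) (Sp p (w n)); lra.
have /choice [g hg] := step.
(* Half the lower bound 1/d for the norms of [w]. With errors [ep] of total at most [eta], each
   block keeps norm at least [eta] and sums of blocks stay below [L + eta]. *)
pose eta := (2 * d)^-1; have eta0 : 0 < eta by rewrite invr_gt0 mulr_gt0.
pose ep k : R := eta * 2 ^- k.+1.
have ep0 k : 0 < ep k by rewrite mulr_gt0 // invr_gt0 exprn_gt0.
(* The state is the left end of the next block and the least index into [w] still allowed. *)
pose fix st k := if k is j.+1 then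
  ((g (st j, ep j)).2, (g (st j, ep j)).1.+1) else (0%N, 0%N).
pose P k := (st k).1; pose nn k := (g (st k, ep k)).1.
have Plt j : (P j < P j.+1)%N by have [] := hg (st j, ep j) (ep0 j).
have nnS k : (nn k < nn k.+1)%N by have [] := hg (st k.+1, ep k.+1) (ep0 k.+1).
have nn_inj : injective nn.
  have nn_lt : {homo nn : i j / (i < j)%N} by apply: homo_ltn => // i j k; exact: ltn_trans.
  by move=> i j E; case: (ltngtP i j) => // /nn_lt; rewrite E ltnn.
have /choice [bl hbl] := blocks_cover erefl Plt.
have blE (i k : nat) : (bl i == k) = (P k <= i < P k.+1)%N.
  apply/eqP/idP => [<-|h]; [exact: hbl|exact (blocks_unique Plt (hbl i) h)].
pose Q k := P k.+1.
have hQ i : (i < Q (bl i))%N by case/andP: (hbl i).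
pose c0 i := a (w (nn (bl i))) i.
pose u0 k := \sum_(i < Q k | bl i == k) c0 i *: e i.
have u0E k : u0 k = Sp (P k.+1) (w (nn k)) - Sp (P k) (w (nn k)).
  rewrite /Sp (big_ord_widen _ (fun i => a (w (nn k)) i *: e i) (ltnW (Plt k))).
  rewrite [X in X - _](bigID (fun i : 'I_ _ => (i < P k)%N)) /= [RHS]addrAC subrr add0r.
  apply: eq_big => [i|i /eqP ik]; last by rewrite /c0 ik.
  by rewrite blE ltn_ord andbT -leqNgt.
have wu k : nm (w (nn k) - u0 k) <= ep k.
  by rewrite u0E; have [] := hg (st k, ep k) (ep0 k).
have ep_le k : ep k <= eta.
  rewrite /ep -[leRHS]mulr1 ler_pM2l // invf_le1 ?exprn_gt0 // exprn_ege1 // ler1n //.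
have u0_ge k : eta <= nm (u0 k).
  have h1 : 2 * eta <= nm (w (nn k)).
    rewrite /eta invfM mulrA divff ?pnatr_eq0 // mul1r -[_^-1]mul1r ler_pdivrMr //.
    by rewrite mulrC.
  have := nmD (w (nn k) - u0 k) (u0 k); rewrite subrK.
  have := wu k; have := ep_le k; lra.
have u0_sum n : nm (\sum_(k < n) u0 k) <= L + eta.
  have -> : \sum_(k < n) u0 k = \sum_(k < n) (1 : F) *: w (nn k) - \sum_(k < n) (w (nn k) - u0 k).
    rewrite -sumrB; apply: eq_bigr => k _; by rewrite scale1r opprB addrC subrK.
  apply: le_trans (nmB _ _) _; apply: lerD.
    by apply: (hw 'I_n (fun k => nn k)) => [i j /nn_inj/val_inj //|i]; rewrite ab1.
  apply: le_trans (nm_sum _ _) _.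
  apply: (@le_trans _ _ (\sum_(k < n) ep k)); first by apply: ler_sum => k _; exact: wu.
  rewrite /ep -mulr_sumr -[leRHS]mulr1 ler_pM2l //; exact: geometric_sum_le.
have nu0 k : 0 < nm (u0 k) by apply: lt_le_trans (u0_ge k).
(* The normalizing factors are at most [eta^-1], which unconditionality of the blocks absorbs. *)
pose la k := (nm (u0 k))^-1.
have la0 k : 0 < la k by rewrite invr_gt0.
have uE k : \sum_(i < Q k | bl i == k) (emb (la (bl i)) * c0 i) *: e i = emb (la k) *: u0 k.
  by rewrite scaler_sumr; apply: eq_bigr => i /eqP ->; rewrite scalerA.
exists bl, Q, (fun i => emb (la (bl i)) * c0 i), (C * (eta^-1 * (L + eta))); split=> //.
  by move=> k; rewrite uE nm_emb_scale ?(ltW (la0 k)) // mulVf // gt_eqF.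
move=> n; under eq_bigr do rewrite uE.
have lu0 : latt C u0 by exact: (latt_blocks hl c0 hQ).
have eV0 : 0 <= eta^-1 by rewrite invr_ge0 ltW.
apply: le_trans (lu0 'I_n val (fun k => emb (la k)) (fun=> emb (eta^-1)) val_inj _) _.
  move=> i; rewrite !ab_emb (ger0_norm (ltW (la0 _))) (ger0_norm eV0).
  by rewrite lef_pV2 ?posrE.
rewrite /= -scaler_sumr nm_emb_scale // ler_wpM2l // ler_wpM2l //; exact: u0_sum.
Qed.

(** Normalizing the basis of X + c_0 gives a second normalized basis of X; uniqueness matches it
    with [e] up to a permutation, and its odd-indexed vectors with the desired subsequence. *)
Lemma c0_subsequence (X : completeNormedModType F) (C : R) (e : nat -> X) :
  unique_normalized_unconditional_basis [set: X] -> contains_c0 X ->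
  normalized_unconditional_basis [set: X] e -> 0 <= C -> latt C e ->
  exists (s : nat -> nat) (L : R), injective s /\ bounded_sums L (e \o s).
Proof.
move=> [_ uX] hc0 he C0 hl; have [be ne] := he.
have ne1 n : nm (e n) = 1 by apply: emb_inj; rewrite nmE ne rmorph1.
have dense := unconditional_basis_dense be.
have [w [L [d [L0 d0 hw wd]]]] := contains_c0_sequence hc0.
have [bl [Q [c [L' [hQ nu hL']]]]] := gliding_hump C0 hl ne1 dense L0 d0 hw wd.
have [f [bf nf [M hM]]] := c0_summand_basis C0 hl ne1 dense hQ nu hL'.
have f0 n : f n != 0 by apply: basis_coord_neq0 bf.
pose la n := (nm (f n))^-1.
have la0 n : 0 < la n by rewrite invr_gt0 nm_gt0.
pose f' n := emb (la n) *: f n.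
have bf' : normalized_unconditional_basis [set: X] f'.
  split.
    apply: (unconditional_basis_scale (c := fun n => emb (la n))) bf => // n.
    by rewrite fmorph_eq0 gt_eqF.
  by move=> n; rewrite -nmE nm_emb_scale ?(ltW (la0 n)) // mulVf ?rmorph1 // nm_eq0.
have [s [bs /equivalent_seq_eqvs [K K0 ef]]] := uX _ _ bf' he.
pose o k := k.*2.+1.
have oinj : injective o by move=> i j [] /double_inj.
exists (s \o o), (K * M); split; first by apply: inj_comp => //; exact: bij_inj.
apply: (bounded_sums_eqvs K0 (eqvs_comp oinj ef)) => I al hal.
rewrite (eq_bigr (fun i => f (al i).*2.+1)); first exact: hM.
by move=> i _; rewrite /f' /o /= /la nf invr1 rmorph1 scale1r.
Qed.

End GlidingHump.

(** * Large sets of indices *)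

Section Enumeration.
Lemma enumerate_infinite (M : set nat) : (forall N, exists2 m, (N <= m)%N & M m) ->
  exists s : nat -> nat, [/\ injective s, forall n, M (s n) &
    forall m, M m -> exists n, s n = m].
Proof.
move=> unb.
have /choice [nx hnx] : forall N, exists m, (N <= m)%N /\ M m.
  by move=> N; have [m ? ?] := unb N; exists m.
pose g n := iter n (fun m => nx m.+1) (nx 0%N).
have gM n : M (g n) by case: n => [|n] /=; [case: (hnx 0%N)|case: (hnx (g n).+1)].
have gS n : (g n < g n.+1)%N by case: (hnx (g n).+1).
have g_lt : {homo g : i j / (i < j)%N} by apply: homo_ltn => // i j k; exact: ltn_trans.
have ginj : injective g.
  by move=> i j E; case: (ltngtP i j) => // /g_lt; rewrite E ltnn.
have h1 : ([set: nat] #<= M)%card.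
  have e1 : (range g #= [set: nat])%card.
    by apply: inj_card_eq => i j _ _; exact: ginj.
  by rewrite -(card_le_eql e1); apply: subset_card_le => _ [n _ <-].
have h2 : (M #<= [set: nat])%card by apply: subset_card_le.
have /card_set_bijP [s [s1 s2 s3]] : ([set: nat] #= M)%card.
  by rewrite card_eq_le h1 h2.
exists s; split=> [i j|n|m /s3 [n _ <-]]; last by exists n.
  by apply: s2; rewrite in_setT.
exact: s1.
Qed.

End Enumeration.

(** * Copies of the basis inside sets of indices *)

Section Core.
Context {X : normedModType F} (C : R) (e : nat -> X).
Context (C1 : 1 <= C) (hl : latt C e) (ne : forall i, nm (e i) = 1).

Let C0 : 0 <= C. Proof. exact: le_trans ler01 C1. Qed.

Definition phi (s : seq nat) : R := nm (\sum_(i <- s) e i).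

(** The copy may fill a proper part of [M]; a copy onto [M] is recovered by Schroeder-Bernstein. *)
Definition embeds (K : R) (M : set nat) := exists s : nat -> nat,
  [/\ injective s, forall n, M (s n) & eqvs K e (e \o s)].

Definition large (M : set nat) := forall L : R, exists s : seq nat,
  [/\ uniq s, forall i, i \in s -> M i & L < phi s].

Lemma nth_ord_inj (s : seq nat) : uniq s -> injective (fun i : 'I_(size s) => nth 0%N s i).
Proof.
by move=> us i j /eqP; rewrite nth_uniq // => /eqP /val_inj.
Qed.

Lemma phiE (s : seq nat) : phi s = nm (\sum_(i < size s) e (nth 0%N s i)).
Proof. by rewrite /phi (big_nth 0%N) big_mkord. Qed.

Lemma phi_sub (s s' : seq nat) : uniq s -> uniq s' -> {subset s <= s'} ->
  phi s <= C * phi s'.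
Proof.
move=> us us' sub.
have -> : phi s = nm (\sum_(i <- s' | i \in s) e i).
  have pe : perm_eq s [seq i <- s' | i \in s].
    apply: uniq_perm => //; first exact: filter_uniq.
    by move=> x; rewrite mem_filter; case: (boolP (x \in s)) => // /sub ->.
  by rewrite /phi (perm_big _ pe) big_filter.
rewrite phiE (big_nth 0%N) big_mkord.
have := latt_mask (fun=> 1) (fun i : 'I_(size s') => nth 0%N s' i \in s) hl (nth_ord_inj us').
under eq_bigr do rewrite scale1r.
by under [in X in _ <= C * X]eq_bigr do rewrite scale1r.
Qed.

Lemma phi_cat (s s' : seq nat) : phi (s ++ s') <= phi s + phi s'.
Proof. by rewrite /phi big_cat /=; exact: nmD. Qed.

Lemma phi_size (s : seq nat) : phi s <= (size s)%:R.
Proof.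
rewrite phiE; apply: le_trans (nm_sum _ _) _.
by under eq_bigr do rewrite ne; rewrite sumr_const card_ord.
Qed.

Lemma sum_scale1 (I : finType) (P : pred I) (v : I -> X) :
  \sum_(i | P i) (1 : F) *: v i = \sum_(i | P i) v i.
Proof. by apply: eq_bigr => i _; rewrite scale1r. Qed.

Lemma phi_nil : phi [::] = 0. Proof. by rewrite /phi big_nil nm0. Qed.

Lemma phi_perm (s s' : seq nat) : perm_eq s s' -> phi s = phi s'.
Proof. by move=> h; rewrite /phi (perm_big _ h). Qed.

Lemma phi_map (K : R) (t : nat -> nat) (s : seq nat) : eqvs K e (e \o t) -> uniq s ->
  phi s <= K * phi (map t s) /\ phi (map t s) <= K * phi s.
Proof.
move=> ht us; rewrite phiE /phi big_map (big_nth 0%N) big_mkord.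
have := ht _ _ (fun=> 1) (nth_ord_inj us).
by rewrite !sum_scale1.
Qed.

Lemma embeds_mono (K K' : R) (M M' : set nat) : K <= K' -> M `<=` M' ->
  embeds K M -> embeds K' M'.
Proof.
move=> KK MM [s [s1 s2 s3]]; exists s; split=> // [n|]; first exact/MM/s2.
exact: eqvs_weaken s3.
Qed.

(** Unconditionality bounds the parts over [Z] and off [Z] by [C] times the whole, so they can be
    compared separately, and off [Z] they coincide. *)
Lemma eqvs_glue (x y : nat -> X) (Z : set nat) (K : R) : latt C x -> latt C y ->
  0 <= K -> (forall i, ~ Z i -> x i = y i) ->
  (forall (I : finType) (P : pred I) (al : I -> nat) (a : I -> F), injective al ->
    (forall i, P i -> Z (al i)) ->
    nm (\sum_(i | P i) a i *: x (al i)) <= K * nm (\sum_(i | P i) a i *: y (al i)) /\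
    nm (\sum_(i | P i) a i *: y (al i)) <= K * nm (\sum_(i | P i) a i *: x (al i))) ->
  eqvs (C * (K + 1)) x y.
Proof.
move=> hx hy K0 xy hZ I al a hal.
pose P i := `[< Z (al i) >].
have hP i : P i -> Z (al i) by move=> /asboolP.
have [h1 h2] := hZ I P al a hal hP.
have E : \sum_(i | ~~ P i) a i *: x (al i) = \sum_(i | ~~ P i) a i *: y (al i).
  by apply: eq_bigr => i /asboolP nP; rewrite xy.
have x1 := latt_mask a P hx hal; have x2 := latt_mask a (predC P) hx hal.
have y1 := latt_mask a P hy hal; have y2 := latt_mask a (predC P) hy hal.
have ex (z : nat -> X) : \sum_i a i *: z (al i) =
    \sum_(i | P i) a i *: z (al i) + \sum_(i | ~~ P i) a i *: z (al i).
  by rewrite (bigID P).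
split; rewrite [X in nm X <= _]ex; apply: le_trans (nmD _ _) _.
  rewrite E; apply: le_trans (lerD h1 y2) _.
  by rewrite mulrDr mulr1 mulrDl lerD2r (mulrC C) -mulrA ler_wpM2l.
rewrite -E; apply: le_trans (lerD h2 x2) _.
by rewrite mulrDr mulr1 mulrDl lerD2r (mulrC C) -mulrA ler_wpM2l.
Qed.

(** [Z] collects the forward orbits under [f] of the points outside [M]. Using [f] on [Z] and the
    identity elsewhere gives a bijection onto [M], and gluing keeps the equivalence with [e]. *)
Lemma schroeder_bernstein_embeds (K : R) (M : set nat) : 0 <= K -> embeds K M ->
  exists h : nat -> nat, [/\ injective h, forall n, M (h n),
    forall m, M m -> exists n, h n = m & eqvs (C * (C * K + 1)) e (e \o h)].
Proof.
move=> K0 [f [finj fM hf]].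
pose Z := [set n | exists k z, ~ M z /\ n = iter k f z].
pose h n := if `[< Z n >] then f n else n.
have hZ n : Z n -> h n = f n by move=> Zn; rewrite /h asboolT.
have hnZ n : ~ Z n -> h n = n by move=> Zn; rewrite /h asboolF.
have Zf n : Z n -> Z (f n) by move=> [k [z [nz ->]]]; exists k.+1, z.
have hinj : injective h.
  move=> i j; have [Zi|Zi] := pselect (Z i); have [Zj|Zj] := pselect (Z j).
  - by rewrite !hZ // => /finj.
  - by rewrite (hZ i) // (hnZ j) // => E; case: Zj; rewrite -E; apply: Zf.
  - by rewrite (hnZ i) // (hZ j) // => E; case: Zi; rewrite E; apply: Zf.
  - by rewrite !hnZ.
have hM n : M (h n).
  have [Zn|Zn] := pselect (Z n); first by rewrite hZ.
  by rewrite hnZ //; apply: contrapT => nM; apply: Zn; exists 0%N, n.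
have hsurj m : M m -> exists n, h n = m.
  move=> Mm; have [Zm|Zm] := pselect (Z m); last by exists m; rewrite hnZ.
  case: Zm => -[|k] [z [nz E]]; first by rewrite E in Mm.
  by exists (iter k f z); rewrite hZ //; exists k, z.
exists h; split=> //.
apply: (eqvs_glue (Z := Z) hl (latt_comp hinj hl)); first by rewrite mulr_ge0.
  by move=> i nZ; rewrite /= hnZ.
move=> I P al a hal PZ.
have E : \sum_(i | P i) a i *: (e \o h) (al i) = \sum_(i | P i) a i *: e (f (al i)).
  by apply: eq_bigr => i /PZ Zi; rewrite /= hZ.
rewrite E !(sum_mask P).
have [p q] := hf I al (fun i => if P i then a i else 0) hal.
have CK : K <= C * K by rewrite ler_peMl.
by split; [apply: le_trans p _|apply: le_trans q _]; rewrite ler_wpM2r ?nm_ge0.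
Qed.

Lemma c0_sum_le (x : nat -> X) (I : finType) (P : pred I) (al : I -> nat) (a : I -> F)
    (M B : R) : latt C x -> injective al -> 0 <= M ->
  (forall i, P i -> ab (a i) <= M) -> nm (\sum_(i | P i) x (al i)) <= B ->
  nm (\sum_(i | P i) a i *: x (al i)) <= C * (M * B).
Proof.
move=> hx hal M0 ha hB; rewrite sum_mask.
apply: le_trans (hx I al _ (fun i => if P i then emb M else 0) hal _) _.
  by move=> i; case: ifP => // /ha; rewrite ab_emb ger0_norm.
rewrite ler_wpM2l // -sum_mask -scaler_sumr nm_emb_scale // ler_wpM2l //.
Qed.

Context (s0 : nat -> nat) (L0 : R) (s0_inj : injective s0)
  (hs0 : bounded_sums L0 (e \o s0)).

Let L00 : 0 <= L0.
Proof.
apply: le_trans (hs0 (al := fun i : 'I_0 => val i) _); first exact: nm_ge0.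
exact: val_inj.
Qed.

Lemma masked_bounded (I : finType) (P : pred I) (al : I -> nat) : injective al ->
  (forall i, P i -> exists k, al i = s0 k) -> nm (\sum_(i | P i) e (al i)) <= C * L0.
Proof.
move=> hal hP.
have /choice [be hbe] : forall i, exists k, P i -> al i = s0 k.
  move=> i; case: (boolP (P i)) => [/hP [k E]|_]; last by exists 0%N.
  by exists k.
have [|be' be'_inj be'E] := @injective_extension I P be.
  by move=> i j Pi Pj E; apply: hal; rewrite !hbe // E.
have -> : \sum_(i | P i) e (al i) = \sum_(i | P i) (1 : F) *: (e \o s0) (be' i).
  by apply: eq_bigr => i Pi; rewrite scale1r /= be'E // hbe.
have hl0 := latt_comp s0_inj hl.
apply: le_trans (latt_mask (fun=> 1) P hl0 be'_inj) _.
rewrite ler_wpM2l //; under eq_bigr do rewrite scale1r; exact: hs0.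
Qed.

(** The gluing constant [C * (K + 1)] for [K = C * (C * B)], where [B = C * L0 + d] bounds the sums
    of [e] over the indices that move: [C * L0] along the copy of c_0, and [d] for the indices to be
    absorbed. *)
Definition hotel_constant (d : nat) : R := C * (C * (C * (C * L0 + d%:R)) + 1).

Lemma hotel_constant_ge0 d : 0 <= hotel_constant d.
Proof. by rewrite !(mulr_ge0, addr_ge0). Qed.

(* Hilbert's hotel along the copy of c_0 carried by [mu]: the cost depends on the
   size of G only. *)
Lemma hotel (G : seq nat) (mu : nat -> nat) (M : set nat) (K : R) :
  injective mu -> (forall n, M (mu n)) -> (forall n, exists k, mu n = s0 k) ->
  0 <= K -> embeds K ([set x | x \in G] `|` M) ->
  embeds (K * hotel_constant (size G)) M.
Proof.
move=> muinj muM mus0 K0 [s [sinj sM hs]].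
pose d := size G.
have dec x : exists i : nat, (exists j, x = mu j) -> x = mu i.
  have [[j ->]|h] := pselect (exists j, x = mu j); first by exists j.
  by exists 0%N => /h.
have /choice [ix hix] := dec.
pose inmu x := `[< exists j, x = mu j >].
(* Points of [mu] move [d] places along [mu]; the points of [G] off [mu] take freed places, while
   those already on [mu] simply move along. *)
pose th x := if inmu x then mu (ix x + d)%N else if x \in G then mu (index x G) else x.
have ixK j : ix (mu j) = j by apply: muinj; rewrite -hix //; exists j.
have thmu j : th (mu j) = mu (j + d)%N.
  by rewrite /th /inmu asboolT ?ixK //; exists j.
have thG x : ~ (exists j, x = mu j) -> x \in G -> th x = mu (index x G).
  by move=> nx xG; rewrite /th /inmu asboolF // xG.
have tho x : ~ (exists j, x = mu j) -> x \notin G -> th x = x.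
  by move=> nx xG; rewrite /th /inmu asboolF // (negbTE xG).
have cases x : (exists j, x = mu j) \/ ~ (exists j, x = mu j) /\ x \in G \/
    ~ (exists j, x = mu j) /\ x \notin G.
  have [h|h] := pselect (exists j, x = mu j); first by left.
  by case: (boolP (x \in G)) => xG; right; [left|right].
have thinj : injective th.
  move=> x y; case: (cases x) => [[i ->]|[[nx xG]|[nx xG]]];
    case: (cases y) => [[j ->]|[[ny yG]|[ny yG]]].
  - by rewrite !thmu => /muinj /addIn ->.
  - rewrite thmu (thG y) // => /muinj E; have : (index y G < d)%N by rewrite index_mem.
    by rewrite -E ltnNge leq_addl.
  - by rewrite thmu (tho y) // => E; case: ny; exists (i + d)%N.
  - rewrite thmu (thG x) // => /muinj E; have : (index x G < d)%N by rewrite index_mem.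
    by rewrite E ltnNge leq_addl.
  - by rewrite !thG // => /muinj /index_inj ->.
  - by rewrite (thG x) // (tho y) // => E; case: ny; exists (index x G).
  - by rewrite thmu (tho x) // => E; case: nx; exists (j + d)%N.
  - by rewrite (thG y) // (tho x) // => E; case: nx; exists (index y G).
  - by rewrite !tho.
have thM x : ([set x | x \in G] `|` M) x -> M (th x).
  case: (cases x) => [[i ->] _|[[nx xG] _|[nx xG]]].
  - by rewrite thmu.
  - by rewrite thG.
  - by rewrite tho // => -[/= h|//]; rewrite h in xG.
have lth := latt_comp thinj hl.
have heq : eqvs (hotel_constant d) e (e \o th).
  pose B := C * L0 + d%:R.
  have B0 : 0 <= B by rewrite !(mulr_ge0, addr_ge0).
  (* On the indices that [th] may move, both [e] and [e \o th] have bounded sums, hence both norms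
     are comparable with the largest coefficient. *)
  apply: (eqvs_glue (Z := [set x | (exists j, x = mu j) \/ x \in G]) hl lth).
  - by rewrite !mulr_ge0.
  - move=> x nZ; rewrite /= tho //; first by move=> h; apply: nZ; left.
    by apply/negP => h; apply: nZ; right.
  move=> I P al a hal PZ.
  have cnt : nm (\sum_(i | P i && (al i \in G)) e (al i)) <= d%:R.
    apply: le_trans (nm_sum _ _) _; under eq_bigr do rewrite ne.
    rewrite sumr_const ler_nat cardE -(size_map al).
    apply: uniq_leq_size; first by rewrite map_inj_uniq // enum_uniq.
    by move=> x /mapP [i]; rewrite mem_enum => /andP[_ iG] ->.
  have b1 : nm (\sum_(i | P i) e (al i)) <= B.
    rewrite (bigID (fun i => al i \in G)) /= addrC.
    apply: le_trans (nmD _ _) _; apply: lerD => //.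
    apply: masked_bounded => // i /andP[/PZ [[j E] _|-> //]].
    by rewrite E; exact: mus0.
  have b2 : nm (\sum_(i | P i) (e \o th) (al i)) <= B.
    apply: (@le_trans _ _ (C * L0)); last by rewrite lerDl.
    apply: (masked_bounded (al := th \o al)); first exact: inj_comp.
    move=> i /PZ [[j E]|iG] /=; first by rewrite E thmu.
    case: (cases (al i)) => [[j ->]|[[nx xG]|[nx xG]]]; first by rewrite thmu.
      by rewrite thG.
    by rewrite iG in xG.
  have coord (x : nat -> X) i : latt C x -> (forall n, nm (x n) = 1) -> P i ->
      ab (a i) <= C * nm (\sum_(i | P i) a i *: x (al i)).
    move=> hx nx Pi; rewrite sum_mask.
    have := latt_coord (fun i => if P i then a i else 0) i hx hal.
    by rewrite Pi nx mulr1.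
  have nth n : nm ((e \o th) n) = 1 by exact: ne.
  split.
    apply: le_trans (c0_sum_le (M := C * nm (\sum_(i | P i) a i *: (e \o th) (al i)))
      hl hal _ _ b1) _; first by rewrite mulr_ge0 ?nm_ge0.
      by move=> i; exact: coord.
    by rewrite /B le_eqVlt; apply/orP; left; apply/eqP; ring.
  apply: le_trans (c0_sum_le (M := C * nm (\sum_(i | P i) a i *: e (al i)))
    lth hal _ _ b2) _; first by rewrite mulr_ge0 ?nm_ge0.
    by move=> i; exact: coord.
  by rewrite /B le_eqVlt; apply/orP; left; apply/eqP; ring.
exists (th \o s); split; first exact: inj_comp.
- by move=> n; exact/thM/sM.
- apply: eqvs_trans hs _ => //; first exact: hotel_constant_ge0.
  exact: (eqvs_comp sinj heq).
Qed.

End Core.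

(** * Large sets of bounded size *)

Section ShortLargeSets.
Context {X : normedModType F} (C : R) (e : nat -> X).
Context (C1 : 1 <= C) (hl : latt C e) (ne : forall i, nm (e i) = 1).
Context (dich : forall s : nat -> nat, injective s ->
  (exists L, bounded_sums L (e \o s)) \/
  exists p : nat -> nat, injective p /\ exists2 K : R, 0 <= K & eqvs K e (e \o s \o p)).

Let C0 : 0 <= C. Proof. exact: le_trans ler01 C1. Qed.
Let phi := phi e.

(** An enumeration of [M] is a subsequence to which the dichotomy applies; bounded sums along it
    would contradict largeness. *)
Lemma large_embeds (M : set nat) : large e M -> exists2 K : R, 0 <= K & embeds e K M.
Proof.
move=> lM; have [|s [sinj sM sonto]] := @enumerate_infinite M.
  move=> N; apply: contrapT => no; have [s [us sM]] := lM N%:R.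
  rewrite ltNge => /negP; apply; apply: le_trans (phi_size ne s) _.
  rewrite ler_nat -[N](size_iota 0); apply: uniq_leq_size => // i /sM Mi.
  by rewrite mem_iota /= add0n ltnNge; apply/negP => Ni; apply: no; exists i.
have [[L hL]|[p [pinj [K K0 hK]]]] := dich sinj; last first.
  exists K => //; exists (s \o p); split=> //; first exact: inj_comp.
  by move=> n; exact: sM.
have [t [ut tM]] := lM L; rewrite ltNge => /negP; case.
have /choice [r hr] : forall m, exists n, M m -> s n = m.
  move=> m; have [/sonto [n <-]|nM] := pselect (M m); first by exists n.
  by exists 0%N.
have nthM (i : 'I_(size t)) : M (nth 0%N t i) by apply/tM/mem_nth.
rewrite phiE (eq_bigr (fun i : 'I_(size t) => (e \o s) (r (nth 0%N t i)))).
  apply: hL => i j E; apply: (nth_ord_inj ut).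
  by rewrite -(hr _ (nthM i)) -(hr _ (nthM j)) E.
by move=> i _; rewrite /= hr.
Qed.

Context (lT : large e [set: nat]).

Lemma large_tail (l : nat) (B : R) : exists q0, forall q, (q0 <= q)%N ->
  B < phi (iota l (q - l)).
Proof.
have [s [us _ hs]] := lT (C * (B + l%:R)).
exists (maxn l (\max_(i <- s) i).+1) => q; rewrite geq_max => /andP[lq sq].
have h1 : phi s <= C * phi (iota 0 q).
  apply: phi_sub => //; first exact: iota_uniq.
  move=> i si; rewrite mem_iota /= add0n; apply: leq_trans sq.
  by rewrite ltnS; apply: (@leq_bigmax_seq _ s xpredT id).
have h2 : phi (iota 0 q) <= phi (iota 0 l) + phi (iota l (q - l)).
  by rewrite -{1}(subnKC lq) iotaD add0n; exact: phi_cat.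
have h3 : phi (iota 0 l) <= l%:R by rewrite -{2}(size_iota 0 l); exact: phi_size.
have Cp : 0 < C by apply: lt_le_trans C1.
have h4 : C * (B + l%:R) < C * (l%:R + phi (iota l (q - l))).
  apply: lt_le_trans hs (le_trans h1 _); rewrite ler_wpM2l //.
  by apply: le_trans h2 _; rewrite lerD2r.
by move: h4; rewrite ltr_pM2l //; lra.
Qed.

(* If all short sets far out were small, then along a sufficiently lacunary sequence
   of intervals of growing norm, a copy of e inside the union of every fourth
   interval would be impossible: an intermediate interval I splits, according to
   where its elements are sent, into two short pieces. *)
Lemma short_large_sets (B : R) : exists n, forall N, exists s,
  [/\ uniq s, forall i, i \in s -> (N <= i)%N, (size s <= n)%N & B < phi s].
Proof.
apply: contrapT => no.
have /choice [Nf hN] : forall n, exists N, forall s, uniq s ->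
    (forall i, i \in s -> (N <= i)%N) -> (size s <= n)%N -> phi s <= B.
  move=> n; apply: contrapT => h; apply: no; exists n => N.
  apply: contrapT => h2; apply: h; exists N => s us sN sn.
  by rewrite leNgt; apply/negP => Bs; apply: h2; exists s.
(* The next end point lies beyond [Nf l], past which sets of at most [l] elements are small, and far
   enough out for the interval to have norm above [j]. *)
have /choice [g hg] : forall jl : nat * nat, exists q,
    [/\ (jl.2 < q)%N, (Nf jl.2 <= q)%N & jl.1%:R < phi (iota jl.2 (q - jl.2))].
  move=> [j l] /=; have [q0 hq0] := large_tail l j%:R.
  exists (maxn q0 (maxn l.+1 (Nf l))); split.
  - by rewrite !leq_max leqnn !orbT.
  - by rewrite !leq_max leqnn !orbT.
  - by apply: hq0; rewrite leq_max leqnn.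
pose fix l k := if k is j.+1 then g (j, l j) else 0%N.
have lS k : (l k < l k.+1)%N by case: (hg (k, l k)).
have lN k : (Nf (l k) <= l k.+1)%N by case: (hg (k, l k)).
have lphi k : k%:R < phi (iota (l k) (l k.+1 - l k)) by case: (hg (k, l k)).
have lmono i j : (i <= j)%N -> (l i <= l j)%N by exact: blocks_mono lS i j.
pose I k := iota (l k) (l k.+1 - l k).
have memI k x : (x \in I k) = (l k <= x < l k.+1)%N.
  by rewrite mem_iota subnKC // ltnW.
pose M := [set x | exists k, (l (4 * k) <= x < l (4 * k).+1)%N].
have lM : large e M.
  move=> L; pose k := (Num.truncn L).+1; exists (I (4 * k)); split.
  - exact: iota_uniq.
  - by move=> i; rewrite memI => h; exists k.
  - apply: lt_trans (lphi (4 * k)%N); apply: lt_le_trans (truncnS_gt L) _.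
    by rewrite ler_nat -/k leq_pmull.
have [K K0 [s [sinj sM hs]]] := large_embeds lM.
(* The splitting will bound [phi A] by [K * (K * B + B)]; [k] is chosen to contradict this. *)
pose k := (Num.truncn (K * (K * B + B))).+1.
pose A := I (4 * k).+2.
have big : K * (K * B + B) < phi A.
  apply: lt_trans (lphi (4 * k).+2); apply: lt_le_trans (truncnS_gt _) _.
  by rewrite ler_nat -/k (leq_trans (leq_pmull k (isT : 0 < 4)%N)) // leqW.
have uA : uniq A by exact: iota_uniq.
(* [M] has no point from [l (4 * k).+1] up to [l (4 * k.+1)], so [c] tells on which side of [A] an
   element is sent. *)
pose c x := (s x < l (4 * k).+1)%N.
pose G := [seq x <- A | c x]; pose H := [seq x <- A | ~~ c x].
have uG : uniq G by exact: filter_uniq.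
have uH : uniq H by exact: filter_uniq.
have sA : phi (map s A) <= phi (map s G) + phi (map s H).
  rewrite /phi (@phi_perm _ _ _ (map s G ++ map s H)) ?phi_cat //.
  by rewrite -map_cat perm_map // perm_sym (perm_filterC c A).
(* Here the images are short: at most [l (4 * k).+3] of them, all beyond [l (4 * k).+4]. *)
have hH : phi (map s H) <= B.
  apply: (hN (l (4 * k).+3)); first by rewrite map_inj_uniq.
    move=> y /mapP [x]; rewrite mem_filter => /andP[ncx xA] ->.
    apply: (leq_trans (lN _)); have [k' /andP[h1 h2]] := sM x.
    have kk' : (k < k')%N.
      rewrite ltnNge; apply/negP => k'k; move/negP: ncx; apply.
      by apply: leq_trans h2 (lmono _ _ _); rewrite ltnS leq_mul2l.
    apply: leq_trans h1; apply: lmono; move: kk'; clearbody k; clear; lia.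
  rewrite size_map size_filter (leq_trans (count_size _ _)) // size_iota.
  exact: leq_subr.
(* Here the elements themselves are short: [s] injects them below [l (4 * k).+1], while they lie
   beyond [l (4 * k).+2]. *)
have hG : phi G <= B.
  apply: (hN (l (4 * k).+1)) => //.
    move=> x; rewrite mem_filter memI => /andP[_ /andP[h1 _]].
    exact: leq_trans (lN _) h1.
  rewrite -(size_map s) -[leqRHS](size_iota 0).
  apply: uniq_leq_size; first by rewrite map_inj_uniq.
  move=> y /mapP [x]; rewrite mem_filter => /andP[cx _] ->.
  by rewrite mem_iota.
have h1 : phi A <= K * phi (map s A) by case: (phi_map hs uA).
have h2 : phi (map s G) <= K * phi G by case: (phi_map hs uG).
have h3 : K * phi G <= K * B by rewrite ler_wpM2l.
have h4 : K * phi (map s A) <= K * (K * B + B).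
  rewrite ler_wpM2l //; lra.
lra.
Qed.

Context (s0 : nat -> nat) (s0_inj : injective s0).

Lemma injective_unbounded N : exists k, (N <= s0 k)%N.
Proof.
apply: contrapT => no.
have h k : (s0 k < N)%N by rewrite ltnNge; apply/negP => ?; apply: no; exists k.
have inj : injective (fun k : 'I_N.+1 => Ordinal (h k)).
  by move=> i j [] /s0_inj /val_inj.
have := leq_card _ inj; rewrite !card_ord ltnn //.
Qed.

(** The block is an index of [s0] followed by short large sets for 0, ..., k, each beyond the
    previous ones. Their sizes are bounded independently of [N] and [k], so in every block the set
    for j is complete within the first [r j] entries. *)
Lemma block_sequence : exists r : nat -> nat, forall k N, exists s : seq nat,
  [/\ uniq s, forall i, i \in s -> (N <= i)%N, (k < size s)%N,
      exists j, nth 0%N s 0 = s0 j &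
      forall j n, (j <= k)%N -> (r j <= n)%N -> j%:R < C * phi (take n s)].
Proof.
have /choice [nf hn] : forall j : nat, exists n, forall N, exists s,
  [/\ uniq s, forall i, i \in s -> (N <= i)%N, (size s <= n)%N & j%:R < phi s].
  by move=> j; exact: short_large_sets.
(* One place for the initial index of [s0], then the sizes of the sets for 0, ..., j. *)
pose r j := (1 + \sum_(i < j.+1) nf i)%N.
exists r => k N.
suff [s [us sN ks [j sj] [sr ss]]] : exists s : seq nat,
  [/\ uniq s, forall i, i \in s -> (N <= i)%N, (k < size s)%N,
      exists j, nth 0%N s 0 = s0 j & (size s <= r k)%N /\
      forall j, (j <= k)%N -> exists A, [/\ uniq A, j%:R < phi A & {subset A <= take (r j) s}]].
  exists s; split=> //; first by exists j.
  move=> j' n jk rn; have [A [uA Aj As]] := ss j' jk.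
  apply: lt_le_trans Aj _; apply: phi_sub => //; first exact: take_uniq.
  move=> x /As; rewrite -(cat_take_drop (r j') (take n s)) take_takel // mem_cat.
  by move=> ->.
have ext (s : seq nat) j : exists A, [/\ uniq A, uniq (s ++ A) = uniq s,
    forall i, i \in A -> (N <= i)%N, (size A <= nf j)%N & j%:R < phi A /\ (0 < size A)%N].
  have [A [uA AN An Aj]] := hn j (maxn N (\max_(i <- s) i).+1).
  exists A; split=> //.
  - rewrite cat_uniq uA andbT; case: (uniq s) => //=.
    apply/hasPn => x /AN; rewrite geq_max => /andP[_ h].
    apply/negP => xs; have := @leq_bigmax_seq _ s xpredT id x xs isT.
    by move=> /= h2; have := leq_trans h h2; rewrite ltnn.
  - by move=> i /AN; rewrite geq_max => /andP[].
  - split=> //; case: A Aj {uA AN An} => //; rewrite /phi phi_nil.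
    by rewrite ltNge ler0n.
elim: k => [|k [s [us sN ks [j sj] [sr ss]]]].
  have [i Ni] := injective_unbounded N.
  have [A [uA usA AN An [Aj A0]]] := ext [:: s0 i] 0%N.
  exists (s0 i :: A); split=> //.
  - by move=> x; rewrite inE => /orP[/eqP -> //|/AN].
  - by exists i.
  - split; first by rewrite /r big_ord1 /= add1n ltnS.
    move=> j; rewrite leqn0 => /eqP ->; exists A; split=> // x xA.
    by rewrite take_oversize ?inE ?xA ?orbT // /r big_ord1 /= add1n ltnS.
have [A [uA usA AN An [Aj A0]]] := ext s k.+1.
have rS : r k.+1 = (r k + nf k.+1)%N by rewrite /r big_ord_recr /= addnA.
have szA : (size (s ++ A) <= r k.+1)%N by rewrite size_cat rS leq_add.
exists (s ++ A); split=> //.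
- by rewrite usA.
- by move=> x; rewrite mem_cat => /orP[/sN|/AN].
- by rewrite size_cat -addn1 leq_add.
- by exists j; rewrite nth_cat (leq_ltn_trans _ ks).
- split=> // j'; rewrite leq_eqVlt => /orP[/eqP ->|].
    by exists A; split=> // x xA; rewrite take_oversize // mem_cat xA orbT.
  rewrite ltnS => /ss [A' [uA' Aj' As']]; exists A'; split=> // x /As'.
  rewrite take_cat; case: ltnP => // rs.
  by rewrite take_oversize // mem_cat => ->.
Qed.

End ShortLargeSets.

(** * The triangular array *)

Section StablePrefixes.
Context {X : normedModType F} (C : R) (e : nat -> X).
Context (C1 : 1 <= C) (hl : latt C e) (ne : forall i, nm (e i) = 1).

Let C0 : 0 <= C. Proof. exact: le_trans ler01 C1. Qed.

(** Dominates the losses of the colouring argument: C (1 + C) for rounding the coefficients, 2 for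
    equal integer parts, C for undoing the rounding. *)
Definition stable_constant : R := 2 * C * (1 + C) * C * C.

Lemma stable_constant_ge0 : 0 <= stable_constant.
Proof. by rewrite !mulr_ge0 ?addr_ge0. Qed.

(* Up to a constant, the norm on the span of n basis vectors is determined by the
   integer parts of its values at the vectors with coefficients in {0, ..., n}. *)
Lemma prefix_coloring (n : nat) (x : nat -> 'I_n -> nat) :
  exists (T : finType) (col : nat -> T), forall k l, injective (x k) -> injective (x l) ->
    col k = col l -> forall a : 'I_n -> F,
    nm (\sum_i a i *: e (x k i)) <= stable_constant * nm (\sum_i a i *: e (x l i)).
Proof.
pose Nv k (g : {ffun 'I_n -> 'I_n.+1}) := nm (\sum_i emb (g i)%:R *: e (x k i)).
have NvB k g : Nv k g <= n%:R * n%:R.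
  apply: le_trans (nm_sum _ _) _.
  apply: (@le_trans _ _ (\sum_(i < n) n%:R)); last by rewrite sumr_const card_ord mulr_natr.
  apply: ler_sum => i _; rewrite nm_emb_scale ?ler0n // ne mulr1 ler_nat -ltnS //.
pose Bd := Num.truncn (C * (n%:R * n%:R)).
(* The factor [C] ensures that a combination with one coefficient n gets a value at least 1; equal
   integer parts then mean values within a factor 2. *)
pose col k : {ffun {ffun 'I_n -> 'I_n.+1} -> 'I_Bd.+1} := [ffun g => inord (Num.truncn (C * Nv k g))].
exists {ffun {ffun 'I_n -> 'I_n.+1} -> 'I_Bd.+1}, col => k l xk xl ckl a.
have close g : C * Nv k g < C * Nv l g + 1.
  move/ffunP : (ckl) => /(_ g); rewrite !ffunE => /(congr1 val).
  have tb m : (Num.truncn (C * Nv m g) <= Bd)%N.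
    by apply: le_truncn; rewrite ler_wpM2l.
  rewrite /= !inordK ?ltnS // => E.
  apply: lt_le_trans (truncnS_gt _) _; rewrite E -natr1 lerD2r truncn_le.
  by rewrite mulr_ge0 ?nm_ge0.
have [a0|/existsP [i0 ai0]] := boolP [forall i, a i == 0].
  rewrite [X in nm X <= _]big1.
    by rewrite nm0; apply: mulr_ge0; [exact: stable_constant_ge0|exact: nm_ge0].
  move=> i _.
  by rewrite (eqP (forallP a0 i)) scale0r.
have i00 : (0 < n)%N by exact: leq_ltn_trans (ltn_ord i0).
have [im him] : exists im, forall i, ab (a i) <= ab (a im).
  exists [arg max_(i > i0) ab (a i)]%O; case: arg_maxP => // im _ h i.
  exact: h.
pose mx := ab (a im).
have mx0 : 0 < mx by apply: lt_le_trans (him i0); rewrite ab_gt0.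
have n0 : 0 < n%:R :> R by rewrite ltr0n.
(* [q] is the step of the rounding grid: the largest coefficient is exactly n steps, and the n
   rounding errors add up to at most [mx], which that coefficient controls. *)
pose q := mx / n%:R; have q0 : 0 < q by rewrite divr_gt0.
pose g : {ffun 'I_n -> 'I_n.+1} := [ffun i => inord (Num.truncn (ab (a i) / q))].
have qb i : 0 <= ab (a i) / q by rewrite divr_ge0 ?ab_ge0 // ltW.
have gE i : (g i : nat) = Num.truncn (ab (a i) / q).
  rewrite ffunE inordK // ltnS -(@natrK R n).
  apply: le_truncn; rewrite ler_pdivrMr // /q mulrCA divff ?gt_eqF // mulr1.
  exact: him.
have glo i : q * (g i)%:R <= ab (a i).
  by rewrite gE mulrC -ler_pdivlMr // truncn_le.
have ghi i : ab (a i) - q * (g i)%:R <= q.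
  have := truncnS_gt (ab (a i) / q); rewrite -gE -natr1 ltr_pdivrMr //; lra.
have gm : (g im)%:R = n%:R :> R.
  by rewrite gE /q -/mx invf_div mulrCA divff ?gt_eqF // mulr1 natrK.
pose z m := \sum_i emb (q * (g i)%:R) *: e (x m i).
have zE m : nm (z m) = q * Nv m g.
  rewrite /Nv -(nm_emb_scale _ (ltW q0)) scaler_sumr; congr nm.
  by apply: eq_bigr => i _; rewrite scalerA -rmorphM.
have ebound m : injective (x m) -> nm (\sum_i a i *: e (x m i)) <= C * ((1 + C) * nm (z m)).
  move=> xm.
  apply: le_trans (hl (b := fun i => emb (ab (a i))) xm _) _.
    by move=> i; rewrite ab_emb ger0_norm ?ab_ge0.
  rewrite ler_wpM2l //.
  have -> : \sum_i emb (ab (a i)) *: e (x m i) =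
      z m + \sum_i emb (ab (a i) - q * (g i)%:R) *: e (x m i).
    rewrite -big_split /=; apply: eq_bigr => i _.
    by rewrite -scalerDl -rmorphD addrC subrK.
  apply: le_trans (nmD _ _) _; rewrite mulrDl mul1r lerD2l.
  have mz : mx <= C * nm (z m).
    have : ab (emb (q * (g im)%:R)) * nm (e (x m im)) <= C * nm (z m).
      exact: latt_coord (fun i => emb (q * (g i)%:R)) im hl xm.
    by rewrite ne mulr1 ab_emb gm /q divfK ?gt_eqF // ger0_norm // ltW.
  apply: le_trans mz.
  apply: le_trans (nm_sum _ _) _; apply: (@le_trans _ _ (\sum_(i < n) q)).
    apply: ler_sum => i _; rewrite nm_emb_scale ?ne ?mulr1 ?ghi // subr_ge0.
    exact: glo.
  by rewrite sumr_const card_ord -[_ *+ _]mulr_natr /q divfK // gt_eqF.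
have zbound m : injective (x m) -> nm (z m) <= C * nm (\sum_i a i *: e (x m i)).
  move=> xm; apply: hl => // i; rewrite ab_emb ger0_norm ?glo //.
  by rewrite mulr_ge0 ?ler0n ?(ltW q0).
have Nge m : injective (x m) -> 1 <= C * Nv m g.
  move=> xm; have : ab (emb (g im)%:R) * nm (e (x m im)) <= C * Nv m g.
    exact: latt_coord (fun i => emb (g i)%:R) im hl xm.
  rewrite ne mulr1 ab_emb gm ger0_norm ?ler0n //; apply: le_trans.
  by rewrite ler1n.
have zz : nm (z k) <= 2 * nm (z l).
  rewrite !zE mulrCA ler_pM2l //.
  have Cp : 0 < C by apply: lt_le_trans C1.
  rewrite -(ler_pM2l Cp); have := close g; have := Nge l xl; lra.
apply: le_trans (ebound k xk) _.
have zl := zbound l xl.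
have h1 : (1 + C) * nm (z k) <= (1 + C) * (2 * (C * nm (\sum_i a i *: e (x l i)))).
  by rewrite ler_wpM2l ?addr_ge0 // (le_trans zz) // ler_wpM2l.
apply: (@le_trans _ _ (C * ((1 + C) * (2 * (C * nm (\sum_i a i *: e (x l i))))))).
  by rewrite ler_wpM2l.
have CC : C * nm (\sum_i a i *: e (x l i)) <= C * C * nm (\sum_i a i *: e (x l i)).
  by rewrite ler_wpM2r ?nm_ge0 // ler_peMl.
rewrite /stable_constant.
set t := nm _ in CC *.
have -> : 2 * C * (1 + C) * C * C * t = C * ((1 + C) * (2 * (C * C * t))) by ring.
by rewrite ler_wpM2l // ler_wpM2l ?addr_ge0 // ler_wpM2l.
Qed.

Lemma ultra_color (U : set_system nat) (T : finType) (col : nat -> T) :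
  UltraFilter U -> exists c, U [set k | col k = c].
Proof.
move=> UU; apply: contrapT => no.
have all_no (s : seq T) : U [set k | col k \notin s].
  elim: s => [|c s IH]; first by apply: filterS filterT.
  have [h|h] := in_ultra_setVsetC [set k | col k = c] UU.
    by case: no; exists c.
  apply: filterS (filterI h IH) => k [/= n1 n2].
  by rewrite inE negb_or n2 andbT; apply/eqP.
have /filter_ex [k] := all_no (enum T).
by rewrite /= mem_enum.
Qed.

(** An ultrafilter containing the cofinite sets selects one colour of prefixes for each length.
    Finitely many of the resulting sets [D j] always meet, so [t n] can be taken in every [D j] with
    j at most n. *)
Lemma stable_prefixes (x : nat -> nat -> nat) :
  (forall k i j, (i <= k)%N -> (j <= k)%N -> x k i = x k j -> i = j) ->
  exists t : nat -> nat, {homo t : i j / (i < j)%N} /\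
    forall n m m', (n <= m)%N -> (n <= m')%N -> forall a : 'I_n.+1 -> F,
      nm (\sum_i a i *: e (x (t m) i)) <=
      stable_constant * nm (\sum_i a i *: e (x (t m') i)).
Proof.
move=> xinj.
have [U [UU Uoo]] := @ultraFilterLemma nat \oo _.
have Uge N : U [set k | (N <= k)%N] by apply: Uoo; exists N.
have xinj' k n : (n <= k)%N -> injective (fun i : 'I_n.+1 => x k i).
  move=> nk; have le (i : 'I_n.+1) : (i <= k)%N by apply: leq_trans nk; rewrite -ltnS.
  by move=> i j E; apply: val_inj; exact: (xinj k _ _ (le i) (le j) E).
have /choice [D hD] : forall n, exists D : set nat, [/\ U D, forall k, D k -> (n <= k)%N &
    forall k l, D k -> D l -> forall a : 'I_n.+1 -> F,
      nm (\sum_i a i *: e (x k i)) <= stable_constant * nm (\sum_i a i *: e (x l i))].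
  move=> n; have [T [col hcol]] := @prefix_coloring n.+1 (fun k i => x k i).
  have [c Uc] := ultra_color col UU.
  exists ([set k | col k = c] `&` [set k | (n <= k)%N]); split.
  - by apply: filterI.
  - by move=> k [].
  - move=> k l [/= ck nk] [/= cl nl]; apply: hcol; rewrite ?ck ?cl //; exact: xinj'.
have UD n : U (\bigcap_(j < n.+1) D j).
  elim: n => [|n IH].
    by apply: filterS (let: And3 h _ _ := hD 0%N in h) => k hk [|].
  apply: filterS (filterI IH (let: And3 h _ _ := hD n.+1 in h)) => k [h1 h2] j /=.
  by rewrite ltnS leq_eqVlt => /orP[/eqP ->//|]; exact: h1.
have /choice [f hf] : forall nN : nat * nat, exists k,
    (nN.2 <= k)%N /\ forall j, (j <= nN.1)%N -> D j k.
  move=> [n N]; have /filter_ex [k [h1 h2]] :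
    U ([set k | (N <= k)%N] `&` \bigcap_(j < n.+1) D j) by exact: filterI.
  by exists k; split=> // j jn; apply: h2; rewrite /= ltnS.
pose fix t n := if n is m.+1 then f (m.+1, (t m).+1) else f (0%N, 0%N).
have tD n j : (j <= n)%N -> D j (t n).
  case: n => [|n] jn; first by case: (hf (0%N, 0%N)) => _; apply.
  by case: (hf (n.+1, (t n).+1)) => _; apply.
exists t; split.
  apply: homo_ltn => [i j k|p]; first exact: ltn_trans.
  by case: (hf (p.+1, (t p).+1)).
move=> n m m' nm' nm'' a; have [_ _ h] := hD n.
by apply: h; apply: tD.
Qed.

End StablePrefixes.

(** * Numbering the basis by the triangular array *)

Section Pyramid.
Context {X : normedModType F} (C : R) (e : nat -> X).
Context (C1 : 1 <= C) (hl : latt C e) (ne : forall i, nm (e i) = 1).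

Let C0 : 0 <= C. Proof. exact: le_trans ler01 C1. Qed.

Definition pyramid := {n : nat & 'I_n.+1}.
Definition cell (n : nat) (i : 'I_n.+1) : pyramid := existT _ n i.

Definition rows (k : nat -> nat) : set pyramid :=
  [set p | exists i, projT1 p = k i].

(* The combinatorial form of the theorem: [x] numbers the basis e by the cells of
   the triangular array. *)
Definition pyramid_indexing (x : pyramid -> nat) (K : R) :=
  [/\ bijective x, 1 <= K,
    forall (n m : nat) (nm' : (n < m)%N) (a : 'I_n.+1 -> F),
      nm (\sum_i a i *: e (x (cell i))) <=
        K * nm (\sum_i a i *: e (x (cell (widen_ord (leqW nm') i)))) /\
      nm (\sum_i a i *: e (x (cell (widen_ord (leqW nm') i)))) <=
        K * nm (\sum_i a i *: e (x (cell i))) &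
    forall k : nat -> nat, (forall i j, (i < j)%N -> (k i < k j)%N) ->
      exists t : nat -> nat, [/\ injective t, range t = x @` rows k &
        eqvs K e (e \o t)]].

Lemma cell_inj n : injective (@cell n).
Proof. by move=> i j /eqP; rewrite eq_Tagged => /eqP. Qed.

(** The array [b] may use only part of the indices. A copy [be] of [e] filling exactly this part
    makes [b] followed by the inverse of [be] a bijective numbering; each passage through [be] costs
    a factor [K2]. *)
Lemma pyramid_indexing_transfer (b : pyramid -> nat) (K1 K2 K3 : R) (be : nat -> nat) :
  injective b -> 0 <= K1 -> 0 <= K2 -> 0 <= K3 ->
  (forall (n m : nat) (nm' : (n < m)%N) (a : 'I_n.+1 -> F),
      nm (\sum_i a i *: e (b (cell i))) <=
        K1 * nm (\sum_i a i *: e (b (cell (widen_ord (leqW nm') i)))) /\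
      nm (\sum_i a i *: e (b (cell (widen_ord (leqW nm') i)))) <=
        K1 * nm (\sum_i a i *: e (b (cell i)))) ->
  injective be -> range be = range b -> eqvs K2 e (e \o be) ->
  (forall k : nat -> nat, (forall i j, (i < j)%N -> (k i < k j)%N) ->
      exists h : nat -> nat, [/\ injective h, range h = b @` rows k &
        eqvs K3 e (e \o h)]) ->
  exists x K, pyramid_indexing x K.
Proof.
move=> binj K10 K20 K30 hb beinj beb hbe hh.
have /choice [g hg] : forall p, exists n, be n = b p.
  move=> p; have : range b (b p) by exists p.
  by rewrite -beb => -[n _ <-]; exists n.
have ginj : injective g by move=> p q E; apply: binj; rewrite -!hg E.
have gsurj n : exists p, g p = n.
  have : range be (be n) by exists n.
  by rewrite beb => -[p _ E]; exists p; apply: beinj; rewrite hg.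
have [gi hgi] := choice gsurj.
exists g, (1 + K2 * K1 * K2 + K3 * K2); split.
- by exists gi => // p; apply: ginj.
- by rewrite -addrA lerDl !(addr_ge0, mulr_ge0).
- move=> n m nm' a.
  have E (l : nat) (f : 'I_n.+1 -> 'I_l.+1) : injective f ->
      nm (\sum_i a i *: e (g (cell (f i)))) <= K2 * nm (\sum_i a i *: e (b (cell (f i)))) /\
      nm (\sum_i a i *: e (b (cell (f i)))) <= K2 * nm (\sum_i a i *: e (g (cell (f i)))).
    move=> finj.
    have -> : \sum_i a i *: e (b (cell (f i))) =
       \sum_i a i *: (e \o be) (g (cell (f i))).
      by apply: eq_bigr => i _; rewrite /= hg.
    by apply: (hbe _ (fun i => g (cell (f i))) a) => i j /ginj /cell_inj /finj.
  have [p1 p2] := E n id (fun i j h => h).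
  have winj : injective (widen_ord (leqW nm')) by move=> i j [] /val_inj.
  have [q1 q2] := E m _ winj.
  have [r1 r2] := hb n m nm' a.
  have bound (t : R) : 0 <= t -> K2 * K1 * K2 * t <= (1 + K2 * K1 * K2 + K3 * K2) * t.
    move=> t0; rewrite ler_wpM2r // addrAC lerDr; apply: addr_ge0 => //.
    exact: mulr_ge0.
  split; apply: le_trans (bound _ (nm_ge0 _)); rewrite -!mulrA.
    apply: (le_trans p1); rewrite ler_wpM2l // (le_trans r1) // ler_wpM2l //.
  apply: (le_trans q1); rewrite ler_wpM2l // (le_trans r2) // ler_wpM2l //.
- move=> k hk; have [h [hinj hr hh3]] := hh k hk.
  have /choice [t ht] : forall n, exists p, b p = h n /\ rows k p.
    move=> n; have : range h (h n) by exists n.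
    by rewrite hr => -[p rp <-]; exists p.
  have tinj : injective (g \o t).
    by move=> i j /ginj E; apply: hinj; rewrite -(ht i).1 -(ht j).1 E.
  exists (g \o t); split=> //.
    apply/seteqP; split=> [_ [n _ <-]|_ [p rp <-]].
      by exists (t n) => //; case: (ht n).
    have : (b @` rows k) (b p) by exists p.
    rewrite -hr => -[n _ E]; exists n => //=; congr g.
    by apply: binj; rewrite (ht n).1.
  have h2 : eqvs K2 (e \o (g \o t)) (e \o h).
    have := eqvs_comp tinj hbe.
    rewrite (_ : (e \o be) \o (g \o t) = e \o h) //.
    by apply/funext => n; rewrite /= hg (ht n).1.
  apply: eqvs_weaken (eqvs_trans K30 K20 hh3 (eqvs_sym h2)).
  by rewrite lerDr; rewrite !(addr_ge0, mulr_ge0).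
Qed.

(** Both norms are comparable with the largest modulus of a coefficient. *)
Lemma c0_eqvs (L : R) (J : Type) (s t : J -> nat) : bounded_sums L e ->
  injective s -> injective t -> eqvs (C * (C * L)) (e \o s) (e \o t).
Proof.
move=> hL sinj tinj.
have half (s' t' : J -> nat) : injective s' -> injective t' ->
    forall (I : finType) (al : I -> J) (a : I -> F), injective al ->
    nm (\sum_i a i *: e (s' (al i))) <= C * (C * L) * nm (\sum_i a i *: e (t' (al i))).
  move=> si ti I al a hal.
  have sal : injective (s' \o al) by exact: inj_comp.
  have tal : injective (t' \o al) by exact: inj_comp.
  apply: le_trans (c0_sum_le C1 (al := s' \o al) (P := xpredT)
    (M := C * nm (\sum_i a i *: e (t' (al i)))) (B := L) hl sal _ _ _) _.
  - by rewrite mulr_ge0 ?nm_ge0.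
  - move=> i _; have := latt_coord a i hl tal.
    by rewrite ne mulr1.
  - exact: hL.
  - by rewrite le_eqVlt; apply/orP; left; apply/eqP; ring.
by move=> I al a hal; split; [exact: half|exact: half].
Qed.

Lemma rows_infinite (b : pyramid -> nat) (k : nat -> nat) : injective b ->
  (forall i j, (i < j)%N -> (k i < k j)%N) ->
  forall N, exists2 m, (N <= m)%N & (b @` rows k) m.
Proof.
move=> binj hk N.
have finj : injective (fun i => b (@cell (k i) ord0)).
  move=> i j /binj /(congr1 (@projT1 _ _)) /= E.
  by case: (ltngtP i j) => // /hk; rewrite E ltnn.
have [i Ni] := injective_unbounded finj N.
by exists (b (@cell (k i) ord0)) => //; exists (@cell (k i) ord0) => //; exists i.
Qed.

Lemma rows_id : rows id = [set: pyramid].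
Proof. by apply/seteqP; split=> // p _; exists (projT1 p). Qed.

(** In the c_0 case any injective numbering of the cells will do; [pickle] supplies one and [be]
    repairs surjectivity. *)
Lemma c0_pyramid_indexing (L : R) : bounded_sums L e -> exists x K, pyramid_indexing x K.
Proof.
move=> hL; pose b (p : pyramid) : nat := pickle p.
have binj : injective b by exact: pcan_inj pickleK.
pose K := C * (C * L).
have L0 : 0 <= L.
  apply: le_trans (hL 'I_0 (fun i => val i) _); first exact: nm_ge0.
  exact: val_inj.
have K0 : 0 <= K by rewrite !mulr_ge0.
have rowsE (k : nat -> nat) : (forall i j, (i < j)%N -> (k i < k j)%N) ->
   exists h : nat -> nat, [/\ injective h, range h = b @` rows k & eqvs K e (e \o h)].
  move=> hk; have [s [sinj sM sonto]] := enumerate_infinite (rows_infinite binj hk).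
  exists s; split=> //; last exact: (c0_eqvs hL (s := id)).
  by apply/seteqP; split=> [_ [n _ <-]|m /sonto [n <-]] //; exists n.
have [be [beinj beb hbe]] := rowsE id (fun i j h => h).
apply: (pyramid_indexing_transfer binj K0 K0 K0 _ beinj _ hbe rowsE); last first.
  by rewrite beb rows_id.
move=> n m nm' a.
have i1 : injective (fun i : 'I_n.+1 => b (cell i)) by move=> i j /binj /cell_inj.
have i2 : injective (fun i : 'I_n.+1 => b (cell (widen_ord (leqW nm') i))).
  by move=> i j /binj /cell_inj [] /val_inj.
exact: (c0_eqvs hL i1 i2 (al := id)).
Qed.

Context (dich : forall s : nat -> nat, injective s ->
  (exists L, bounded_sums L (e \o s)) \/
  exists p : nat -> nat, injective p /\ exists2 K : R, 0 <= K & eqvs K e (e \o s \o p)).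
Context (lT : large e [set: nat]).
Context (s0 : nat -> nat) (L0 : R) (s0_inj : injective s0)
  (hs0 : bounded_sums L0 (e \o s0)).

Let SC : R := stable_constant C.

(** Each block is chosen beyond the previous ones, which makes the rows disjoint. Passing to the
    subsequence [t] with stable prefixes keeps the rate [r], because row k comes from a block of
    number at least k. *)
Lemma stable_blocks : exists (b : nat -> nat -> nat) (r : nat -> nat),
  [/\ forall k i l j, (i <= k)%N -> (j <= l)%N -> b k i = b l j -> k = l /\ i = j,
      forall k, exists j, b k 0%N = s0 j,
      forall j k n, (j <= k)%N -> (r j <= n)%N -> (n <= k)%N ->
        j%:R < C * phi e (map (b k) (iota 0 n.+1)) &
      forall n m m', (n <= m)%N -> (n <= m')%N -> forall a : 'I_n.+1 -> F,
        nm (\sum_i a i *: e (b m i)) <= SC * nm (\sum_i a i *: e (b m' i))].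
Proof.
have [r hr] := block_sequence C1 hl ne dich lT s0_inj.
have /choice [f hf] : forall kN : nat * nat, exists s : seq nat,
  [/\ uniq s, forall i, i \in s -> (kN.2 <= i)%N, (kN.1 < size s)%N,
      exists j, nth 0%N s 0 = s0 j &
      forall j n, (j <= kN.1)%N -> (r j <= n)%N -> j%:R < C * phi e (take n s)].
  by move=> [k N]; exact: hr.
pose fix Nk k := if k is j.+1 then (\max_(i <- f (j, Nk j)) i).+1 else 0%N.
pose B k := f (k, Nk k).
have hB k : [/\ uniq (B k), forall i, i \in B k -> (Nk k <= i)%N, (k < size (B k))%N,
      exists j, nth 0%N (B k) 0 = s0 j &
      forall j n, (j <= k)%N -> (r j <= n)%N -> j%:R < C * phi e (take n (B k))].
  exact: (hf (k, Nk k)).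
have uB k : uniq (B k) by case: (hB k).
have szB k : (k < size (B k))%N by case: (hB k).
have geB k x : x \in B k -> (Nk k <= x)%N by case: (hB k) => [_ h _ _ _]; exact: h.
have ltB k x : x \in B k -> (x < Nk k.+1)%N.
  by move=> xB /=; rewrite ltnS; apply: (@leq_bigmax_seq _ (B k) xpredT id).
have NkS k : (Nk k < Nk k.+1)%N.
  have h : nth 0%N (B k) 0 \in B k by rewrite mem_nth // (leq_ltn_trans _ (szB k)).
  exact: leq_ltn_trans (geB _ _ h) (ltB _ _ h).
pose x k i := nth 0%N (B k) i.
have xB k i : (i <= k)%N -> x k i \in B k.
  by move=> ik; rewrite mem_nth // (leq_ltn_trans ik (szB k)).
have xlt k l i j : (i <= k)%N -> (j <= l)%N -> (k < l)%N -> x k i <> x l j.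
  move=> ik jl kl E; have h1 := ltB _ _ (xB k i ik); have h2 := geB _ _ (xB l j jl).
  have := leq_trans h1 (leq_trans (blocks_mono NkS kl) h2).
  by rewrite E ltnn.
have xinj k i j : (i <= k)%N -> (j <= k)%N -> x k i = x k j -> i = j.
  move=> ik jk /eqP; rewrite nth_uniq ?(leq_ltn_trans _ (szB k)) // => /eqP //.
have [t [tlt ht]] := stable_prefixes C1 hl ne xinj.
have tge k : (k <= t k)%N.
  by elim: k => // k IH; apply: leq_ltn_trans IH (tlt _ _ (ltnSn k)).
exists (fun k i => x (t k) i), r; split.
- move=> k i l j ik jl E.
  have ik' := leq_trans ik (tge k); have jl' := leq_trans jl (tge l).
  case: (ltngtP k l) => [kl|lk|kl].
  + by case: (xlt _ _ _ _ ik' jl' (tlt _ _ kl)).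
  + by case: (xlt _ _ _ _ jl' ik' (tlt _ _ lk)).
  + by subst l; split=> //; exact: xinj E.
- by move=> k; case: (hB (t k)).
- move=> j k n jk rn nk; have [_ _ _ _ h] := hB (t k).
  have := h j n.+1 (leq_trans jk (tge k)) (leqW rn).
  rewrite -(map_nth_iota0 0%N) //.
  by apply: leq_ltn_trans (szB _); exact: leq_trans nk (tge k).
- exact: ht.
Qed.

(* The copies of e inside unions of rows are uniformly good along some subsequence
   of rows: otherwise a diagonal sequence of rows would, up to finitely many basis
   vectors at each stage, be worse than any bound. *)
Lemma uniform_embedding (b : nat -> nat -> nat) :
  (forall k i l j, (i <= k)%N -> (j <= l)%N -> b k i = b l j -> k = l /\ i = j) ->
  (forall k, exists j, b k 0%N = s0 j) ->
  (forall t : nat -> nat, {homo t : i j / (i < j)%N} ->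
     large e [set y | exists n i, (i <= n)%N /\ y = b (t n) i]) ->
  exists t (K : R), [/\ {homo t : i j / (i < j)%N}, 0 <= K &
    forall s : nat -> nat, {homo s : i j / (i < j)%N} ->
      embeds e K [set y | exists n i, (i <= n)%N /\ y = b (t (s n)) i]].
Proof.
move=> binj b0 blarge.
pose M t := [set y | exists n i, (i <= n)%N /\ y = b (t n) i].
pose incr (t : nat -> nat) := {homo t : i j / (i < j)%N}.
apply: contrapT => no.
have /choice [g hg] : forall tK : (nat -> nat) * R, exists s : nat -> nat,
    incr s /\ (incr tK.1 -> 0 <= tK.2 -> ~ embeds e tK.2 (M (tK.1 \o s))).
  move=> [t K] /=; have [[it K0]|h] := pselect (incr t /\ 0 <= K); last first.
    by exists id; split=> // it K0; case: h.
  apply: contrapT => h; apply: no; exists t, K; split=> // s si.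
  by apply: contrapT => h2; apply: h; exists s.
pose hc d := hotel_constant C L0 d.
have hc0 d : 0 <= hc d by exact: (hotel_constant_ge0 C1 hs0).
(* [T k.+1] will be a subsequence of [T k] without a copy of constant [bd k]; the hotel factor
   allows for the (k+1)^2 indices in the first k+1 truncated rows. *)
pose bd k : R := k%:R * hc (k.+1 * k.+1)%N.
have bd0 k : 0 <= bd k by rewrite mulr_ge0.
pose fix T k := if k is j.+1 then T j \o g (T j, bd j) else id.
have gi k : incr (g (T k, bd k)) by case: (hg (T k, bd k)).
have Ti k : incr (T k).
  by elim: k => [|k IH] i j ij //=; apply/IH/gi.
have Tno k : ~ embeds e (bd k) (M (T k.+1)).
  by case: (hg (T k, bd k)) => _ h; apply: h; [exact: Ti|exact: bd0].
have incr_ge (s : nat -> nat) : incr s -> forall n, (n <= s n)%N.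
  by move=> si; elim=> // n IH; apply: leq_ltn_trans IH (si _ _ (ltnSn n)).
have Tfac k m : exists u, incr u /\ T (k + m)%N = T k \o u.
  elim: m => [|m [u [ui E]]]; first by exists id; rewrite addn0; split=> // i j.
  exists (u \o g (T (k + m)%N, bd (k + m)%N)); split.
    by move=> i j ij; apply/ui/gi.
  by rewrite addnS /= E.
(* From row k+1 on, the diagonal runs through rows of [T k.+1]; what comes before is the finite list
   [G]. *)
pose D k := T k k.
have Di : incr D.
  apply: homo_ltn => [i j k|k]; first exact: ltn_trans.
  rewrite /D /=; apply: Ti.
  exact: leq_trans (incr_ge _ (gi k) k.+1).
have [K K0 hK] := large_embeds ne dich (blarge D Di).
(* With [k] above the constant of the copy along [D], absorbing [G] yields the copy inside the rows
   of [T k.+1] that was excluded. *)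
pose k := (Num.truncn K).+1.
pose G := [seq b (D p.1) p.2 | p <- [seq (n, i) | n <- iota 0 k.+1, i <- iota 0 k.+1]].
have szG : size G = (k.+1 * k.+1)%N by rewrite size_map size_allpairs !size_iota.
have MD : M D `<=` [set y | y \in G] `|` M (T k.+1).
  move=> _ [n [i [ni ->]]]; have [nk|kn] := ltnP n k.+1.
    left; apply/mapP; exists (n, i) => //; apply/allpairsP; exists (n, i).
    by split=> //; rewrite mem_iota add0n //= (leq_ltn_trans ni nk).
  right; have [u [ui E]] := Tfac k.+1 (n - k.+1)%N.
  rewrite subnKC // in E; exists (u n), i; split.
    exact: leq_trans ni (incr_ge _ ui n).
  by rewrite /D E.
(* The first entries of the rows lie in the copy of c_0 and form the corridor of the hotel. *)
pose mu n := b (T k.+1 n) 0%N.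
have Tinj : injective (T k.+1).
  by move=> i j E; have [h|h|//] := ltngtP i j; have := Ti k.+1 _ _ h; rewrite E ltnn.
have muinj : injective mu.
  by move=> i j E; apply: Tinj; have [] := binj _ _ _ _ (leq0n _) (leq0n _) E.
have := hotel C1 hl ne s0_inj hs0 (G := G) (mu := mu) (M := M (T k.+1)) (K := K)
  muinj _ _ K0 _.
move=> h; apply: (Tno k); apply: (embeds_mono _ (subset_refl _) (h _ _ _)).
- rewrite szG /bd -/(hc _) ler_wpM2r //.
  by apply/ltW; exact: truncnS_gt.
- by [].
- by move=> n; exists n, 0%N.
- by move=> n; exact: b0.
- exact: embeds_mono (lexx K) MD hK.
Qed.

Lemma pyramid_indexing_exists : exists x K, pyramid_indexing x K.
Proof.
have [b0 [r [binj0 b0s b0r b0st]]] := stable_blocks.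
have Cp : 0 < C by apply: lt_le_trans C1.
have incr_ge (s : nat -> nat) : {homo s : i j / (i < j)%N} -> forall n, (n <= s n)%N.
  by move=> si; elim=> // n IH; apply: leq_ltn_trans IH (si _ _ (ltnSn n)).
(* Row [t n] is cut after n+1 entries; as soon as n reaches both j and [r j], this prefix still has
   norm above j / C. *)
have blarge (t : nat -> nat) : {homo t : i j / (i < j)%N} ->
     large e [set y | exists n i, (i <= n)%N /\ y = b0 (t n) i].
  move=> it L; pose j := (Num.truncn (C * `|L|)).+1; pose n := maxn j (r j).
  have tn := incr_ge t it n.
  exists (map (b0 (t n)) (iota 0 n.+1)); split.
  - rewrite map_inj_in_uniq ?iota_uniq // => i i'; rewrite !mem_iota /= !add0n !ltnS => ni ni' E.
    have [_ //] := binj0 _ _ _ _ (leq_trans ni tn) (leq_trans ni' tn) E.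
  - move=> y /mapP [i]; rewrite mem_iota /= add0n ltnS => ni ->.
    by exists n, i.
  - have jn : (j <= n)%N by rewrite leq_maxl.
    have := b0r j (t n) n (leq_trans jn tn) (leq_maxr _ _) tn.
    move=> h; rewrite -(ltr_pM2l Cp); apply: le_lt_trans h.
    apply: (@le_trans _ _ (C * `|L|)); first by rewrite ler_wpM2l // ler_norm.
    by apply/ltW; exact: truncnS_gt.
have [t [K [it K0 hK]]] := uniform_embedding binj0 b0s blarge.
have tinj : injective t.
  by move=> i j E; case: (ltngtP i j) => // /it; rewrite E ltnn.
pose b (p : pyramid) := b0 (t (projT1 p)) (projT2 p).
have binj : injective b.
  move=> [n i] [m j] E; rewrite /b /= in E.
  have ii : (i <= t n)%N by apply: leq_trans (incr_ge t it n); rewrite -ltnS.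
  have jj : (j <= t m)%N by apply: leq_trans (incr_ge t it m); rewrite -ltnS.
  have [/tinj nm' ij] := binj0 _ _ _ _ ii jj E.
  by subst m; congr existT; apply: val_inj.
have rowsE (k : nat -> nat) : (forall i j, (i < j)%N -> (k i < k j)%N) ->
   exists h : nat -> nat, [/\ injective h, range h = b @` rows k &
     eqvs (C * (C * K + 1)) e (e \o h)].
  move=> hk.
  (* Row [k n] of the array has at least n+1 cells, so the truncated rows with a uniform copy of [e]
     lie inside the full ones. *)
  have sub : [set y | exists n i, (i <= n)%N /\ y = b0 (t (k n)) i] `<=` b @` rows k.
    move=> _ [n [i [ni ->]]].
    have ik : (i < (k n).+1)%N by rewrite ltnS (leq_trans ni) // incr_ge.
    by exists (cell (Ordinal ik)) => //; exists n.
  have [h [hinj hM honto hh]] := schroeder_bernstein_embeds C1 hl K0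
     (embeds_mono (lexx K) sub (hK k hk)).
  exists h; split=> //.
  by apply/seteqP; split=> [_ [n _ <-]|m /honto [n <-]] //; exists n.
have [be [beinj beb hbe]] := rowsE id (fun i j h => h).
have K3 : 0 <= C * (C * K + 1) by rewrite mulr_ge0 // addr_ge0 // mulr_ge0.
apply: (pyramid_indexing_transfer binj (stable_constant_ge0 C1) K3 K3 _ beinj _ hbe rowsE);
  last by rewrite beb rows_id.
move=> n m nm' a; have tnm := it _ _ nm'.
have n1 := incr_ge t it n; have n2 := leq_trans n1 (ltnW tnm).
by split; [exact: (b0st n (t n) (t m) n1 n2)|exact: (b0st n (t m) (t n) n2 n1)].
Qed.

End Pyramid.

(** * The decomposition of X *)

Section Decomposition.
(** The equivalence extends to an operator bounded above and below with constant [K], whence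
    [K * K]; the lower bound and completeness make its range closed. *)
Lemma eqvs_isomorphism (X : completeNormedModType F) (C K : R) (e : nat -> X) (t : nat -> nat) :
  0 <= C -> 0 <= K -> latt C e -> (forall i, e i != 0) -> closure (fspan e) = [set: X] ->
  eqvs K e (e \o t) -> K_isomorphic (emb (K * K)) [set: X] (closed_span (range (e \o t))).
Proof.
move=> C0 K0 hl e0 dense het.
have [|T [Te Tb]] := basis_extension (f := e \o t) C0 K0 hl e0 dense.
  by move=> n a; have [_] := het 'I_n (fun i => i : nat) (fun i => a i) val_inj.
have Tspan n (a : nat -> F) : T (\sum_(i < n) a i *: e i) = \sum_(i < n) a i *: (e \o t) i.
  by rewrite linear_sum; apply: eq_bigr => i _; rewrite linearZ /= Te.
have cont (u : nat -> X) x : tendsto u x -> tendsto (fun n => T (u n)) (T x).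
  move=> ux eps eps0; have h : 0 < eps / (K + 1) by rewrite divr_gt0 // ltr_wpDl.
  have [N hN] := ux _ h; exists N => n /hN; rewrite -linearB ler_pdivlMr ?ltr_wpDl //.
  move=> hn; apply: le_trans (Tb _) _; set y := nm _ in hn *.
  have y0 : 0 <= y by exact: nm_ge0.
  lra.
have lower x : nm x <= K * nm (T x).
  have : closure (fspan e) x by rewrite dense.
  move=> /closure_tendsto [u [us ux]]; apply/ler_addgt0Pr => eps eps0.
  have h : 0 < eps / (K * K + 1) by rewrite divr_gt0 // ltr_wpDl // mulr_ge0.
  have [N /(_ N (leqnn _)) hN] := ux _ h; rewrite nm_distC in hN.
  have [n [a ua]] := us N.
  have l1 : nm (u N) <= K * nm (T (u N)).
    by rewrite ua Tspan; have [] := het 'I_n (fun i => i : nat) (fun i => a i) val_inj.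
  have l2 : nm (T (u N)) <= nm (T x) + K * nm (x - u N).
    have -> : T (u N) = T x - T (x - u N) by rewrite -linearB opprB addrC subrK.
    apply: le_trans (nmB _ _) _; by rewrite lerD2l.
  have l3 := nmD (x - u N) (u N); rewrite subrK in l3.
  rewrite ler_pdivlMr ?ltr_wpDl ?mulr_ge0 // in hN.
  have : K * nm (T (u N)) <= K * (nm (T x) + K * nm (x - u N)) by rewrite ler_wpM2l.
  lra.
exists T, (emb K), (emb K); split; rewrite ?emb_ge0 // ?rmorphM //.
apply: real_bounds_isomorphism => //.
- by move=> a u v _ _; rewrite linearP.
- rewrite closed_spanE; apply/seteqP; split=> [_ [x _ <-]|y].
    have : closure (fspan e) x by rewrite dense.
    move=> /closure_tendsto [u [us ux]].
    apply/closure_tendsto; exists (fun n => T (u n)); split; last exact: cont.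
    by move=> n; have [m [a ->]] := us n; exists m, a.
  move=> /closure_tendsto [v [vs vy]].
  have /choice [u hu] : forall n, exists u, T u = v n.
    by move=> n; have [m [a ->]] := vs n; exists (\sum_(i < m) a i *: e i).
  have [|x ux] := @cauchyn_tendsto _ u.
    move=> eps eps0; have h : 0 < eps / (K + 1) by rewrite divr_gt0 // ltr_wpDl.
    have [N hN] := tendsto_cauchyn vy h; exists N => m n Nm Nn.
    have := hN m n Nm Nn; rewrite -!hu -linearB ler_pdivlMr ?ltr_wpDl //.
    move=> hn; apply: le_trans (lower _) _; set z := nm _ in hn *.
    have z0 : 0 <= z by exact: nm_ge0.
    lra.
  exists x => //; apply: (tendsto_unique (cont _ _ ux)).
  by apply: tendsto_ext vy => n; rewrite hu.
Qed.

Section Rows.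
Context {X : completeNormedModType F} (C : R) (e : nat -> X).
Context (C0 : 0 <= C) (hl : latt C e) (ne : forall i, nm (e i) = 1)
  (dense : closure (fspan e) = [set: X]).
Context (x : pyramid -> nat) (bx : bijective x).

Let xinj : injective x. Proof. exact: bij_inj. Qed.

Definition row_span (n : nat) : set X :=
  [set v | exists a : 'I_n.+1 -> F, v = \sum_i a i *: e (x (cell i))].

Lemma row_finite_basis n : finite_basis (row_span n) (fun i : 'I_n.+1 => e (x (cell i))).
Proof.
split.
- split; first by exists (fun=> 0); rewrite big1 // => i _; rewrite scale0r.
  move=> c _ _ [a ->] [b ->]; exists (fun i => c * a i + b i).
  rewrite scaler_sumr -big_split /=; apply: eq_bigr => i _.
  by rewrite scalerDl scalerA.
- move=> i; exists (fun j => (j == i)%:R).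
  rewrite (bigD1 i) //= eqxx scale1r big1 ?addr0 // => j /negbTE ->.
  by rewrite scale0r.
- move=> v [a va]; exists a; split=> // b vb; apply/funext => i.
  have inj : injective (fun i : 'I_n.+1 => x (cell i)) by move=> ? ? /xinj /cell_inj.
  have := latt_coord (fun i => a i - b i) i hl inj.
  under eq_bigr do rewrite scalerBl.
  rewrite sumrB -va -vb subrr nm0 mulr0 ne mulr1 => h.
  by apply/eqP; rewrite -subr_eq0 -ab_eq0 eq_le h ab_ge0.
Qed.

Lemma rows_injective (N : nat) (s : nat -> nat) : injective s ->
  injective (fun p : {n : 'I_N & 'I_(s n).+1} => x (@cell (s (tag p)) (tagged p))).
Proof.
move=> sinj [n i] [m j] /xinj /= E.
have nm' : n = m by apply/val_inj/sinj; have := congr1 (@projT1 _ _) E.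
by subst m; congr existT; exact: cell_inj E.
Qed.

(** Any order of the rows exhausts the cells by finite sets, so unordered summation of the basis
    expansion gives convergence by rows. For uniqueness, the coordinate at a cell is constant in the
    partial sums once its row has appeared, and coordinates are continuous. *)
Lemma row_unconditional_fdd : unconditional_fdd row_span.
Proof.
split; first by move=> n; exists n.+1, (fun i => e (x (cell i))); exact: row_finite_basis.
have [a [ax alin afin abd]] := basis_coords C0 hl ne dense.
move=> v; exists (fun n => \sum_(i < n.+1) a v (x (cell i)) *: e (x (cell i))); split.
- by move=> n; exists (fun i => a v (x (cell i))).
- move=> s bs; apply/tendstoP => eps eps0.
  have [n0 hn0] := ax v _ eps0.
  have [si sK siK] := bs; have [xi xK xiK] := bx.
  exists (\max_(j < n0) si (projT1 (xi j))).+1 => N NN.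
  rewrite seriesE /= sig_big_dep /=.
  apply: (hn0 _ _ (rows_injective (bij_inj bs))) => j jn.
  case xj : (xi j) => [r i].
  have rN : (si r < N)%N.
    apply: leq_trans NN; rewrite ltnS.
    have := @leq_bigmax _ (fun j : 'I_n0 => si (projT1 (xi j))) (Ordinal jn).
    by rewrite /= xj.
  have ri : (i < (s (Ordinal rN)).+1)%N by rewrite /= siK.
  exists (existT (fun n : 'I_N => 'I_(s n).+1) (Ordinal rN) (Ordinal ri)) => /=.
  rewrite -(xiK j) xj; congr x; rewrite /cell.
  have gen (m : nat) (im : (i < m.+1)%N) : m = r -> existT _ m (Ordinal im) = existT _ r i :> pyramid.
    by move=> mr; subst m; congr existT; apply: val_inj.
  by apply: gen; rewrite siK.
- move=> w wE /tendstoP wv.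
  pose c n := sval (cid (wE n)).
  have hc n : w n = \sum_i c n i *: e (x (cell i)) by exact: svalP (cid (wE n)).
  have aB y z j : a (y - z) j = a y j - a z j.
    have a0 : a 0 j = 0.
      have := alin 1 0 0 j; rewrite scale1r addr0 mul1r => E.
      by apply: (@addrI _ (a 0 j)); rewrite -E addr0.
    have aN := alin (-1) z 0 j; rewrite !addr0 a0 addr0 in aN.
    have := alin 1 y (-1 *: z) j.
    by rewrite !scale1r mul1r aN scaleN1r mulN1r.
  have ab_coord y j : ab (a y j) <= C * nm y.
    by have := abd y j.+1 (pred1 j); rewrite (big_pred1 ord_max) ?nmZ ?ne ?mulr1.
  apply/funext => n; rewrite hc; apply: eq_bigr => i _; congr (_ *: _).
  set j := x (cell i).
  have partial N : (n < N)%N -> a (series w N) j = c n i.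
    move=> nN; rewrite seriesE.
    under eq_bigr do rewrite hc.
    rewrite sig_big_dep /=.
    rewrite (afin _ _ (fun p : {n : 'I_N & 'I_n.+1} => c (tag p) (tagged p))); last first.
      exact: (rows_injective (s := id)).
    pose p0 := existT (fun n : 'I_N => 'I_n.+1) (Ordinal nN) i.
    rewrite (big_pred1 p0) // => p.
    rewrite -[j]/(x (@cell (tag p0) (tagged p0))).
    by rewrite (inj_eq (rows_injective (s := id) (fun i j h => h))).
  apply/eqP; rewrite eq_sym -subr_eq0 -ab_eq0 eq_le ab_ge0 andbT.
  apply/ler_addgt0Pr => eps eps0; rewrite add0r.
  have h : 0 < eps / (C + 1) by rewrite divr_gt0 // ltr_wpDl.
  have [N hN] := wv _ h.
  have := hN _ (leq_maxl N n.+1).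
  have := ab_coord (series w (maxn N n.+1) - v) j.
  rewrite aB partial ?leq_maxr // ler_pdivlMr ?ltr_wpDl //.
  rewrite -abN opprB; set y := nm _; set z := ab _ => h1 h2.
  have y0 : 0 <= y by exact: nm_ge0.
  lra.
Qed.

Lemma row_family_basis : unconditional_basis [set: X] e ->
  unconditional_basis_family [set: X]
    (fun p : pyramid => e (x (cell (projT2 p)))).
Proof.
move=> be; have [xi xK xiK] := bx; exists xi; split; first by exists x.
rewrite (_ : _ \o xi = e) //; apply/funext => n /=.
by rewrite -[n in RHS]xiK; case: (xi n).
Qed.

Lemma rows_closed_span (k : nat -> nat) (t : nat -> nat) : range t = x @` rows k ->
  closed_span (\bigcup_i row_span (k i)) = closed_span (range (e \o t)).
Proof.
move=> tr; congr closure; rewrite smallest_subspaceE; apply/seteqP; split.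
  apply: smallest_sub; first exact: fspan_subspace.
  move=> _ [i _ [a ->]]; apply: linear_subspace_sum; first exact: fspan_subspace.
  move=> j _; have : (x @` rows k) (x (cell j)) by exists (cell j) => //; exists i.
  by rewrite -tr => -[n _ <-]; exact: (fspan_gen (e \o t)).
move=> _ [n [a ->]] A [Alin hA]; apply: linear_subspace_sum => // i _.
have : range t (t i) by exists (i : nat).
rewrite tr => -[[r j] [m /= rm] E]; apply: hA; exists m => //.
rewrite /= -E; subst r; have [_ h _] := row_finite_basis (k m); exact: h.
Qed.

End Rows.

Lemma pyramid_decomposition (X : completeNormedModType F) (C K : R) (e : nat -> X)
    (x : pyramid -> nat) :
  0 <= C -> latt C e -> normalized_unconditional_basis [set: X] e ->
  pyramid_indexing e x K ->
  exists (E : nat -> set X) (x : forall n : nat, 'I_n.+1 -> X) (K : F),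
    unconditional_fdd E /\
    [/\ forall n, has_dimension (E n) n.+1 /\ finite_basis (E n) (x n),
        unconditional_basis_family [set: X]
          (fun p : {n : nat & 'I_n.+1} => x (projT1 p) (projT2 p)),
        1 <= K /\
        forall (n m : nat) (hnm : (n < m)%N),
          K_equivalent K (x n) (fun i : 'I_n.+1 => x m (widen_ord (leqW hnm) i))
      & forall k : nat -> nat, (forall i j, (i < j)%N -> (k i < k j)%N) ->
          K_isomorphic K [set: X] (closed_span (\bigcup_i E (k i))) ].
Proof.
move=> C0 hl [be ne'] [bx K1 hpre hrows].
have ne i : nm (e i) = 1 by apply: emb_inj; rewrite nmE ne' rmorph1.
have e0 i : e i != 0 by rewrite -nm_gt0 ne ltr01.
have dense := unconditional_basis_dense be.
have K0 : 0 <= K by apply: le_trans K1.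
have KK : K <= K * K by rewrite ler_peMl.
(* The isomorphisms have the product of two constants [K]; since [K <= K * K], the square serves for
   the prefixes as well. *)
exists (row_span e x), (fun n i => e (x (cell i))), (emb (K * K)); split.
  exact: (row_unconditional_fdd C0 hl ne dense bx).
split.
- move=> n; have h := row_finite_basis hl ne bx n; split=> //.
  by exists (fun i => e (x (cell i))).
- exact: (row_family_basis bx be).
- split; first by rewrite -(rmorph1 emb) emb_le (le_trans K1).
  move=> n m hnm a; have [h1 h2] := hpre n m hnm a.
  rewrite -!nmE -!rmorphM !emb_le; split.
    by apply: le_trans h1 _; rewrite ler_wpM2r ?nm_ge0.
  by apply: le_trans h2 _; rewrite ler_wpM2r ?nm_ge0.
- move=> k hk; have [t [tinj tr ht]] := hrows k hk.
  rewrite (rows_closed_span hl ne bx tr).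
  exact: eqvs_isomorphism C0 K0 hl e0 dense ht.
Qed.

End Decomposition.

End BanachSpaces.

(** * The scalar fields R and R[i] *)

Section RealOrComplex.
Import complex.

Lemma real_cauchy_cvg (R : realType) (u : nat -> R) :
  (forall eps : R, 0 < eps -> exists N, forall m n, (N <= m)%N -> (N <= n)%N ->
     `|u m - u n| <= eps) ->
  exists l, forall eps : R, 0 < eps -> exists N, forall n, (N <= n)%N ->
     `|u n - l| <= eps.
Proof.
move=> hu; have cu : cauchy (u @ \oo).
  apply: cauchy_exP => eps e0; have [|N hN] := hu (eps / 2); first lra.
  exists (u N); exists N => // n /= Nn; rewrite -ball_normE /=.
  by apply: le_lt_trans (hN N n (leqnn _) Nn) _; lra.
have /cauchy_cvg cu' := cu; exists (lim (u @ \oo)) => eps e0.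
move/cvgrPdist_le : cu' => /(_ eps e0) [N _ hN].
by exists N => n /hN; rewrite distrC.
Qed.

Lemma ger0_Re (R : realType) (z : R[i]) : 0 <= z -> z = (complex.Re z)%:C%C.
Proof. by case: z => a b; rewrite lecE /= => /andP[/eqP -> _]. Qed.

Lemma norm_Re_le (R : realType) (z : R[i]) : `|complex.Re z|%:C%C <= `|z|.
Proof. exact: normc_ge_Re. Qed.

Lemma norm_Im_le (R : realType) (z : R[i]) : `|complex.Im z|%:C%C <= `|z|.
Proof.
case: z => a b; rewrite normc_def lecR /= -sqrtr_sqr ler_wsqrtr //.
by rewrite lerDr sqr_ge0.
Qed.

Lemma norm_le_ReIm (R : realType) (z : R[i]) :
  `|z| <= (`|complex.Re z| + `|complex.Im z|)%:C%C.
Proof.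
case: z => a b; rewrite normc_def lecR /=.
rewrite -[leRHS]ger0_norm ?addr_ge0 // -sqrtr_sqr ler_wsqrtr //.
rewrite sqrrD !real_normK ?num_real // addrAC lerDl mulrn_wge0 // mulr_ge0 //.
Qed.

(** The splitting of the unit ball uses u = 0 over R and u = i over R[i]; completeness of R[i] is
    checked on real and imaginary parts. *)
Lemma real_or_complex_scalars (R : realType) (F : numFieldType) :
  real_or_complex R F -> inhabited (scalars R F).
Proof.
case; constructor.
- apply: (@Scalars R R idfun) => //.
  + by move=> z _; exists z.
  + exists 0; first by rewrite normr0.
    by move=> z hz; exists z, 0; rewrite normr0 mul0r addr0.
  + exact: real_cauchy_cvg.
- apply: (@Scalars R R[i] (real_complex R)).
  + by move=> x y; rewrite lecR.
  + by move=> z /ger0_Re ->; exists (complex.Re z).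
  + exists 'i%C; first by rewrite normc_def /= expr0n add0r expr1n sqrtr1.
    move=> z hz; exists (complex.Re z), (complex.Im z); split; last exact: complexE.
      by rewrite -lecR (le_trans (norm_Re_le z)).
    by rewrite -lecR (le_trans (norm_Im_le z)).
  + move=> u hu.
    have [|a ha] := @real_cauchy_cvg _ (fun n => complex.Re (u n)).
      move=> eps e0; have [N hN] := hu eps e0; exists N => m n Nm Nn.
      by rewrite -lecR -raddfB (le_trans (norm_Re_le _)) ?hN.
    have [|b hb] := @real_cauchy_cvg _ (fun n => complex.Im (u n)).
      move=> eps e0; have [N hN] := hu eps e0; exists N => m n Nm Nn.
      by rewrite -lecR -raddfB (le_trans (norm_Im_le _)) ?hN.
    exists (a +i* b)%C => eps e0; have e2 : 0 < eps / 2 by lra.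
    have [N1 h1] := ha _ e2; have [N2 h2] := hb _ e2.
    exists (maxn N1 N2) => n; rewrite geq_max => /andP[/h1 {}h1 /h2 {}h2].
    apply: le_trans (norm_le_ReIm _) _; rewrite lecR !raddfB /=; lra.
Qed.

End RealOrComplex.

(* [E n] and [x n] stand for E_(n+1) and (x_i^(n+1))_(i = 1..n+1). *)
Theorem theorem4p8 (R : realType) (F : numFieldType)
    (hF : real_or_complex R F) (X : completeNormedModType F)
    (hgenus : genus 2 X) (hc0 : contains_c0 X) :
  exists (E : nat -> set X) (x : forall n : nat, 'I_n.+1 -> X) (K : F),
    unconditional_fdd E /\
    [/\ forall n, has_dimension (E n) n.+1 /\ finite_basis (E n) (x n),
        unconditional_basis_family [set: X]
          (fun p : {n : nat & 'I_n.+1} => x (projT1 p) (projT2 p)),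
        1 <= K /\
        forall (n m : nat) (hnm : (n < m)%N),
          K_equivalent K (x n) (fun i : 'I_n.+1 => x m (widen_ord (leqW hnm) i))
      & forall k : nat -> nat, (forall i j, (i < j)%N -> (k i < k j)%N) ->
          K_isomorphic K [set: X] (closed_span (\bigcup_i E (k i))) ].
Proof.
have [S] := real_or_complex_scalars hF.
have [uX _ _] := hgenus; have [[e he] _] := uX; have [be ne'] := he.
have ne i : nm (e i) = 1 :> R by apply: (@emb_inj _ _ S); rewrite nmE ne' rmorph1.
have [C C1 hl] := unconditional_basis_constant (S := S) be.
have C0 : 0 <= C by apply: le_trans C1.
have [s0 [L0 [s0inj hs0]]] := c0_subsequence uX hc0 he C0 hl.
suff [x [K hx]] : exists x K, pyramid_indexing (S := S) e x K.
  exact: pyramid_decomposition C0 hl he hx.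
have [[L hL]|unb] := pselect (exists L, bounded_sums (S := S) L e).
  exact: (c0_pyramid_indexing C1 hl ne hL).
have [//|dich] := genus2_dichotomy hgenus he C0 hl s0inj hs0.
apply: (pyramid_indexing_exists C1 hl ne dich _ s0inj hs0).
(* Unbounded sums of [e] amount to largeness of the set of all indices. *)
move=> L; apply: contrapT => no; apply: unb; exists L => I al hal.
rewrite leNgt; apply/negP => Lal; apply: no; exists (map al (enum I)).
split=> //; first by rewrite map_inj_uniq // enum_uniq.
by rewrite /phi big_map big_enum.
Qed.
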